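(* For every reduced expression $\underline w_0$ of the longest element $w_0\in S_n$, $N=n(n-1)/2$, the following polyhedral objects coincide: (i) $\mathcal S_{\underline w_0}=\Xi_{\underline w_0}$; (ii) $S_{\underline w_0}=\mathsf\Xi_{\underline w_0}$; (iii) $\mathcal S_{\underline w_0}(\lambda)=\Xi_{\underline w_0}(\lambda)$ for all $\lambda\in\mathbb R^{n-1}$.
   Context: **Pseudoline arrangement.** Let $\underline w_0=s_{i_1}\cdots s_{i_N}$, $s_i=(i,i+1)$. $\mathrm{pa}(\underline w_0)$ is the planar wiring diagram with $n$ lines $l_1,\dots,l_n$ running from left to right, labelled at the left end from bottom to top; reading left to right, the $j$-th letter $s_{i_j}$ is a crossing of the lines at heights $i_j,i_j+1$ (level $i_j$). The right end of $l_i$ is a vertex $L_i$. A face has level $i\in\{1,\dots,n-1\}$ if it lies between heights $i$ and $i+1$. $F_i$ is the face of level $i$ unbounded to the left; $\hat F_j$ is the face of level $i_j$ bounded to the left by the $j$-th crossing. **GP-paths.** For $1\le i\le n-1$, the orientation $(l_i,l_{i+1})$ orients $l_1,\dots,l_i$ from right to left and $l_{i+1},\dots,l_n$ from left to right. An oriented path along the lines is rigorous if it never passes straight along a line $l_a$ through its crossing with a line $l_b$ when either $a<b$ and both lines are oriented to the left, or $a>b$ and both are oriented to the right. A GP-path of shape $(l_i,l_{i+1})$ is a rigorous oriented path, for this orientation, from $L_p$ to $L_q$ with $p\le i$, $q\ge i+1$, $w_0(i+1)\le w_0(p)\le w_0(i)$ and $w_0(i+1)\le w_0(q)\le w_0(i)$,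 $w_0(j)=n+1-j$ (so $p=i$, $q=i+1$). $\mathcal P_{\underline w_0}$ is the set of all GP-paths for all $i$. **Area cones.** $J(i)=\{j:i_j=i\}=\{j_1<\dots<j_{n_i}\}$. $\mathbb R^{N+n-1}$ has standard basis $e_F$, $F$ a face; $\mathbb R^N$ is the span of the $e_{\hat F_j}$. For $\mathbf p\in\mathcal P_{\underline w_0}$ let $A_{\mathbf p}$ be the union of the faces to the left of $\mathbf p$ (the region enclosed by $\mathbf p$), $e_{\mathbf p}=-\sum_{F\subset A_{\mathbf p}}e_F$; $e_{[i:k]}=-e_{F_i}-\sum_{r=1}^ke_{\hat F_{j_r}}$. $S_{\underline w_0}=\{x\in\mathbb R^N:e_{\mathbf p}^tx\ge0\ \forall\mathbf p\in\mathcal P_{\underline w_0}\}$, $\mathcal S_{\underline w_0}=\{x\in\mathbb R^{N+n-1}:e_{\mathbf p}^tx\ge0\ \forall\mathbf p\in\mathcal P_{\underline w_0},\ e_{[i:k]}^tx\ge0\ \forall1\le i\le n-1,\,0\le k\le n_i\}$, $\tau_{\underline w_0}(x)=(e_{[i:n_i]}^tx)_{i=1,\dots,n-1}$, $\mathcal S_{\underline w_0}(\lambda)=\mathcal S_{\underline w_0}\cap\tau_{\underline w_0}^{-1}(\lambda)$. **Quiver and seed.** The quiver $Q_{\underline w_0}$ has the faces as vertices. Let $\mathrm{start}(F)$ be the index of the crossing bounding $F$ on the left ($-\infty$ if none) and $\mathrm{end}(F)$ that on the right ($+\infty$ if none). Arrows: between two faces of the same level separated by one crossing, from left to right; if $G,H$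 have adjacent levels and $\mathrm{start}(H)<\mathrm{start}(G)<\mathrm{end}(H)<\mathrm{end}(G)$, an arrow $G\to H$. Faces unbounded to the left or right are frozen; arrows between frozen vertices are disregarded. The seed $s_{\underline w_0}$ has this quiver and coordinates $X_F=z^{e_F}$ on the torus $\mathcal X_{\underline w_0}$. **Superpotential.** Each seed $s$ obtained by iterated mutation at unfrozen vertices has a quiver with $\varepsilon_{ab}=\#(a\to b)-\#(b\to a)$ and a torus $\mathcal X_s=\operatorname{Spec}\mathbb C[X_{a,s}^{\pm1}]$, $X_{a,s}=z^{e_{a,s}}$. Mutation at an unfrozen $k$ is quiver mutation with the birational map $\mathcal X_s\dashrightarrow\mathcal X_{s'}$ whose pullback is $X_{k,s'}\mapsto X_{k,s}^{-1}$, $X_{a,s'}\mapsto X_{a,s}(1+X_{k,s}^{-\operatorname{sgn}\varepsilon_{ak}})^{-\varepsilon_{ak}}$ for $a\ne k$. $\mathcal X$ (dual to the $\mathcal A$-cluster variety $G^{e,w_0}=B\cap B^-w_0B^-$) is glued from these tori. For a frozen vertex $f$, $\vartheta_f$ is the function on $\mathcal X$ given by $z^{-e_{f,s_f}}$ in a seed $s_f$ in which $f$ is a sink (such a seed exists), and in other seeds by pulling back along mutations. $W=\sum_f\vartheta_f$ over all frozen vertices; $\vartheta_{(i,n)}$ denotes $\vartheta_f$ for the face $f$ of level $n-i$ unbounded to the right. For $g=\sum_ua_uz^u$, $g^{\mathrm{trop}}(x)=\min\{x\cdot u:a_u\ne0\}$. $\Xi_{\underline w_0}=\{x\in\mathbb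 R^{N+n-1}:(W|_{\mathcal X_{\underline w_0}})^{\mathrm{trop}}(x)\ge0\}$, $\mathsf\Xi_{\underline w_0}=\{x\in\mathbb R^N:(\sum_{i=1}^{n-1}\vartheta_{(i,n)}|_{\mathcal X_{\underline w_0}})^{\mathrm{trop}}(x)\ge0\}$, $\Xi_{\underline w_0}(\lambda)=\Xi_{\underline w_0}\cap\tau_{\underline w_0}^{-1}(\lambda)$. *)

(* Defs.v *)
From HB Require Import structures.
From mathcomp Require Import all_boot all_order all_fingroup all_algebra.
From mathcomp Require Import finmap complex classical_sets reals.
From mathcomp Require Import constructive_ereal.
(* The notations of mpoly clash with those of constructive_ereal. *)
From mathcomp Require Import -(notations) mpoly.

Set Implicit Arguments.
Unset Strict Implicit.
Unset Printing Implicit Defensive.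

Import Order.TTheory GRing.Theory Num.Theory.
Local Open Scope ring_scope.

(* Throughout n = r.+1, and all indices are shifted to start
   at 0: lines and heights range over 'I_r.+1, levels (hence letters, and the
   indices i = 1, ..., n-1) over 'I_r, crossings over 'I_N. *)

Section Words.
Variable r : nat.

Definition simple_refl (i : 'I_r) : {perm 'I_r.+1} :=
  tperm (widen_ord (leqnSn r) i) (lift ord0 i).

Definition longest : {perm 'I_r.+1} := perm (@rev_ord_inj r.+1).

(* perm.v composes from left to right: wordperm v sends h to the height
   reached by the line that starts at height h. The opposite convention
   yields the inverse, which for the longest element makes no difference. *)
Definition wordperm (v : seq 'I_r) : {perm 'I_r.+1} :=
  (\prod_(i <- v) simple_refl i)%g.

Definition reduced_expression (g : {perm 'I_r.+1}) (v : seq 'I_r) : Prop :=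
  wordperm v = g /\ forall v', wordperm v' = g -> (size v <= size v')%N.

End Words.

(* inl i is the face F_i, inr j is the face \hat F_j. *)
Notation face r N := ('I_r + 'I_N)%type.

Section Wiring.
Variables (r N : nat) (w : N.-tuple 'I_r).

Definition level (F : face r N) : 'I_r :=
  match F with inl i => i | inr j => tnth w j end.

(* Crossings are numbered 1, ..., N here; 0 stands for -oo and N.+1 for +oo. *)
Definition fstart (F : face r N) : nat :=
  match F with inl _ => 0%N | inr j => j.+1 end.

Definition fend (F : face r N) : nat :=
  (fstart F + find (pred1 (level F)) (drop (fstart F) w)).+1.

Definition right_unbounded (F : face r N) : bool := fend F == N.+1.

Definition frozen (F : face r N) : bool :=
  (fstart F == 0%N) || right_unbounded F.

Definition J (i : 'I_r) : seq 'I_N := [seq j <- enum 'I_N | tnth w j == i].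

Definition right_face (i : 'I_r) : face r N :=
  last (inl i) [seq inr j | j <- J i].

(* Slice t (0 <= t <= N) is a vertical line between the t-th and the
   (t+1)-st crossing; height t l is the height of the line l there. *)
Definition height (t : nat) (l : 'I_r.+1) : 'I_r.+1 := wordperm (take t w) l.

(* The line l takes part in the crossing number j (counted from 0), which
   separates the slices j and j.+1. *)
Definition meets (j : 'I_N) (l : 'I_r.+1) : bool :=
  (height j l == tnth w j :> nat) || (height j l == (tnth w j).+1 :> nat).

(* In the orientation (l_i, l_(i+1)). *)
Definition leftward (i : 'I_r) (l : 'I_r.+1) : bool := (l <= i)%N.

Definition forbidden (i : 'I_r) (j : 'I_N) (a : 'I_r.+1) : bool :=
  meets j a &&
  [exists b, [&& b != a, meets j b &
     [&& (a < b)%N, leftward i a & leftward i b]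
     || [&& (b < a)%N, ~~ leftward i a & ~~ leftward i b]]].

(* (l, t) is the point of the line l on the slice t. An oriented path is
   recorded by the points where it meets the slices; the right end of l is
   (l, N). Going from one point to the next means traversing the strip of
   exactly one crossing j, entered along a and left along b: a leftward line
   enters it at slice j.+1 and leaves it at slice j, a rightward line enters
   at j and leaves at j.+1. *)
Definition point : Type := ('I_r.+1 * nat)%type.

Definition step (i : 'I_r) : rel point := fun u v =>
  [exists j : 'I_N,
    [&& u.2 == (if leftward i u.1 then (j : nat).+1 else j),
        v.2 == (if leftward i v.1 then (j : nat) else j.+1)
      & if u.1 == v.1 then ~~ forbidden i j u.1
        else meets j u.1 && meets j v.1]].

Definition gp_path (i : 'I_r) (p : seq point) : bool :=
  match p with
  | [::] => false
  | u :: q => [&& u == (widen_ord (leqnSn r) i, N), path (step i) u q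
                & last u q == (lift ord0 i, N)]
  end.

(* p is closed up by a segment to the right of the slice N. The winding
   number of this loop around a point of F on the slice fstart F is counted
   along the upward vertical ray; the loop runs counterclockwise, with the
   enclosed region on its left. *)
Definition winding (i : 'I_r) (p : seq point) (F : face r N) : int :=
  let above u := (u.2 == fstart F) && (level F < height (fstart F) u.1)%N in
  (count (fun u : point => above u && leftward i u.1) p)%:Z
  - (count (fun u : point => above u && ~~ leftward i u.1) p)%:Z.

Definition enclosed (i : 'I_r) (p : seq point) (F : face r N) : bool :=
  winding i p F != 0.

Definition e (F : face r N) : {ffun face r N -> int} :=
  [ffun G => (G == F)%:R].

Definition e_path (i : 'I_r) (p : seq point) : {ffun face r N -> int} :=
  - \sum_(F | enclosed i p F) e F.

Definition e_seg (i : 'I_r) (k : nat) : {ffun face r N -> int} :=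
  - e (inl i) - \sum_(j <- take k (J i)) e (inr j).

Definition arrow (a b : face r N) : bool :=
  ((level a == level b) && (fend a == fstart b))
  || [&& (level a == (level b).+1 :> nat) || (level b == (level a).+1 :> nat),
         (fstart b < fstart a)%N, (fstart a < fend b)%N & (fend b < fend a)%N].

(* A quiver is given by its exchange matrix #(a -> b) - #(b -> a), with zero
   entries between frozen vertices. *)
Definition quiver0 (a b : face r N) : int :=
  if frozen a && frozen b then 0 else (arrow a b)%:Z - (arrow b a)%:Z.

Definition mutate_quiver (k : face r N) (q : face r N -> face r N -> int)
    (a b : face r N) : int :=
  if frozen a && frozen b then 0
  else if (a == k) || (b == k) then - q a b
  else q a b + Num.max 0 (q a k) * Num.max 0 (q k b)
             - Num.max 0 (q b k) * Num.max 0 (q k a).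

End Wiring.

Section Seeds.
Variables (R : realType) (r N : nat) (w : N.-tuple 'I_r).

(* The function field of the torus of the initial seed. *)
Definition ratfun : fieldType := {fraction (mpoly #|{: face r N}| R[i])}.

Definition X (F : face r N) : ratfun :=
  tofrac (mpolyX R[i] (mnm1 (enum_rank F))).

(* seed_coord F is the coordinate X_(F,s) of the seed s, pulled back to the
   initial torus along the mutations leading to s; since pullbacks are field
   morphisms, the mutation formula applies verbatim. *)
Record seed := Seed {
  seed_quiver : face r N -> face r N -> int;
  seed_coord : face r N -> ratfun }.

Definition seed0 : seed := Seed (quiver0 w) X.

Definition mutate (k : face r N) (s : seed) : seed :=
  let eps := seed_quiver s in let x := seed_coord s in
  Seed (mutate_quiver w k eps)
       (fun a => if a == k then (x k)^-1
                 else x a * (1 + x k ^ (- sgz (eps a k))) ^ (- eps a k)).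

Inductive is_seed : seed -> Prop :=
| is_seed0 : is_seed seed0
| is_seed_mutate s k : is_seed s -> ~~ frozen w k -> is_seed (mutate k s).

Definition sink_seed (f : face r N) (s : seed) : Prop :=
  is_seed s /\ forall a, seed_quiver s f a <= 0.

Section Potential.
Variable sf : face r N -> seed.

Definition theta (f : face r N) : ratfun := (seed_coord (sf f) f)^-1.

Definition W : ratfun := \sum_(f | frozen w f) theta f.

(* theta_(i,n) belongs to the right unbounded face of level n-i. *)
Definition theta_n (i : 'I_r) : ratfun := theta (right_face w (rev_ord i)).

End Potential.

(* Laurent polynomials: finitely supported families of coefficients. *)
Definition laurent : Type :=
  {fsfun {ffun face r N -> int} -> R[i] with 0}.

Definition laurent_fun (g : laurent) : ratfun :=
  \sum_(u <- finsupp g) tofrac (mpolyC _ (g u)) * \prod_F X F ^ (u F).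

Definition dot (x : {ffun face r N -> R}) (u : {ffun face r N -> int}) : R :=
  \sum_F x F * (u F)%:~R.

Definition trop (g : laurent) (x : {ffun face r N -> R}) : \bar R :=
  \big[Order.min/+oo%E]_(u <- finsupp g) (dot x u)%:E.

Local Open Scope classical_set_scope.

(* R^N inside R^(N+n-1) *)
Definition hat_space : set {ffun face r N -> R} :=
  [set x | forall i, x (inl i) = 0].

Definition area_cone : set {ffun face r N -> R} :=
  hat_space `&` [set x | forall i p, gp_path w i p -> 0 <= dot x (e_path w i p)].

Definition graded_area_cone : set {ffun face r N -> R} :=
  [set x | (forall i p, gp_path w i p -> 0 <= dot x (e_path w i p)) /\
           (forall i k, (k <= size (J w i))%N -> 0 <= dot x (e_seg w i k))].

Definition tau (x : {ffun face r N -> R}) : {ffun 'I_r -> R} :=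
  [ffun i => dot x (e_seg w i (size (J w i)))].

Definition graded_area_fiber (lam : {ffun 'I_r -> R}) :
    set {ffun face r N -> R} :=
  graded_area_cone `&` tau @^-1` [set lam].

Definition trop_nonneg (h : ratfun) : set {ffun face r N -> R} :=
  [set x | exists2 g : laurent, laurent_fun g = h & (0 <= trop g x)%E].

Definition Xi (sf : face r N -> seed) : set {ffun face r N -> R} :=
  trop_nonneg (W sf).

Definition Xi_hat (sf : face r N -> seed) : set {ffun face r N -> R} :=
  hat_space `&` trop_nonneg (\sum_(i < r) theta_n sf i).

Definition Xi_fiber (sf : face r N -> seed) (lam : {ffun 'I_r -> R}) :
    set {ffun face r N -> R} :=
  Xi sf `&` tau @^-1` [set lam].

End Seeds.

Arguments area_cone R {r N} w.
Arguments graded_area_cone R {r N} w.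
Arguments sink_seed {R r N} w f s.

(* Main.v *)
Require Import Defs.
From mathcomp Require Import all_boot all_order all_fingroup all_algebra reals.
From mathcomp Require Import finmap complex classical_sets constructive_ereal.
From mathcomp Require Import -(notations) mpoly.
From mathcomp Require Import boolp zify ring lra.

Set Implicit Arguments.
Unset Strict Implicit.
Unset Printing Implicit Defensive.

Import Order.TTheory GRing.Theory Num.Theory.
Local Open Scope ring_scope.

(** * Laurent polynomials as functions *)

(** All three identities come down to writing the potential, in the initial seed, as a sum of
    monomials with positive coefficients. A Laurent polynomial is determined by its values, so for
    such a sum the tropical condition is exactly the list of inequalities given by its exponents
    ([trop_nonneg_monomials]). What has to be shown is that theta of the left face of level i is the
    sum of the monomials with exponents e_[i:k], k < n_i ([theta_left]), and that theta of a right
    face is the sum of the monomials with exponents e_p, one for each region enclosed by a GP-path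
    of the corresponding shape ([theta_right]). The one inequality of the graded cone that does not
    occur in W, that of e_[i:n_i], is the sum of two that do, because the right face of level i
    alone is enclosed by a GP-path ([e_seg_size]).

    Independence of the sink seed ([sink_seed_coord]). If f is a sink, then 1/x_f is Laurent in the
    seed and in all neighbouring seeds. A rank two computation along the divisor x_l = -1 shows that
    this property passes to every mutated seed ([universal_run]), so 1/x_f is Laurent in all seeds.
    An auxiliary frozen vertex with one arrow to f, together with a mutation at f, shows that its
    expansion is 1/x'_f times a Laurent polynomial with constant term 1 ([sink_pointed]). If f is a
    sink at both ends of a run of mutations, the quotient of its two coordinates and the inverse
    quotient both have constant term 1; growth along monomial curves, governed by tropical mutation,
    then forces the quotient to be 1 ([sink_unique_pos]).

    Left faces. Mutating at the unfrozen faces of level i from left to right makes F_i a sink, and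
    its coordinate is computed in closed form ([left_quiver_sink], [left_coordE]).

    Right faces. Regions enclosed by GP-paths are encoded by sets of faces subject to local
    conditions at the crossings ([adm]), with generating function [Theta]. A commutation move only
    relabels faces; a braid move is the mutation at the triangle ([braid_quiver]). [Theta] is
    compatible with both ([comm_Theta], [braid_Theta]), in the second case by a local identity
    summed over the two states of the triangle ([braid_weights]). Every simple reflection is a
    descent of w_0, so braid moves lead to a word ending in any given letter l ([braid_to_descent]).
    There the right face of level l is a sink and the only admissible set consists of this face
    ([last_sink], [adm_last]). Transporting this along the moves gives [right_sink].

    GP-paths and admissible sets. The winding numbers of a GP-path satisfy the local conditions in
    the form of inequalities, and a discrete maximum principle ([max_principle]) shows that they are
    0 or 1, so the path gives an admissible set ([path_adm]). Conversely, the boundary of an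
    admissible set is traced by a GP-path ([gp_path_exists]), and the maximum principle applied to a
    difference shows that this path encloses exactly the given set ([adm_path]). *)

Definition lmono (I : finType) (K : fieldType) (u : {ffun I -> int})
    (x : I -> K) : K := \prod_a x a ^ u a.

Definition lsum (I : finType) (K : fieldType) (s : seq (K * {ffun I -> int}))
    (x : I -> K) : K := \sum_(p <- s) p.1 * lmono p.2 x.

(** * Laurent polynomials are determined by their values at positive integers *)

Section Independence.
Variables (K : numFieldType).

Lemma poly_nat_roots (p : {poly K}) :
  (forall t : nat, (0 < t)%N -> p.[t%:R] = 0) -> p = 0.
Proof.
move=> p0; apply: (@roots_geq_poly_eq0 _ _ [seq t.+1%:R | t <- iota 0 (size p)]).
- by apply/allP=> _ /mapP[t _ ->]; apply/rootP/p0.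
- rewrite map_inj_uniq ?iota_uniq // => s t /eqP.
  by rewrite eqr_nat eqSS => /eqP.
- by rewrite size_map size_iota.
Qed.

Lemma exists_nat_nonroot (p : {poly K}) : p != 0 ->
  exists2 t : nat, (0 < t)%N & p.[t%:R] != 0.
Proof.
move=> p0; apply: contrapT => nt; move/eqP: p0; apply; apply: poly_nat_roots.
by move=> t t0; apply/eqP/negP => /negP pt; apply: nt; exists t.
Qed.

(** Multiplying by a power of t larger than every exponent involved turns the sum into a polynomial
    with infinitely many roots. *)
Lemma laurent1_eq0 (s : seq (K * int)) :
  (forall t : nat, (0 < t)%N -> \sum_(p <- s) p.1 * t%:R ^ p.2 = 0) ->
  forall e, \sum_(p <- s | p.2 == e) p.1 = 0.
Proof.
move=> s0 e.
pose E := (\sum_(p <- s) `|p.2| + `|e|)%N.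
have Eb p : p \in s -> 0 <= p.2 + E%:Z.
  move=> ps; have : (`|p.2| <= \sum_(p <- s) `|p.2|)%N.
    by rewrite (big_rem p) //= leq_addr.
  by rewrite /E; lia.
pose P := \sum_(p <- s) p.1 *: 'X^(absz (p.2 + E%:Z)).
have P0 : P = 0.
  apply: poly_nat_roots => t t0; rewrite horner_sum.
  transitivity (t%:R ^+ E * \sum_(p <- s) p.1 * t%:R ^ p.2); last first.
    by rewrite s0 ?mulr0.
  rewrite mulr_sumr; apply: eq_big_seq => p ps.
  rewrite hornerZ hornerXn mulrCA; congr (_ * _).
  rewrite (_ : _ ^+ `|_| = t%:R ^ (p.2 + E%:Z)); last by rewrite -[in RHS](gez0_abs (Eb _ ps)).
  by rewrite expfzDr ?pnatr_eq0 -?lt0n // mulrC.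
have := congr1 (fun q : {poly K} => q`_(absz (e + E%:Z))) P0.
rewrite coef0 coef_sum => eP; transitivity (\sum_(p <- s) (p.1 *: 'X^(absz (p.2 + E%:Z)) : {poly K})`_(absz (e + E%:Z))) => //.
rewrite big_mkcond /=; apply: eq_big_seq => p ps.
rewrite coefZ coefXn.
have -> : (absz (e + E%:Z) == absz (p.2 + E%:Z)) = (p.2 == e).
  have := Eb _ ps; have : 0 <= e + E%:Z by rewrite /E; lia.
  by move=> ? ?; apply/eqP/eqP => [|->//]; lia.
by case: eqP; rewrite ?mulr1 ?mulr0.
Qed.

End Independence.

Section Laurent.
Variables (I : finType) (K : numFieldType).
Implicit Types (u : {ffun I -> int}) (s : seq (K * {ffun I -> int})).

Definition idot u (v : I -> int) : int := \sum_a u a * v a.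

(** Take v_a = t ^ rank(a): the pairing with u becomes the value at t of the polynomial with
    coefficients u, and t is chosen away from the roots of all differences. *)
Lemma exists_separating (us : seq {ffun I -> int}) :
  exists v : I -> nat, {in us &, injective (fun u => idot u (fun a => (v a)%:Z))}.
Proof.
pose pd (d : {ffun I -> int}) : {poly rat} :=
  \sum_a (d a)%:~R *: 'X^(enum_rank a).
have pd_coef d a : (pd d)`_(enum_rank a) = (d a)%:~R.
  rewrite coef_sum (bigD1 a) //= coefZ coefXn eqxx mulr1 big1 ?addr0 // => b ba.
  rewrite coefZ coefXn; case: eqP => [/ord_inj/enum_rank_inj e|_]; last by rewrite mulr0.
  by rewrite e eqxx in ba.
have pd0 d : d != 0 -> pd d != 0.
  apply: contra => /eqP d0; apply/eqP/ffunP => a; rewrite ffunE.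
  by apply/eqP; rewrite -(intr_eq0 rat) -pd_coef d0 coef0.
pose P := \prod_(u1 <- us) \prod_(u2 <- us | u1 != u2) pd (u1 - u2).
have : P != 0.
  rewrite /P prodf_seq_neq0; apply/allP => u1 _ /=.
  rewrite prodf_seq_neq0; apply/allP => u2 _ /=; apply/implyP => ne.
  by apply: pd0; rewrite subr_eq0.
case/exists_nat_nonroot => t t0; rewrite /P horner_prod prodf_seq_neq0 => /allP Pt.
exists (fun a => (t ^ enum_rank a)%N) => u1 u2 i1 i2 e.
apply/eqP/negP => /negP ne.
have := Pt _ i1; rewrite /= horner_prod prodf_seq_neq0 => /allP/(_ _ i2).
rewrite /= ne /= horner_sum => /eqP; apply.
have := congr1 (fun z : int => z%:~R : rat) e.
rewrite /idot !rmorph_sum /= => /eqP; rewrite -subr_eq0 -sumrB => /eqP e'.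
transitivity (\sum_a ((u1 a * (t ^ enum_rank a)%N%:Z)%:~R - (u2 a * (t ^ enum_rank a)%N%:Z)%:~R : rat)) => //.
apply: eq_bigr => a _.
rewrite hornerZ hornerXn !ffunE !rmorphM rmorphB /= mulrBl.
by rewrite -!pmulrn natrX.
Qed.

Lemma lmono_dir u (v : I -> int) (y : I -> K) (t : K) : t != 0 ->
  lmono u (fun a => y a * t ^ v a) = lmono u y * t ^ idot u v.
Proof.
move=> t0; rewrite /lmono /idot (big_morph _ (fun m n => expfzDr m n t0) (expr0z t)).
rewrite -big_split; apply: eq_bigr => a _ /=.
by rewrite expfzMl exprz_exp mulrC [v a * _]mulrC mulrC.
Qed.

(** On the curve a |-> t ^ v_a with separating v, distinct exponents give distinct powers of t. The
    list may repeat exponents, so coefficients are collected. *)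
Lemma lsum_indep s :
  (forall y : I -> nat, (forall a, (0 < y a)%N) -> lsum s (fun a => (y a)%:R) = 0) ->
  forall u, \sum_(p <- s | p.2 == u) p.1 = 0.
Proof.
move=> s0 u.
have [v vinj] := exists_separating (u :: [seq p.2 | p <- s]).
pose s' := [seq (p.1, idot p.2 (fun a => (v a)%:Z)) | p <- s].
have H : forall e, \sum_(p <- s') (if p.2 == e then p.1 else 0) = 0.
  move=> e; rewrite -big_mkcond; apply: laurent1_eq0 => t t0.
  rewrite big_map /=.
  rewrite -[RHS](s0 (fun a => (t ^ v a)%N)); last by move=> a; rewrite expn_gt0 t0.
  apply: eq_bigr => p _; congr (_ * _).
  have /= := @lmono_dir p.2 (fun a => (v a)%:Z) (fun=> 1) t%:R.
  rewrite pnatr_eq0 -lt0n => /(_ t0).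
  rewrite [X in _ = X * _]/lmono big1 ?mul1r => [<-|a _]; last by rewrite exp1rz.
  by rewrite /lmono; apply: eq_bigr => a _; rewrite mul1r natrX.
rewrite -[RHS](H (idot u (fun a => (v a)%:Z))) big_map -big_mkcond /=.
rewrite big_seq_cond [RHS]big_seq_cond; apply: eq_bigl => p; case ps: (p \in s) => //=.
apply/eqP/eqP => [->//|]; apply: vinj; rewrite inE ?eqxx ?orbT //.
by rewrite map_f ?orbT.
Qed.

Lemma lsum_undup s x : lsum s x =
  \sum_(u <- undup [seq p.2 | p <- s]) (\sum_(p <- s | p.2 == u) p.1) * lmono u x.
Proof.
rewrite /lsum.
under [RHS]eq_bigr => u _ do rewrite mulr_suml big_mkcond /=.
rewrite exchange_big /=; apply: eq_big_seq => p ps.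
rewrite (bigD1_seq p.2) ?undup_uniq ?mem_undup ?map_f //= eqxx big1 ?addr0 //.
by move=> u /negPf; rewrite eq_sym => ->.
Qed.

Lemma lsum_eq0 s :
  (forall y : I -> nat, (forall a, (0 < y a)%N) -> lsum s (fun a => (y a)%:R) = 0) ->
  forall x, lsum s x = 0.
Proof.
move=> s0 x; rewrite lsum_undup big1 // => u _.
by rewrite (lsum_indep s0) mul0r.
Qed.

End Laurent.

(** * Laurent functions and orders along the divisor x_l = -1 *)

Section LaurentFunctions.
Variables (I : finType) (R : realFieldType).
Implicit Types (F G : (I -> R) -> R) (x : I -> R) (l : I).

Definition pos x := forall a, 0 < x a.
Definition nonzero x := forall a, x a != 0.
(** Agreement is required at all points without zero coordinates, not just at positive ones, so that
    such a function can be evaluated on the divisor x_l = -1. *)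
Definition laur F := exists s, forall x, nonzero x -> F x = lsum s x.

Lemma pos_nonzero x : pos x -> nonzero x.
Proof. by move=> px a; rewrite gt_eqF. Qed.

Lemma eq_laur F G : laur G -> (forall x, nonzero x -> F x = G x) -> laur F.
Proof. by move=> [s Gs] FG; exists s => x nx; rewrite FG // Gs. Qed.

Lemma laurD F G : laur F -> laur G -> laur (fun x => F x + G x).
Proof.
move=> [s Fs] [t Gt]; exists (s ++ t) => x nx.
by rewrite Fs // Gt // /lsum big_cat.
Qed.

Lemma laurM F G : laur F -> laur G -> laur (fun x => F x * G x).
Proof.
move=> [s Fs] [t Gt].
exists [seq (p.1 * q.1, [ffun a => p.2 a + q.2 a]) | p : R * {ffun I -> int} <- s, q : R * {ffun I -> int} <- t] => x nx.
rewrite Fs // Gt // /lsum big_allpairs_dep big_distrl /=; apply: eq_bigr => p _.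
rewrite big_distrr; apply: eq_bigr => q _ /=; rewrite mulrACA; congr (_ * _).
by rewrite /lmono -big_split; apply: eq_bigr => a _; rewrite ffunE expfzDr.
Qed.

Lemma laur_cst (c : R) : laur (fun=> c).
Proof.
exists [:: (c, [ffun=> 0])] => x nx; rewrite /lsum big_seq1 /lmono big1 ?mulr1 //.
by move=> a _; rewrite ffunE expr0z.
Qed.

Lemma laur_expz l (n : int) : laur (fun x => x l ^ n).
Proof.
exists [:: (1, [ffun a => if a == l then n else 0])] => x nx.
rewrite /lsum big_seq1 mul1r /lmono (bigD1 l) //= ffunE eqxx big1 ?mulr1 //.
by move=> a /negPf al; rewrite ffunE al expr0z.
Qed.

Lemma laur_coord l : laur (fun x => x l).
Proof. exact: (laur_expz l 1). Qed.

Lemma laurX F n : laur F -> laur (fun x => F x ^+ n).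
Proof.
move=> lF; elim: n => [|n IH]; first exact: laur_cst.
by apply: eq_laur (laurM lF IH) _ => x _; rewrite exprS.
Qed.

Lemma laur_sum (J : Type) (s : seq J) (F : J -> (I -> R) -> R) :
  (forall j, laur (F j)) -> laur (fun x => \sum_(j <- s) F j x).
Proof.
move=> lF; elim: s => [|j s IH].
  by apply: eq_laur (laur_cst 0) _ => x _; rewrite big_nil.
by apply: eq_laur (laurD (lF j) IH) _ => x _; rewrite big_cons.
Qed.

Lemma laur_eq0 F : laur F -> (forall x, pos x -> F x = 0) ->
  forall x, nonzero x -> F x = 0.
Proof.
move=> [s Fs] F0 x nx; rewrite Fs //; apply: lsum_eq0 => y y0.
have py : pos (fun a => (y a)%:R) by move=> a; rewrite ltr0n.
by rewrite -Fs ?F0 //; apply: pos_nonzero.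
Qed.

(** Identities between rational functions are checked on the positive orthant, where no denominator
    vanishes; this carries them over to the wall. *)
Lemma laur_ext F G : laur F -> laur G -> (forall x, pos x -> F x = G x) ->
  forall x, nonzero x -> F x = G x.
Proof.
move=> lF lG FG x nx; apply/eqP; rewrite -subr_eq0; apply/eqP.
apply: (laur_eq0 (F := fun x => F x - G x)) => // [|y py]; last by rewrite FG ?subrr.
apply: eq_laur (laurD lF (laurM (laur_cst (-1)) lG)) _ => y _.
by rewrite mulN1r.
Qed.

Definition subst l (t : R) x : I -> R := fun a => if a == l then t else x a.

(* The wall is the divisor of the mutation at l. *)
Definition wall l x := x l = -1 /\ forall a, a != l -> 0 < x a.

Lemma wall_subst l x : pos x -> wall l (subst l (-1) x).
Proof. by move=> px; split=> [|a /negPf al]; rewrite /subst ?eqxx // al. Qed.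

Lemma wall_nonzero l x : wall l x -> nonzero x.
Proof.
move=> [xl xp] a; have [->|al] := eqVneq a l; first by rewrite xl oppr_eq0 oner_eq0.
by rewrite gt_eqF ?xp.
Qed.

Lemma expz_wall_quotient l (n : int) : exists Q, laur Q /\ forall x, nonzero x ->
  x l ^ n = (-1) ^ n + (1 + x l) * Q x.
Proof.
elim/int_rec: n => [|n [Q [lQ QE]]|n [Q [lQ QE]]].
- exists (fun=> 0); split=> [|x _]; first exact: laur_cst.
  by rewrite !expr0z mulr0 addr0.
- exists (fun x => (-1) ^ n%:Z + x l * Q x); split=> [|x nx].
    by apply: laurD (laur_cst _) (laurM (laur_coord l) lQ).
  rewrite intS !expfzDr ?oppr_eq0 ?oner_eq0 // QE // !expr1z; ring.
exists (fun x => x l ^ (-1) * ((-1) ^ (- n%:Z) + Q x)); split=> [|x nx].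
  by apply: laurM (laur_expz l _) (laurD (laur_cst _) lQ).
have n1 : -1 != 0 :> R by rewrite oppr_eq0 oner_eq0.
rewrite intS opprD !expfzDr // QE // !exprN1 invrN1; have := nx l => ?; by field.
Qed.

(** Division of each power of x_l by 1 + x_l leaves its value at -1 as remainder. The remainders add
    up to the restriction of F to the wall, which is zero. *)
Lemma laur_divides_wall l F : laur F -> (forall x, wall l x -> F x = 0) ->
  exists Q, laur Q /\ forall x, nonzero x -> F x = (1 + x l) * Q x.
Proof.
move=> [s Fs] F0.
have [q qP] := choice (expz_wall_quotient l).
pose rest (u : {ffun I -> int}) : {ffun I -> int} :=
  [ffun a => if a == l then 0 else u a].
have rl u : laur (lmono (rest u)).
  by exists [:: (1, rest u)] => x _; rewrite /lsum big_seq1 mul1r.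
have monoE u x : lmono u x = lmono (rest u) x * x l ^ u l.
  rewrite /lmono (bigD1 l) //= [in RHS](bigD1 l) //= ffunE eqxx expr0z mul1r mulrC.
  by congr (_ * _); apply: eq_bigr => a /negPf al; rewrite ffunE al.
have restE u x t : lmono (rest u) (subst l t x) = lmono (rest u) x.
  apply: eq_bigr => a _; rewrite ffunE /subst.
  by case: eqP => // ->; rewrite !expr0z.
exists (fun x => \sum_(p <- s) p.1 * lmono (rest p.2) x * q (p.2 l) x); split.
  apply: laur_sum => p; apply: laurM; last exact: (qP _).1.
  by apply: laurM (laur_cst _) (rl _).
pose F0' x := \sum_(p <- s) p.1 * lmono (rest p.2) x * (-1) ^ p.2 l.
have F0E x : nonzero x -> F0' x = 0.
  apply: laur_eq0 => {x} [|x px].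
    by apply: laur_sum => p; apply: laurM (laurM (laur_cst _) (rl _)) (laur_cst _).
  rewrite -[RHS](F0 _ (wall_subst l px)) Fs; last exact/wall_nonzero/wall_subst.
  apply: eq_bigr => p _; rewrite [lmono p.2 _]monoE restE mulrA.
  by rewrite /subst eqxx.
move=> x nx; rewrite Fs // -[RHS]add0r -{1}(F0E _ nx) mulr_sumr -big_split /=.
apply: eq_bigr => p _; rewrite [lmono p.2 _]monoE (qP _).2 //; ring.
Qed.

Section Wall.
Variable l : I.

(* F is (1 + x_l)^n times a unit of the local ring of the divisor x_l = -1. *)
Definition order (n : int) F := exists A B, [/\ laur A, laur B,
  forall x, wall l x -> A x != 0 /\ B x != 0 &
  forall x, pos x -> F x * B x = (1 + x l) ^ n * A x].

(** Absence of a pole along the wall: denominators are allowed as long as they do not vanish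
    there. *)
Definition integral F := exists A B, [/\ laur A, laur B,
  forall x, wall l x -> B x != 0 & forall x, pos x -> F x * B x = A x].

Lemma p1_gt0 x : pos x -> 0 < 1 + x l.
Proof. by move=> px; rewrite addr_gt0. Qed.

Lemma p1_neq0 x : pos x -> 1 + x l != 0.
Proof. by move=> px; rewrite gt_eqF ?p1_gt0. Qed.

Lemma eq_order n F G : order n G -> (forall x, pos x -> F x = G x) -> order n F.
Proof.
move=> [A [B [lA lB AB GE]]] FG; exists A, B; split=> // x px.
by rewrite FG // GE.
Qed.

Lemma orderM m n F G : order m F -> order n G -> order (m + n) (fun x => F x * G x).
Proof.
move=> [A [B [lA lB AB FE]]] [A' [B' [lA' lB' AB' GE]]].
exists (fun x => A x * A' x), (fun x => B x * B' x); split; try exact: laurM.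
  by move=> x wx; have [? ?] := AB _ wx; have [? ?] := AB' _ wx; rewrite !mulf_neq0.
by move=> x px; rewrite mulrACA FE // GE // mulrACA -expfzDr ?p1_neq0.
Qed.

Lemma orderV n F : (forall x, pos x -> F x != 0) -> order n F ->
  order (- n) (fun x => (F x)^-1).
Proof.
move=> F0 [A [B [lA lB AB FE]]]; exists B, A; split=> //.
  by move=> x wx; have [? ?] := AB _ wx.
move=> x px; apply: (mulfI (F0 _ px)); rewrite mulrA mulfV ?F0 // mul1r mulrCA FE //.
by rewrite mulrA -expfzDr ?p1_neq0 // addNr expr0z mul1r.
Qed.

Lemma laur_order0 F : laur F -> (forall x, wall l x -> F x != 0) -> order 0 F.
Proof.
move=> lF F0; exists F, (fun=> 1); split=> // [|x wx|x px].
- exact: laur_cst.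
- by rewrite oner_eq0 F0.
- by rewrite mulr1 expr0z mul1r.
Qed.

Lemma order_coord a : order 0 (fun x => x a).
Proof. by apply: laur_order0 (laur_coord a) _ => x /wall_nonzero. Qed.

Lemma order_wall : order 1 (fun x => 1 + x l).
Proof.
exists (fun=> 1), (fun=> 1); split=> [||x _|x _]; try exact: laur_cst.
  by rewrite oner_eq0.
by rewrite !mulr1.
Qed.

Lemma orderX n F (m : int) : (forall x, pos x -> F x != 0) -> order n F ->
  order (n * m) (fun x => F x ^ m).
Proof.
move=> F0 oF.
have oX (k : nat) : order (n * k%:Z) (fun x => F x ^+ k).
  elim: k => [|k IH].
    by rewrite mulr0; apply: laur_order0 (laur_cst 1) _ => *; rewrite oner_eq0.
  rewrite intS mulrDr mulr1; apply: eq_order (orderM oF IH) _ => x _.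
  by rewrite exprS.
case: m => m; first exact: oX.
rewrite NegzE mulrN; apply: eq_order (orderV _ (oX m.+1)) _ => x px.
  by rewrite expf_neq0 ?F0.
by rewrite -exprnN.
Qed.


Lemma integralD F G : integral F -> integral G -> integral (fun x => F x + G x).
Proof.
move=> [A [B [lA lB AB FE]]] [A' [B' [lA' lB' AB' GE]]].
exists (fun x => A x * B' x + A' x * B x), (fun x => B x * B' x); split.
- by apply: laurD; apply: laurM.
- exact: laurM.
- by move=> x wx; rewrite mulf_neq0 ?AB ?AB'.
- by move=> x px; rewrite -FE // -GE //; ring.
Qed.

Lemma integralM F G : integral F -> integral G -> integral (fun x => F x * G x).
Proof.
move=> [A [B [lA lB AB FE]]] [A' [B' [lA' lB' AB' GE]]].
exists (fun x => A x * A' x), (fun x => B x * B' x); split; try exact: laurM.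
- by move=> x wx; rewrite mulf_neq0 ?AB ?AB'.
- by move=> x px; rewrite -FE // -GE //; ring.
Qed.

Lemma laur_integral F : laur F -> integral F.
Proof.
move=> lF; exists F, (fun=> 1); split=> // [|x wx|x px].
- exact: laur_cst.
- exact: oner_neq0.
- by rewrite mulr1.
Qed.

Lemma order0_integral F : order 0 F -> integral F.
Proof.
move=> [A [B [lA lB AB FE]]]; exists A, B; split=> // x.
  by move=> /AB[].
by move=> px; rewrite FE // expr0z mul1r.
Qed.

Lemma eq_integral F G : integral G -> (forall x, pos x -> F x = G x) -> integral F.
Proof.
move=> [A [B [lA lB AB GE]]] FG; exists A, B; split=> // x px.
by rewrite FG // GE.
Qed.

Definition wall_laur F := exists (d : nat) P, laur P /\
  forall x, pos x -> F x * (1 + x l) ^+ d = P x.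

(** If F has no pole on the wall, the numerator over (1 + x_l)^(d+1) vanishes there, so a factor 1 +
    x_l can be cancelled, until no denominator is left. *)
Lemma integral_laur F : wall_laur F -> integral F ->
  exists P, laur P /\ forall x, pos x -> F x = P x.
Proof.
move=> [d]; elim: d => [|d IH] [P [lP PE]] iF.
  by exists P; split=> // x px; rewrite -PE // mulr1.
have [A [B [lA lB B0 FE]]] := iF.
have l1 : laur (fun x => 1 + x l) by apply: laurD (laur_cst 1) (laur_coord l).
have PB x : nonzero x -> P x * B x = A x * (1 + x l) ^+ d.+1.
  apply: (laur_ext (laurM lP lB) (laurM lA (laurX _ l1))) => {}x px.
  by rewrite -PE // -FE //; ring.
have [x wx|Q [lQ QE]] := laur_divides_wall lP _ (l := l).
  have := PB _ (wall_nonzero wx); rewrite wx.1 subrr exprS mul0r mulr0 => /eqP.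
  by rewrite mulf_eq0 (negPf (B0 _ wx)) orbF => /eqP.
apply: IH => //; exists Q; split=> // x px.
by apply: (mulfI (p1_neq0 px)); rewrite -(QE _ (pos_nonzero px)) -(PE _ px) exprS; ring.
Qed.

End Wall.
End LaurentFunctions.

(** * Mutation on abstract index sets, and three consecutive mutations at two vertices *)

(** Unlike in [mutate_quiver], no vertex is declared frozen and no entry is reset to zero; the two
    rules are compared on the relevant entries in [agree_run]. *)
Definition qmut (I : eqType) (k : I) (q : I -> I -> int) (a b : I) : int :=
  if (a == k) || (b == k) then - q a b
  else q a b + Num.max 0 (q a k) * Num.max 0 (q k b)
             - Num.max 0 (q b k) * Num.max 0 (q k a).

Definition xmut (I : eqType) (K : fieldType) (k : I) (q : I -> I -> int)
    (x : I -> K) (a : I) : K :=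
  if a == k then (x k)^-1
  else x a * (1 + x k ^ (- sgz (q a k))) ^ (- q a k).

Definition skew (I : Type) (q : I -> I -> int) := forall a b, q a b = - q b a.

Section RankTwo.
Variables (I : finType) (R : realFieldType).
Implicit Types (q : I -> I -> int) (x : I -> R) (F : (I -> R) -> R).

Lemma qmut_skew k q : skew q -> skew (qmut k q).
Proof.
move=> sq a b; rewrite /qmut orbC; case: ifP => _; first by rewrite sq opprK.
by rewrite [q a b]sq; ring.
Qed.

Lemma qmutK k q : skew q -> qmut k (qmut k q) = q.
Proof.
move=> sq; apply/funext => a; apply/funext => b; rewrite /qmut eqxx !orbT !orTb.
case: eqP => [->|_]; first by rewrite opprK.
case: eqP => [->|_] /=; first by rewrite opprK.
rewrite -[- q a k]sq -[- q k b]sq -[- q b k]sq -[- q k a]sq; ring.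
Qed.

Lemma xmut_pos k q x : pos x -> pos (xmut k q x).
Proof.
move=> px a; rewrite /xmut; case: eqP => _; rewrite ?invr_gt0 ?px //.
by rewrite mulr_gt0 ?px // exprz_gt0 // addr_gt0 // exprz_gt0.
Qed.

Lemma xmutK k q x : pos x -> xmut k (qmut k q) (xmut k q x) = x.
Proof.
move=> px; apply/funext => a; rewrite /xmut eqxx invrK.
case: (altP eqP) => [->//|ak]; rewrite /qmut eqxx orbT.
rewrite sgzN exprz_inv opprK -mulrA -expfzDr ?subrr ?expr0z ?mulr1 //.
by rewrite gt_eqF // addr_gt0 // exprz_gt0.
Qed.

Section Wall.
Variable l : I.

Lemma order_factor (F : (I -> R) -> R) (e m : int) :
  (forall x, pos x -> 0 < F x) ->
  (0 < e -> order l m (fun x => 1 + (F x)^-1)) ->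
  (e < 0 -> order l m (fun x => 1 + F x)) ->
  order l (- (m * e)) (fun x => (1 + F x ^ (- sgz e)) ^ (- e)).
Proof.
move=> F0 pe ne; have [e0|e0|->] := ltrgt0P e.
- rewrite -mulrN gtr0_sgz //; apply: orderX (pe e0) => x px.
  by rewrite gt_eqF // addr_gt0 ?invr_gt0 ?F0.
- rewrite -mulrN ltr0_sgz // opprK; apply: orderX (ne e0) => x px.
  by rewrite gt_eqF // addr_gt0 ?F0.
rewrite mulr0 oppr0.
by apply: laur_order0 => [|x _]; rewrite ?expr0z ?oner_eq0 //; exact: laur_cst.
Qed.

Lemma orderV1 F : (forall x, pos x -> 0 < F x) -> order l 0 F ->
  order l 1 (fun x => 1 + F x) -> order l 1 (fun x => 1 + (F x)^-1).
Proof.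
move=> F0 oF o1; rewrite -(addr0 1) -oppr0.
apply: eq_order (orderM o1 (orderV _ oF)) _ => x px.
  by rewrite gt_eqF ?F0.
by have := F0 _ px => /lt0r_neq0 ?; field.
Qed.

Variables (k : I) (q : I -> I -> int).
Hypotheses (kl : k != l) (sq : skew q).
Let q1 := qmut l q.
Let x1 x := xmut l q x.
Let q2 := qmut k q1.
Let x2 x := xmut k q1 (x1 x).
Let x3 x := xmut l q2 (x2 x).
Let lk : l == k = false. Proof. by rewrite eq_sym (negPf kl). Qed.

Let x1p x : pos x -> pos (x1 x). Proof. exact: xmut_pos. Qed.
Let x2p x : pos x -> pos (x2 x). Proof. by move=> px; apply/xmut_pos/x1p. Qed.
Let x3p x : pos x -> pos (x3 x). Proof. by move=> px; apply/xmut_pos/x2p. Qed.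

Let x1_order a : a != l -> order l (- q a l) (fun x => x1 x a).
Proof.
move=> /negPf al; rewrite -[- _]add0r -(mul1r (q a l)).
have oF := order_factor (F := fun x => x l) (m := 1) (e := q a l).
apply: eq_order (orderM (order_coord R l a) (oF _ _ _)) _.
- by move=> x px.
- by move=> _; apply: orderV1 (order_coord R l l) (order_wall R l).
- by move=> _; apply: order_wall.
- by move=> x px; rewrite /x1 /xmut al.
Qed.

Let q1lk : q1 l k = q k l.
Proof. by rewrite /q1 /qmut eqxx -sq. Qed.

Let x1l x : x1 x l = (x l)^-1.
Proof. by rewrite /x1 /xmut eqxx. Qed.

Let U x := 1 + x1 x k ^ (- sgz (q k l)).

Let x2l x : x2 x l = (x l)^-1 * U x ^ (- q k l).
Proof. by rewrite /x2 /xmut lk x1l q1lk. Qed.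

Let U_gt0 x : pos x -> 0 < U x.
Proof. by move=> px; rewrite addr_gt0 // exprz_gt0 // x1p. Qed.

Let x1k_pos n x : pos x -> q k l = n.+1%:Z ->
  (x1 x k)^-1 = (x k)^-1 * (1 + x l) ^+ n.+1 / x l ^+ n.+1.
Proof.
move=> px e; rewrite /x1 /xmut (negPf kl) e gtr0_sgz // exprN1.
have p := p1_gt0 l px; have xl := px l; have xk := px k.
have -> : 1 + (x l)^-1 = (1 + x l) / x l by field; rewrite gt_eqF.
rewrite -exprnN expr_div_n; field.
by rewrite !expf_neq0 ?gt_eqF.
Qed.

Let x1k_neg n x : pos x -> q k l = - n.+1%:Z ->
  x1 x k = x k * (1 + x l) ^+ n.+1.
Proof.
by move=> px e; rewrite /x1 /xmut (negPf kl) e ltr0_sgz // !opprK.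
Qed.

Let laur_p1 : laur (fun x : I -> R => 1 + x l).
Proof. exact: laurD (laur_cst _ 1) (laur_coord _ l). Qed.

Let wall_k x : wall l x -> 0 < x k. Proof. by move=> [_ ->]. Qed.

Let wall_pow n x : wall l x -> (1 + x l) ^+ n = (n == 0%N)%:R.
Proof. by move=> [-> _]; rewrite subrr expr0n. Qed.

Let order_x2l_of (A B E : (I -> R) -> R) : laur E -> laur B ->
  (forall x, wall l x -> E x != 0 /\ B x != 0) ->
  (forall x, pos x -> (1 + x2 x l) * B x = (1 + x l) * E x) ->
  order l 1 (fun x => 1 + x2 x l).
Proof. by move=> lE lB EB EE; exists E, B; split. Qed.

(** The power of x1_k occurring in [U] vanishes on the wall, whatever the sign of q k l, so that [U]
    equals 1 there. *)
Let U_order : q k l <> 0 -> order l 0 U.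
Proof.
case e: (q k l) => [[|n]|n] // _.
  pose B x := x k * x l ^+ n.+1.
  pose A x := B x + (1 + x l) ^+ n.+1.
  have lB : laur B by apply: laurM (laur_coord _ k) (laurX _ (laur_coord _ l)).
  have lA : laur A by apply: laurD lB (laurX _ laur_p1).
  exists A, B; split=> // x wx.
    rewrite /A /B wall_pow // addr0.
    by rewrite mulf_neq0 ?expf_neq0 ?wx.1 ?oppr_eq0 ?oner_eq0 ?gt_eqF ?wall_k.
  rewrite expr0z mul1r /U e gtr0_sgz // exprN1 (x1k_pos wx e) /A /B; field.
  by rewrite !expf_neq0 ?gt_eqF.
rewrite NegzE in e.
have lP : laur (fun x => 1 + x k * (1 + x l) ^+ n.+1).
  by apply: laurD (laur_cst _ 1) (laurM (laur_coord _ k) (laurX _ laur_p1)).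
apply: eq_order (laur_order0 lP _) _ => x wx.
  by rewrite wall_pow // mulr0 addr0 oner_eq0.
by rewrite /U e ltr0_sgz // opprK expr1z (x1k_neg _ e).
Qed.

(** [U] is 1 up to order |q k l| along the wall and x2_l is 1/x_l times a power of [U], so 1 + x2_l
    differs from (1 + x_l)/x_l by terms of order at least |q k l|. If |q k l| = 1 these have order
    one as well, and positivity of x_k on the wall excludes cancellation. *)
Let x2l_order1 : order l 1 (fun x => 1 + x2 x l).
Proof.
case e: (q k l) => [[|n]|n].
- apply: eq_order (orderV1 _ (order_coord R l l) (order_wall R l)) _ => x px //.
  by rewrite x2l e oppr0 expr0z mulr1.
- pose B x := x k * x l ^+ n.+1.
  pose A x := B x + (1 + x l) ^+ n.+1.
  have lB : laur B by apply: laurM (laur_coord _ k) (laurX _ (laur_coord _ l)).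
  have lA : laur A by apply: laurD lB (laurX _ laur_p1).
  pose S x := \sum_(j < n.+1) A x ^+ (n.+1.-1 - j) * B x ^+ j.
  exists (fun x => B x ^+ n.+1 + x l * (1 + x l) ^+ n * S x),
    (fun x => x l * A x ^+ n.+1); split.
  + apply: laurD (laurX _ lB) (laurM _ _).
      by apply: laurM (laur_coord _ l) (laurX _ laur_p1).
    by apply: laur_sum => j; apply: laurM; apply: laurX.
  + by apply: laurM (laur_coord _ l) (laurX _ lA).
  + move=> x wx; have [xl _] := wx; have xk := wall_k wx.
    have B0 : B x != 0.
      by rewrite mulf_neq0 ?expf_neq0 ?xl ?oppr_eq0 ?oner_eq0 ?gt_eqF.
    have AE : A x = B x by rewrite /A wall_pow // addr0.
    rewrite AE mulf_neq0 ?expf_neq0 ?(wall_nonzero wx) //; split=> //.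
    rewrite wall_pow //; case: (posnP n) => [n0|n0].
      rewrite /S /B n0 big_ord1 !expr0 !mulr1 xl !expr1.
      by rewrite mulrN1 -opprD oppr_eq0 gt_eqF // addr_gt0.
    by rewrite mulr0 mul0r addr0 expf_neq0.
  move=> x px; rewrite x2l /U e gtr0_sgz // exprN1 (x1k_pos px e).
  have [xl xk] := (px l, px k); have p := p1_gt0 l px.
  have Bp : 0 < B x by rewrite mulr_gt0 ?exprn_gt0.
  have Ap : 0 < A x by rewrite addr_gt0 ?exprn_gt0.
  have -> : 1 + (x k)^-1 * (1 + x l) ^+ n.+1 / x l ^+ n.+1 = A x / B x.
    by rewrite /A /B; field; apply/andP; split; rewrite lt0r_neq0 ?exprn_gt0.
  have SE : A x ^+ n.+1 = B x ^+ n.+1 + (1 + x l) ^+ n.+1 * S x.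
    by apply/eqP; rewrite -subr_eq0 opprD addrA subrXX -/(S x) /A addrAC subrr add0r subrr.
  rewrite -exprnN expr_div_n expr1z.
  transitivity (x l * A x ^+ n.+1 + B x ^+ n.+1).
    by field; rewrite !gt_eqF ?exprn_gt0.
  by rewrite SE [(1 + x l) ^+ n.+1]exprS; ring.
rewrite NegzE in e.
pose A x := 1 + x k * (1 + x l) ^+ n.+1.
have lA : laur A.
  by apply: laurD (laur_cst _ 1) (laurM (laur_coord _ k) (laurX _ laur_p1)).
pose S x := \sum_(j < n.+1) A x ^+ (n.+1.-1 - j) * 1 ^+ j.
exists (fun x => 1 + x k * (1 + x l) ^+ n * S x), (fun x => x l); split.
+ apply: laurD (laur_cst _ 1) (laurM _ _).
    by apply: laurM (laur_coord _ k) (laurX _ laur_p1).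
  by apply: laur_sum => j; apply: laurM; apply: laurX => //; apply: laur_cst.
+ exact: laur_coord.
+ move=> x wx; split; last exact: wall_nonzero wx l.
  rewrite wall_pow //; case: (posnP n) => [n0|n0].
    by rewrite /S n0 big_ord1 !expr0 !mulr1 gt_eqF // addr_gt0 ?ltr01 ?wall_k.
  by rewrite mulr0 mul0r addr0 oner_eq0.
move=> x px; rewrite x2l /U e ltr0_sgz // !opprK expr1z (x1k_neg px e).
have xl := px l.
have SE : A x ^+ n.+1 = 1 + x k * (1 + x l) ^+ n.+1 * S x.
  apply/eqP; rewrite -subr_eq0 opprD addrA -{1}(expr1n R n.+1) subrXX -/(S x).
  by rewrite /A [1 + _]addrC addrK subrr.
rewrite -/(A x) -!exprnP SE [(1 + x l) ^+ n.+1]exprS; field.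
by rewrite gt_eqF.
Qed.

Let x2l_order0 : order l 0 (fun x => x2 x l).
Proof.
have xV : order l 0 (fun x : I -> R => (x l)^-1).
  by rewrite -oppr0; apply: orderV (order_coord R l l) => x px; rewrite gt_eqF.
have [e0|/eqP ne] := eqVneq (q k l) 0.
  by apply: eq_order xV _ => x px; rewrite x2l e0 oppr0 expr0z mulr1.
have := orderM xV (orderX (- q k l) _ (U_order ne)); rewrite mul0r addr0.
move=> H; apply: eq_order (H _) _ => x px; last by rewrite x2l.
by rewrite gt_eqF ?U_gt0.
Qed.

Let x1k_order : order l (- q k l) (fun x => x1 x k).
Proof. exact: x1_order. Qed.

Let p1x1k_order : order l (- Num.max 0 (q k l)) (fun x => 1 + x1 x k).
Proof.
have [e|e|e] := ltrgt0P (q k l).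
- rewrite -(addr0 (- _)).
  have U0 : order l 0 U by apply: U_order => e0; rewrite e0 in e.
  apply: eq_order (orderM x1k_order U0) _ => x px.
  have := x1p px k => /lt0r_neq0 ?.
  by rewrite /U gtr0_sgz // exprN1; field.
- have U0 : order l 0 U by apply: U_order => e0; rewrite e0 in e.
  by rewrite oppr0; apply: eq_order U0 _ => x px; rewrite /U ltr0_sgz.
- have H : order l 0 (fun x => 1 + x k).
    apply: laur_order0 => [|x wx]; first exact: laurD (laur_cst _ 1) (laur_coord _ k).
    by rewrite gt_eqF // addr_gt0 ?ltr01 ?wall_k.
  rewrite oppr0; apply: eq_order H _ => x px.
  by rewrite /x1 /xmut (negPf kl) e oppr0 expr0z mulr1.
Qed.

Let p1x1kV_order : order l (Num.min 0 (q k l)) (fun x => 1 + (x1 x k)^-1).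
Proof.
have -> : Num.min 0 (q k l) = - Num.max 0 (q k l) - (- q k l) by lia.
apply: eq_order (orderM p1x1k_order (orderV _ x1k_order)) _ => x px.
  by rewrite gt_eqF ?x1p.
by have := x1p px k => /lt0r_neq0 ?; field.
Qed.

Let q2E a : a != l -> a != k ->
  q2 a l = - q a l - Num.max 0 (q k l) * Num.max 0 (- q1 a k)
    - Num.min 0 (q k l) * Num.max 0 (q1 a k).
Proof.
move=> /negPf al /negPf ak.
have q1s : skew q1 by exact: qmut_skew.
rewrite /q2 /qmut ak lk /= [q1 k a]q1s [q1 k l]q1s q1lk.
have -> : q1 a l = - q a l by rewrite /q1 /qmut eqxx orbT.
have -> : Num.max 0 (- q k l) = - Num.min 0 (q k l) by lia.
by ring.
Qed.

Let x2_order a : a != l -> order l (q2 a l) (fun x => x2 x a).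
Proof.
move=> al; have [->|ak] := eqVneq a k.
  have -> : q2 k l = - - q k l.
    by rewrite /q2 /qmut eqxx /= /q1 /qmut eqxx orbT.
  apply: eq_order (orderV _ x1k_order) _ => x px; first by rewrite gt_eqF ?x1p.
  by rewrite /x2 /xmut eqxx.
(* The order along the wall of whichever of 1 + 1/x1_k and 1 + x1_k enters the mutation of x_a. *)
pose m := if 0 < q1 a k then Num.min 0 (q k l) else - Num.max 0 (q k l).
have -> : q2 a l = - q a l - m * q1 a k.
  rewrite q2E // /m; case: ifP => h.
    have -> : Num.max 0 (- q1 a k) = 0 by lia.
    have -> : Num.max 0 (q1 a k) = q1 a k by lia.
    by ring.
  have -> : Num.max 0 (- q1 a k) = - q1 a k by lia.
  have -> : Num.max 0 (q1 a k) = 0 by lia.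
  by ring.
have oF := order_factor (F := fun x => x1 x k) (m := m) (e := q1 a k).
apply: eq_order (orderM (x1_order al) (oF _ _ _)) _ => [x px|h|h|x px].
- exact: x1p.
- by rewrite /m h.
- by rewrite /m; case: ifP => // h'; lia.
- by rewrite /x2 /xmut (negPf ak).
Qed.

(** After two mutations x_a has order q2 a l. Since 1 + x2_l again has order one, the third mutation
    contributes exactly the opposite order. *)
Lemma order_three_mutations a : order l 0 (fun x => x3 x a).
Proof.
have [->|al] := eqVneq a l.
  rewrite -oppr0; apply: eq_order (orderV _ x2l_order0) _ => x px.
    by rewrite gt_eqF ?x2p.
  by rewrite /x3 /xmut eqxx.
rewrite -(subrr (q2 a l)) -{2}(mul1r (q2 a l)).
have oF := order_factor (F := fun x => x2 x l) (m := 1) (e := q2 a l).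
apply: eq_order (orderM (x2_order al) (oF _ _ _)) _ => [x px|_|_|x px].
- exact: x2p.
- by apply: orderV1 => // x px; exact: x2p.
- by [].
- by rewrite /x3 /xmut (negPf al).
Qed.

Let wlM F G : wall_laur l F -> wall_laur l G -> wall_laur l (fun x => F x * G x).
Proof.
move=> [m [P [lP PE]]] [n [Q [lQ QE]]]; exists (m + n)%N, (fun x => P x * Q x).
by split=> [|x px]; [exact: laurM | rewrite exprD -PE // -QE //; ring].
Qed.

Let wlD F G : wall_laur l F -> wall_laur l G -> wall_laur l (fun x => F x + G x).
Proof.
move=> [m [P [lP PE]]] [n [Q [lQ QE]]].
exists (m + n)%N, (fun x => P x * (1 + x l) ^+ n + Q x * (1 + x l) ^+ m).
split=> [|x px]; last by rewrite exprD -PE // -QE //; ring.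
by apply: laurD; apply: laurM => //; apply: laurX.
Qed.

Let wl_laur F : laur F -> wall_laur l F.
Proof. by move=> lF; exists 0%N, F; split=> // x _; rewrite mulr1. Qed.

Let eq_wl F G : wall_laur l G -> (forall x, pos x -> F x = G x) -> wall_laur l F.
Proof.
by move=> [d [P [lP PE]]] FG; exists d, P; split=> // x px; rewrite FG // PE.
Qed.

Let wlX F n : wall_laur l F -> wall_laur l (fun x => F x ^+ n).
Proof.
move=> wF; elim: n => [|n IH]; first exact/wl_laur/laur_cst.
by apply: eq_wl (wlM wF IH) _ => x _; rewrite exprS.
Qed.

Let wl_p1z (n : int) : wall_laur l (fun x : I -> R => (1 + x l) ^ n).
Proof.
case: n => n; first by apply: wl_laur; apply: laurX.
exists n.+1, (fun=> 1); split=> [|x px]; first exact: laur_cst.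
by rewrite NegzE -exprnN mulVf // expf_neq0 // p1_neq0.
Qed.

Let wl_x1 a (n : int) : wall_laur l (fun x => x1 x a ^ n).
Proof.
have [->|al] := eqVneq a l.
  apply: eq_wl (wl_laur (laur_expz R l (- n))) _ => x px.
  by rewrite x1l exprz_inv.
have wc b (j : int) : wall_laur l (fun x : I -> R => x b ^ j).
  exact/wl_laur/laur_expz.
(* For positive q a l the mutation factor involves 1 + 1/x_l = (1 + x_l)/x_l, which contributes this
   additional power of x_l. *)
pose j := if 0 < q a l then q a l else 0.
apply: eq_wl (wlM (wlM (wc a n) (wc l (j * n))) (wl_p1z (- q a l * n))) _ => x px.
rewrite /x1 /xmut (negPf al) -!exprz_exp -!expfzMl; congr (_ ^ _).
rewrite -mulrA; congr (_ * _); rewrite /j.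
have xl := px l; have p := p1_gt0 l px.
have [e|e|->] := ltrgt0P (q a l); last by rewrite oppr0 !expr0z mulr1.
  rewrite gtr0_sgz // exprN1.
  have -> : 1 + (x l)^-1 = (1 + x l) / x l by field; rewrite gt_eqF.
  by rewrite expfzMl exprz_inv opprK mulrC.
by rewrite ltr0_sgz // opprK expr0z mul1r.
Qed.

Let wall_laur_mutation s : wall_laur l (fun x => lsum s (x1 x)).
Proof.
elim: s => [|p s IH].
  by apply: eq_wl (wl_laur (laur_cst _ 0)) _ => x _; rewrite /lsum big_nil.
have wp : wall_laur l (fun x => lmono p.2 (x1 x)).
  rewrite /lmono; elim: (index_enum I) => [|a r IHr].
    by apply: eq_wl (wl_laur (laur_cst _ 1)) _ => x _; rewrite big_nil.
  by apply: eq_wl (wlM (wl_x1 a _) IHr) _ => x _; rewrite big_cons.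
apply: eq_wl (wlD (wlM (wl_laur (laur_cst _ p.1)) wp) IH) _ => x _.
by rewrite /lsum big_cons.
Qed.

Let integral_three_mutations s : integral l (fun x => lsum s (x3 x)).
Proof.
have ic (c : R) : integral l (fun=> c) by apply/laur_integral/laur_cst.
elim: s => [|p s IH].
  by apply: eq_integral (ic 0) _ => x _; rewrite /lsum big_nil.
have wp : integral l (fun x => lmono p.2 (x3 x)).
  rewrite /lmono; elim: (index_enum I) => [|a r IHr].
    by apply: eq_integral (ic 1) _ => x _; rewrite big_nil.
  have oa : order l 0 (fun x => x3 x a ^ p.2 a).
    rewrite -(mul0r (p.2 a)); apply: orderX (order_three_mutations a) => x px.
    by rewrite gt_eqF ?x3p.
  apply: eq_integral (integralM (order0_integral oa) IHr) _ => x _.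
  by rewrite big_cons.
apply: eq_integral (integralD (integralM (ic p.1) wp) IH) _ => x _.
by rewrite /lsum big_cons.
Qed.

(** In terms of x, the function F(x1) can only have a pole along 1 + x_l = 0. Being also Laurent in
    x3, whose coordinates are units along that divisor, it has none. *)
Lemma laur_three_charts F G : laur F -> laur G ->
  (forall x, pos x -> F (x1 x) = G (x3 x)) ->
  exists P, laur P /\ forall x, pos x -> F (x1 x) = P x.
Proof.
move=> [s Fs] [t Gt] FG.
have sE x : pos x -> F (x1 x) = lsum s (x1 x) by move=> px; apply/Fs/pos_nonzero/x1p.
have [||P [lP PE]] := @integral_laur _ _ l (fun x => lsum s (x1 x)) => //.
  apply: eq_integral (integral_three_mutations t) _ => x px.
  by rewrite -sE // FG // Gt //; apply/pos_nonzero/x3p.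
by exists P; split=> // x px; rewrite sE // PE.
Qed.

End Wall.
End RankTwo.

(** * Runs of mutations and growth rates along monomial curves *)

Definition qrun (I : eqType) (ks : seq I) (q : I -> I -> int) :=
  foldl (fun q k => qmut k q) q ks.

Fixpoint xrun (I : eqType) (K : fieldType) (ks : seq I) (q : I -> I -> int)
    (x : I -> K) : I -> K :=
  if ks is k :: ks' then xrun ks' (qmut k q) (xmut k q x) else x.

Section Growth.
Variable R : realFieldType.

Lemma poly_growth (p : {poly R}) (C : R) (d : nat) :
  (forall t, 1 <= t -> `|p.[t]| <= C * t ^+ d) -> (size p <= d.+1)%N.
Proof.
move=> pC; rewrite leqNgt; apply/negP => dp.
have C0 : 0 <= C by have := pC _ (lexx 1); rewrite expr1n mulr1; apply: le_trans.
case e: (size p) dp => [//|n]; rewrite ltnS => dn.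
have c0 : 0 < `|p`_n|.
  by rewrite normr_gt0 -[n]/(n.+1.-1) -e -lead_coefE lead_coef_eq0 -size_poly_eq0 e.
pose A := \sum_(i < n) `|p`_i|.
have A0 : 0 <= A by apply: sumr_ge0.
(* At this t the leading term outweighs all lower terms and the assumed bound together. *)
pose t := 1 + (A + C) / `|p`_n|.
have t1 : 1 <= t by rewrite lerDl divr_ge0 ?addr_ge0.
have t0 : 0 < t by apply: lt_le_trans t1.
have tn k : (k < n)%N -> t ^+ k <= t ^+ n.-1.
  by move=> kn; apply: ler_weXn2l => //; rewrite -ltnS prednK //; case: (n) kn.
have n0 : (0 < n)%N by case: (n) dn.
have lo : `|p`_n| * t ^+ n <= (A + C) * t ^+ n.-1.
  have -> : `|p`_n| * t ^+ n = `|p.[t] - \sum_(i < n) p`_i * t ^+ i|.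
    by rewrite horner_coef e big_ord_recr /= addrAC subrr add0r normrM normrX (gtr0_norm t0).
  apply: le_trans (ler_normB _ _) _; rewrite addrC mulrDl; apply: lerD.
    apply: le_trans (ler_norm_sum _ _ _) _; rewrite mulr_suml.
    apply: ler_sum => i _; rewrite normrM normrX (gtr0_norm t0).
    by apply: ler_wpM2l => //; apply: tn.
  by apply: le_trans (pC _ t1) _; apply: ler_wpM2l => //; apply: tn.
move: lo; rewrite -[in t ^+ n](prednK n0) exprS mulrA ler_pM2r ?exprn_gt0 //.
rewrite /t mulrDr mulr1 mulrCA mulfV ?gt_eqF // mulr1 => lo.
by move: c0; rewrite ltNge => /negP; apply; rewrite -(lerD2r (A + C)) add0r.
Qed.

Lemma laurent1_growth (s : seq (R * int)) (C : R) (m : int) :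
  (forall t, 1 <= t -> `|\sum_(p <- s) p.1 * t ^ p.2| <= C * t ^ m) ->
  forall e, m < e -> \sum_(p <- s | p.2 == e) p.1 = 0.
Proof.
move=> sC e me.
pose E := (\sum_(p <- s) `|p.2| + `|e| + `|m|)%N.
have Eb p : p \in s -> 0 <= p.2 + E%:Z.
  move=> ps; have : (`|p.2| <= \sum_(p <- s) `|p.2|)%N.
    by rewrite (big_rem p) //= leq_addr.
  by rewrite /E; lia.
have Em : 0 <= m + E%:Z by rewrite /E; lia.
have Ee : 0 <= e + E%:Z by rewrite /E; lia.
pose P := \sum_(p <- s) p.1 *: 'X^(absz (p.2 + E%:Z)).
have PE t : 1 <= t -> P.[t] = (\sum_(p <- s) p.1 * t ^ p.2) * t ^+ E.
  move=> t1; have t0 : t != 0 by rewrite gt_eqF // (lt_le_trans _ t1).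
  rewrite horner_sum mulr_suml; apply: eq_big_seq => p ps.
  rewrite hornerZ hornerXn -mulrA; congr (_ * _).
  by rewrite -[LHS]/(t ^ (absz (p.2 + E%:Z))%:Z) gez0_abs ?Eb // expfzDr.
have sP : (size P <= (absz (m + E%:Z)%R).+1)%N.
  apply: (@poly_growth _ C) => t t1; have t0 : 0 < t by apply: lt_le_trans t1.
  rewrite PE // normrM (gtr0_norm (exprn_gt0 _ t0)).
  rewrite -[t ^+ absz _]/(t ^ (absz (m + E%:Z))%:Z) gez0_abs // expfzDr ?gt_eqF //.
  by rewrite mulrA ler_pM2r ?exprn_gt0 // sC.
have cP : P`_(absz (e + E%:Z)) = 0.
  by apply: nth_default; apply: leq_trans sP _; lia.
rewrite coef_sum in cP; transitivity (\sum_(p <- s) (p.1 *: 'X^(absz (p.2 + E%:Z)) : {poly R})`_(absz (e + E%:Z))) => //.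
rewrite big_mkcond /=; apply: eq_big_seq => p ps.
rewrite coefZ coefXn.
have -> : (absz (e + E%:Z) == absz (p.2 + E%:Z)) = (p.2 == e).
  have := Eb _ ps; move=> ?; apply/eqP/eqP => [|->//]; lia.
by case: eqP; rewrite ?mulr1 ?mulr0.
Qed.

(** The lower bound makes the class stable under inversion; it expresses that subtraction-free
    functions grow exactly like a power of t. *)
Definition growth (m : int) (F : R -> R) := exists c C, 0 < c /\
  forall t, 1 <= t -> c * t ^ m <= F t <= C * t ^ m.

Lemma growth_gt0 m F t : growth m F -> 1 <= t -> 0 < F t.
Proof.
move=> [c [C [c0 FC]]] t1; have /andP[lo _] := FC _ t1.
by apply: lt_le_trans lo; rewrite mulr_gt0 // exprz_gt0 // (lt_le_trans _ t1).
Qed.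

Lemma eq_growth m F G : growth m G -> (forall t, 1 <= t -> F t = G t) -> growth m F.
Proof.
by move=> [c [C [c0 GC]]] FG; exists c, C; split=> // t t1; rewrite FG // GC.
Qed.

Lemma growthM m n F G : growth m F -> growth n G -> growth (m + n) (fun t => F t * G t).
Proof.
move=> gF gG; have [c [C [c0 FC]]] := gF; have [d [D [d0 GD]]] := gG.
exists (c * d), (C * D); split=> [|t t1]; first exact: mulr_gt0.
have t0 : 0 < t by apply: lt_le_trans t1.
have /andP[cF FC'] := FC _ t1; have /andP[dG GD'] := GD _ t1.
rewrite expfzDr ?gt_eqF // !(mulrACA _ _ (t ^ m)) !ler_pM //.
- by rewrite ltW // (growth_gt0 gF).
- by rewrite ltW // (growth_gt0 gG).
- by rewrite mulr_ge0 // ltW // exprz_gt0.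
- by rewrite mulr_ge0 // ltW // exprz_gt0.
Qed.

Lemma growthV m F : growth m F -> growth (- m) (fun t => (F t)^-1).
Proof.
move=> gF; have [c [C [c0 FC]]] := gF.
have C0 : 0 < C.
  have /andP[_] := FC _ (lexx 1); rewrite exp1rz mulr1.
  by apply: lt_le_trans; apply: growth_gt0 gF _.
exists C^-1, c^-1; split=> [|t t1]; first by rewrite invr_gt0.
have t0 : 0 < t by apply: lt_le_trans t1.
have tm : 0 < t ^ m by rewrite exprz_gt0.
have Ft := growth_gt0 gF t1; have /andP[cF FC'] := FC _ t1.
rewrite -invr_expz -!invfM lef_pV2 ?posrE ?mulr_gt0 //.
by rewrite FC' lef_pV2 ?posrE ?mulr_gt0.
Qed.

Lemma growth_cst c : 0 < c -> growth 0 (fun=> c).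
Proof. by move=> c0; exists c, c; split=> // t _; rewrite expr0z mulr1 lexx. Qed.

Lemma growthX m F (n : int) : growth m F -> growth (m * n) (fun t => F t ^ n).
Proof.
move=> gF; have gX (k : nat) : growth (m * k%:Z) (fun t => F t ^+ k).
  elim: k => [|k IH]; first by rewrite mulr0; apply: growth_cst.
  rewrite intS mulrDr mulr1; apply: eq_growth (growthM gF IH) _ => t _.
  by rewrite exprS.
case: n => n; first exact: gX.
rewrite NegzE mulrN; apply: eq_growth (growthV (gX n.+1)) _ => t _.
by rewrite -exprnN.
Qed.

Lemma growth1D m F : growth m F -> growth (Num.max 0 m) (fun t => 1 + F t).
Proof.
move=> gF; have [c [C [c0 FC]]] := gF.
have C0 : 0 < C.
  have /andP[_] := FC _ (lexx 1); rewrite exp1rz mulr1.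
  by apply: lt_le_trans; apply: growth_gt0 gF _.
exists (Num.min 1 c), (1 + C); split=> [|t t1]; first by rewrite lt_min ltr01.
have t0 : 0 < t by apply: lt_le_trans t1.
have tm : 0 < t ^ m by rewrite exprz_gt0.
have Ft := growth_gt0 gF t1; have /andP[cF FC'] := FC _ t1.
have [m0|m0] := leP 0 m.
  have t1m : 1 <= t ^ m by rewrite -(expr0z t); apply: ler_weXz2l.
  apply/andP; split; last by rewrite mulrDl mul1r lerD.
  apply: le_trans (le_trans _ cF) _; last by rewrite lerDr.
  by rewrite ler_pM2r // ge_min lexx orbT.
have t1m : t ^ m <= 1 by rewrite -(expr0z t); apply: ler_weXz2l => //; apply: ltW.
rewrite expr0z !mulr1; apply/andP; split.
  by apply: (@le_trans _ _ 1); rewrite ?ge_min ?lexx // lerDl ltW.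
by rewrite lerD2l; apply: le_trans FC' _; rewrite ger_pMr.
Qed.

End Growth.

(** The tropicalization of [xmut], with maximum as addition because exponents are read off as t
    tends to infinity. *)
Definition tmut (I : eqType) (k : I) (q : I -> I -> int) (v : I -> int) (a : I) : int :=
  if a == k then - v k
  else v a + Num.max 0 (v k * - sgz (q a k)) * - q a k.

Fixpoint trun (I : eqType) (ks : seq I) (q : I -> I -> int) (v : I -> int) : I -> int :=
  if ks is k :: ks' then trun ks' (qmut k q) (tmut k q v) else v.

Lemma growth_xrun (I : eqType) (R : realFieldType) (ks : seq I) (q : I -> I -> int)
    (v : I -> int) (x : R -> I -> R) :
  (forall a, growth (v a) (x^~ a)) ->
  forall a, growth (trun ks q v a) (fun t => xrun ks q (x t) a).
Proof.
elim: ks q v x => [//|k ks IH] q v x gx /=; apply: IH => a.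
rewrite /tmut /xmut; case: eqP => _; first exact: growthV.
apply: growthM => //; apply: growthX; apply: growth1D; exact: growthX.
Qed.


(** * Functions that remain Laurent under mutation *)

Section Regular.
Variables (I : finType) (R : realFieldType).
Implicit Types (q : I -> I -> int) (x : I -> R) (F : (I -> R) -> R)
  (X : (I -> R) -> I -> R) (M : pred I).

Definition chart X := (forall x, pos x -> pos (X x)) /\
  forall z, pos z -> exists2 x, pos x & X x = z.

Definition regular F X := exists P, laur P /\ forall x, pos x -> F x = P (X x).

Lemma chart_mut k q X : skew q -> chart X -> chart (fun x => xmut k q (X x)).
Proof.
move=> sq [Xp Xs]; split=> [x px|z pz]; first exact/xmut_pos/Xp.
have [x px xz] := Xs _ (xmut_pos k (qmut k q) pz); exists x => //.
rewrite xz -{1}(qmutK k sq) xmutK //.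
Qed.

(** Start from the chart obtained by mutating at m and then at l. Mutating it at l gives back X
    mutated at m, and two further mutations, at m and at l, lead through X to X mutated at l; so
    [laur_three_charts] applies. *)
Lemma regular_step q X F m l : chart X -> skew q -> l != m ->
  regular F (fun x => xmut m q (X x)) -> regular F (fun x => xmut l q (X x)) ->
  regular F (fun x => xmut l (qmut m q) (xmut m q (X x))).
Proof.
move=> cX sq lm [P [lP PE]] [Q [lQ QE]].
have cX1 := chart_mut m sq cX; have sq1 := qmut_skew m sq.
have cX2 := chart_mut l sq1 cX1; have sq2 := qmut_skew l sq1.
have ml : m != l by rewrite eq_sym.
have X1E x : pos x ->
    xmut l (qmut l (qmut m q)) (xmut l (qmut m q) (xmut m q (X x))) = xmut m q (X x).
  by move=> px; rewrite xmutK //; apply: cX1.1.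
have X0E x : pos x ->
    xmut m (qmut l (qmut l (qmut m q))) (xmut m q (X x)) = X x.
  by move=> px; rewrite qmutK // xmutK //; apply: cX.1.
have [z pz|S [lS SE]] := laur_three_charts ml sq2 lP lQ.
  have [x px <-] := cX2.2 _ pz.
  by rewrite X1E // X0E // -PE // !qmutK // QE.
exists S; split=> // x px; rewrite -SE; last exact: cX2.1.
by rewrite X1E // PE.
Qed.

Definition universal M q X F := regular F X /\
  forall k, M k -> regular F (fun x => xmut k q (X x)).

(** The inductive step of the Laurent phenomenon: being Laurent on a seed and on all its neighbours
    is inherited by each neighbour, whose own neighbours are covered by [regular_step]. *)
Lemma universal_step M q X F m : chart X -> skew q -> M m -> universal M q X F ->
  universal M (qmut m q) (fun x => xmut m q (X x)) F.
Proof.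
move=> cX sq Mm [F0 FM]; split=> [|l Ml]; first exact: FM.
have [->|lm] := eqVneq l m; last by apply: regular_step => //; apply: FM.
have [P [lP PE]] := F0; exists P; split=> // x px.
by rewrite xmutK ?PE //; apply: cX.1.
Qed.

Lemma universal_run M q F ks : skew q -> all M ks -> universal M q id F ->
  universal M (qrun ks q) (xrun ks q) F.
Proof.
have: chart id by split=> // z pz; exists z.
rewrite -[xrun ks q]/(fun x => xrun ks q (id x)).
elim: ks q id => [//|k ks IH] q X cX sq /= /andP[Mk Mks] U.
apply: (IH _ (fun x => xmut k q (X x))) => //.
- exact: chart_mut.
- exact: qmut_skew.
- exact: universal_step.
Qed.

Lemma chart_run q ks : skew q -> chart (xrun ks q).
Proof.
have: chart id by split=> // z pz; exists z.
rewrite -[xrun ks q]/(fun x => xrun ks q (id x)).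
elim: ks q id => [//|k ks IH] q X cX sq /=.
apply: (IH _ (fun x => xmut k q (X x))); [exact: chart_mut | exact: qmut_skew].
Qed.

Lemma qrun_skew q ks : skew q -> skew (qrun ks q).
Proof. by elim: ks q => [//|k ks IH] q sq; apply: IH; apply: qmut_skew. Qed.

End Regular.

Lemma xrun_cat (I : eqType) (K : fieldType) (ks ls : seq I) q (x : I -> K) :
  xrun (ks ++ ls) q x = xrun ls (qrun ks q) (xrun ks q x).
Proof. by elim: ks q x => [//|k ks IH] q x /=; rewrite IH. Qed.

Lemma qrun_cat (I : eqType) (ks ls : seq I) q :
  qrun (ks ++ ls) q = qrun ls (qrun ks q).
Proof. exact: foldl_cat. Qed.

Lemma qrunK (I : finType) (ks : seq I) q : skew q -> qrun (rev ks) (qrun ks q) = q.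
Proof.
elim: ks q => [//|k ks IH] q sq /=.
rewrite rev_cons -cats1 qrun_cat IH; last exact: qmut_skew.
by rewrite /qrun /= qmutK.
Qed.

Lemma xrunK (I : finType) (R : realFieldType) (ks : seq I) q (x : I -> R) : skew q ->
  pos x -> xrun (rev ks) (qrun ks q) (xrun ks q x) = x.
Proof.
elim: ks q x => [//|k ks IH] q x sq px /=.
have sq1 := qmut_skew k sq.
rewrite rev_cons -cats1 xrun_cat qrunK //= IH //; [exact: xmutK | exact: xmut_pos].
Qed.

Lemma tmutK (I : finType) (k : I) q v : tmut k (qmut k q) (tmut k q v) = v.
Proof.
apply/funext => a; rewrite /tmut eqxx opprK; case: (altP eqP) => [->//|ak].
rewrite /qmut eqxx orbT sgzN !opprK.
have -> : - v k * sgz (q a k) = v k * - sgz (q a k) by ring.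
ring.
Qed.

Lemma trunK (I : finType) (ks : seq I) q v : skew q -> trun (rev ks) (qrun ks q) (trun ks q v) = v.
Proof.
have tcat ls ls' q' v' : trun (ls ++ ls') q' v' = trun ls' (qrun ls q') (trun ls q' v').
  by elim: ls q' v' => [//|k ls IH] q' v' /=; rewrite IH.
elim: ks q v => [//|k ks IH] q v sq /=; have sq1 := qmut_skew k sq.
by rewrite rev_cons -cats1 tcat qrunK //= IH // tmutK.
Qed.

(** * Uniqueness of the coordinate at a sink *)

Section Pointed.
Variables (I : finType) (R : realFieldType) (M : pred I) (f g : I).
Hypotheses (Mf : ~~ M f) (fg : f != g).

(* The auxiliary frozen g, attached to f only, detects the poles along the
   divisor of the mutation at f. *)
Definition attached (q : I -> I -> int) :=
  q g f = 1 /\ forall a, a != f -> q g a = 0.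

Hypothesis Mg : ~~ M g.

Let kf k : M k -> (f == k) = false.
Proof. by move=> Mk; apply: contraNF Mf => /eqP ->. Qed.
Let kf' k : M k -> (k == f) = false.
Proof. by move=> Mk; rewrite eq_sym kf. Qed.
Let kg k : M k -> (g == k) = false.
Proof. by move=> Mk; apply: contraNF Mg => /eqP ->. Qed.

Let Mr k : M k -> predU1 f M k.
Proof. by move=> Mk; rewrite /= Mk orbT. Qed.
Let Mff : predU1 f M f.
Proof. by rewrite /= eqxx. Qed.

Lemma attached_run ks q : skew q -> all M ks -> attached q -> attached (qrun ks q).
Proof.
elim: ks q => [//|k ks IH] q sq /= /andP[Mk Mks] [gf ga]; apply: IH => //.
  exact: qmut_skew.
have gk : q g k = 0 by rewrite ga // kf'.
have kg0 : q k g = 0 by rewrite sq gk.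
split=> [|a af]; rewrite /qmut (kg Mk) /=.
  by rewrite (kf Mk) gk kg0 gf /=; ring.
by rewrite gk kg0 (ga _ af); case: ifP => _ //=; ring.
Qed.

Lemma xrun_attached ks q (x : I -> R) : skew q -> all M ks -> attached q ->
  xrun ks q x g = x g.
Proof.
elim: ks q x => [//|k ks IH] q x sq /= /andP[Mk Mks] aq; rewrite IH //.
- by rewrite /xmut (kg Mk) aq.2 ?kf' // oppr0 expr0z mulr1.
- exact: qmut_skew.
- by apply: (@attached_run [:: k]) => //=; rewrite Mk.
Qed.

Definition scale (c : R) (x : I -> R) a := if a == f then c * x a else x a.

(** As f is never mutated, x_f enters the run only as a factor of the coordinate at f itself. This
    gives homogeneity in x_f. *)
Lemma xrun_scale ks q (c : R) x : all M ks ->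
  xrun ks q (scale c x) = scale c (xrun ks q x).
Proof.
elim: ks q x => [//|k ks IH] q x /= /andP[Mk Mks]; rewrite -IH //; congr xrun.
apply/funext => a; rewrite /xmut /scale (kf' Mk); case: eqP => [->|_].
  by rewrite (kf' Mk).
by case: eqP => // _; rewrite mulrA.
Qed.

(** Mutation at k multiplies 1/x_f by a power of 1 + 1/x'_k whose exponent is nonnegative because f
    is a sink. Mutation at f is included too: it will be used once, at the end of the run. *)
Let y_regular q : skew q -> (forall k, M k -> q f k <= 0) ->
  universal (predU1 f M) q id (fun x : I -> R => (x f)^-1).
Proof.
move=> sq sink; split.
  exists (fun x => x f ^ (-1)); split; first exact: laur_expz.
  by move=> x _; rewrite exprN1.
move=> k /orP[/eqP ->|Mk].
  exists (fun x => x f); split; first exact: laur_coord.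
  by move=> x _; rewrite /xmut eqxx.
pose n := absz (q f k); have qn : q f k = - n%:Z by have := sink _ Mk; rewrite /n; lia.
exists (fun x => x f ^ (-1) * (1 + x k ^ (-1)) ^+ n); split.
  apply: laurM (laur_expz _ f _) (laurX _ (laurD (laur_cst _ 1) (laur_expz _ k _))).
move=> x px; rewrite /xmut (kf Mk) eqxx !exprN1 invrK qn.
have [xf xk] := (px f, px k).
have x1 : 0 < 1 + x k by rewrite addr_gt0.
case: (posnP n) => [->|n0]; first by rewrite !oppr0 !expr0z !mulr1.
rewrite ltr0_sgz ?oppr_lt0 // !opprK -exprnP expr1z.
by field; rewrite expf_neq0 gt_eqF.
Qed.

(** The function is chosen so that mutation at f, which divides x_g by 1 + 1/x_f, turns it into the
    monomial 1/x'_g. *)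
Let z_regular q : skew q -> attached q -> (forall k, M k -> q f k <= 0) ->
  universal (predU1 f M) q id (fun x : I -> R => (1 + (x f)^-1) / x g).
Proof.
move=> sq aq sink; split.
  exists (fun x => (1 + x f ^ (-1)) * x g ^ (-1)); split.
    apply: laurM (laur_expz _ g _); apply: laurD (laur_cst _ 1) (laur_expz _ f _).
  by move=> x _; rewrite !exprN1.
move=> k /orP[/eqP ->|Mk].
  exists (fun x => x g ^ (-1)); split; first exact: laur_expz.
  move=> x px; rewrite /xmut eq_sym (negPf fg) aq.1 gtr0_sgz // !exprN1.
  by rewrite invfM invrK mulrC.
have [P [lP PE]] := (y_regular sq sink).2 k (Mr Mk).
exists (fun x => (1 + P x) * x g ^ (-1)); split.
  by apply: laurM (laur_expz _ g _); apply: laurD (laur_cst _ 1) _.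
move=> x px; rewrite -PE // exprN1; congr (_ / _).
by rewrite /xmut (kg Mk) aq.2 ?kf' // oppr0 expr0z mulr1.
Qed.

Definition zero_exp (u : {ffun I -> int}) : {ffun I -> int} :=
  [ffun a => if a == f then 0 else u a].

Lemma lmono_zero_exp u (x : I -> R) t : x f != 0 ->
  lmono (zero_exp u) x = lmono u (subst f 1 x) /\
  lmono u (subst f t x) = t ^ u f * lmono (zero_exp u) x.
Proof.
move=> xf; split.
  by apply: eq_bigr => a _; rewrite ffunE /subst; case: eqP => // _; rewrite exp1rz.
rewrite /lmono (bigD1 f) //= [in RHS](bigD1 f) //= ffunE /subst eqxx expr0z mul1r.
by congr (_ * _); apply: eq_bigr => a /negPf af; rewrite ffunE af.
Qed.

(** Homogeneity writes 1/x_f as 1/x'_f times a Laurent polynomial [s] free of x'_f. Its constant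
    term c is detected by (1 + 1/x_f)/x_g: this stays Laurent after a final mutation at f, which
    forces 1 + t to divide 1 + t c, hence c = 1. *)
Lemma sink_pointed q ks : skew q -> attached q -> (forall k, M k -> q f k <= 0) ->
  all M ks -> exists s : seq (R * {ffun I -> int}),
    (forall x, pos x -> xrun ks q x f / x f = lsum s (xrun ks q x)) /\
    \sum_(p <- s | p.2 == [ffun=> 0]) p.1 = 1.
Proof.
move=> sq aq sink Mks.
have cX := chart_run R ks sq.
have Mks' : all (predU1 f M) ks by apply: sub_all Mks => k; exact: Mr.
have [[P1 [[s1 s1E] P1E]] _] := universal_run sq Mks' (y_regular sq sink).
have [_ /(_ f Mff)[P2 [lP2 P2E]]] :=
  universal_run sq Mks' (z_regular sq aq sink).
pose s := [seq (p.1, zero_exp p.2) | p <- s1].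
have P1scale c z : 0 < c -> pos z -> P1 (scale c z) = c^-1 * P1 z.
  move=> c0 pz; have [x px xz] := cX.2 _ pz.
  rewrite -xz -xrun_scale // -!P1E //; last first.
    by move=> a; rewrite /scale; case: eqP => _; rewrite ?mulr_gt0.
  by rewrite /scale eqxx invfM.
have GE z : pos z -> z f * P1 z = lsum s z.
  move=> pz; have zf := pz f.
  have p1 : pos (subst f 1 z) by move=> a; rewrite /subst; case: eqP => // _; rewrite ltr01.
  have e : z = scale (z f) (subst f 1 z).
    by apply/funext => a; rewrite /scale /subst; case: eqP => // ->; rewrite mulr1.
  rewrite [in P1 z]e P1scale // mulrA mulfV ?gt_eqF // mul1r s1E; last exact: pos_nonzero.
  rewrite /lsum big_map; apply: eq_bigr => p _ /=.
  by rewrite (lmono_zero_exp _ 0 (lt0r_neq0 zf)).1.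
exists s; split=> [x px|].
  by rewrite -GE; [rewrite -P1E | exact: cX.1].
have [s2 s2E] := lP2.
pose q' := qmut f (qrun ks q).
have at' := attached_run sq Mks aq.
have sqt := qrun_skew ks sq.
have cXf := chart_mut f sqt cX.
pose sc t a : R := (1 + t ^ (- sgz (q' a f))) ^ (- q' a f).
have sc0 t a : 0 < t -> 0 < sc t a by move=> t0; rewrite exprz_gt0 // addr_gt0 // exprz_gt0.
pose zt (t : R) (x : I -> R) := subst f t x.
(* Here t is the coordinate at f after the final mutation at f, and [sc] collects the mutation
   factors by which the other coordinates change. *)
have main t w : 0 < t -> pos w ->
    (1 + t) * w g * lsum s2 (subst f t w) = 1 + t * lsum s (fun a => w a * sc t a).
  move=> t0 pw; set z := subst f t w.
  have pz : pos z by move=> a; rewrite /z /subst; case: eqP.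
  have zf : z f = t by rewrite /z /subst eqxx.
  have zg : z g = w g by rewrite /z /subst eq_sym (negPf fg).
  have [x px xz] := cXf.2 _ pz.
  have xf : xrun ks q x f = t^-1.
    by rewrite -zf -xz /xmut eqxx invrK.
  have xg : x g = z g * (1 + t).
    rewrite -xz /xmut eq_sym (negPf fg) at'.1 gtr0_sgz // !exprN1 xf invrK.
    by rewrite xrun_attached // divfK // gt_eqF // addr_gt0.
  have := P2E _ px; rewrite xz s2E; last exact: pos_nonzero.
  have yE : (x f)^-1 = t * lsum s (xrun ks q x).
    rewrite P1E // -GE; last exact: cX.1.
    by rewrite xf mulrA mulfV ?gt_eqF // mul1r.
  rewrite yE xg -zg => <-.
  have -> : lsum s (xrun ks q x) = lsum s (fun a => w a * sc t a).
    rewrite /lsum !big_map; apply: eq_bigr => p _ /=; congr (_ * _).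
    apply: eq_bigr => a _; rewrite ffunE; case: (altP eqP) => [|af].
      by rewrite !expr0z.
    have <- : xmut f q' z a = xrun ks q x a.
      by rewrite -xz /q' xmutK //; apply: cX.1.
    by rewrite /xmut (negPf af) /sc zf /z /subst (negPf af).
  have := pz g; rewrite zg => wg; field.
  by rewrite !gt_eqF // addr_gt0.
clearbody s.
pose shift (u : {ffun I -> int}) : {ffun I -> int} :=
  [ffun a => zero_exp u a + (a == g)%:Z].
(* Comparison of the constant terms in w on both sides of [main], with t regarded as a
   coefficient. *)
have ct (t : R) : 0 < t -> (1 + t) * (\sum_(p <- s2 | shift p.2 == [ffun=> 0]) p.1 * t ^ p.2 f)
    = 1 + t * \sum_(p <- s | p.2 == [ffun=> 0]) p.1.
  move=> t0.
  pose sa := [seq ((1 + t) * p.1 * t ^ p.2 f, shift p.2) | p : R * {ffun I -> int} <- s2].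
  pose sb := [seq (- (t * p.1 * \prod_a sc t a ^ p.2 a), p.2) | p : R * {ffun I -> int} <- s].
  have := @lsum_indep I R (sa ++ (-1, [ffun=> 0]) :: sb) _ [ffun=> 0].
  rewrite big_cat big_cons /= eqxx !big_map /= => H.
  apply/eqP; rewrite -subr_eq0; apply/eqP; rewrite -[RHS]H.
    rewrite mulr_sumr opprD addrA -addrA; congr (_ + _).
      by apply: eq_bigr => p _; rewrite mulrA.
    congr (_ + _); rewrite mulr_sumr -sumrN; apply: eq_bigr => p /eqP ->.
    by rewrite big1 ?mulr1 // => a _; rewrite ffunE expr0z.
  move=> y y0; set w := fun a => (y a)%:R.
  have pw : pos w by move=> a; rewrite ltr0n y0.
  rewrite /lsum big_cat big_cons /= !big_map /=.
  have <- : (1 + t) * w g * lsum s2 (subst f t w) =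
      \sum_(p <- s2) (1 + t) * p.1 * t ^ p.2 f * lmono (shift p.2) w.
    rewrite /lsum mulr_sumr; apply: eq_bigr => p _.
    rewrite (lmono_zero_exp _ t (lt0r_neq0 (pw f))).2.
    have -> : lmono (shift p.2) w = lmono (zero_exp p.2) w * w g.
      have -> : w g = \prod_a w a ^ (a == g)%:Z.
        by rewrite (bigD1 g) //= eqxx expr1z big1 ?mulr1 // => a /negPf ->; rewrite expr0z.
      rewrite /lmono -big_split; apply: eq_bigr => a _ /=.
      by rewrite ffunE expfzDr // gt_eqF.
    ring.
  have -> : \sum_(p <- s) - (t * p.1 * \prod_a sc t a ^ p.2 a) * lmono p.2 w
      = - (t * lsum s (fun a => w a * sc t a)).
    rewrite /lsum mulr_sumr -sumrN; apply: eq_bigr => p _.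
    have -> : lmono p.2 (fun a => w a * sc t a) = lmono p.2 w * \prod_a sc t a ^ p.2 a.
      by rewrite /lmono -big_split; apply: eq_bigr => a _; rewrite expfzMl.
    ring.
  rewrite main // {1}/lmono big1 => [|a _]; last by rewrite ffunE expr0z.
  ring.
set c0 := \sum_(p <- s | _) _ in ct *.
have L1 : laur (fun x : I -> R => (1 + x f) *
    (\sum_(p <- s2 | shift p.2 == [ffun=> 0]) p.1 * x f ^ p.2 f)).
  apply: laurM (laurD (laur_cst _ 1) (laur_coord _ f)) _.
  under eq_fun do rewrite -big_filter.
  by apply: laur_sum => p; apply: laurM (laur_cst _ _) (laur_expz _ f _).
have L2 : laur (fun x : I -> R => 1 + x f * c0).
  by apply: laurD (laur_cst _ 1) (laurM (laur_coord _ f) (laur_cst _ _)).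
(* Both sides are Laurent in t, so the identity may be evaluated at t = -1, where the left side
   vanishes. *)
have n1 : nonzero (fun _ : I => -1 : R) by move=> a; rewrite oppr_eq0 oner_eq0.
have := laur_ext L1 L2 (fun x px => ct (x f) (px f)) n1.
by rewrite subrr mul0r mulN1r => /esym/subr0_eq.
Qed.

(** Let H be the quotient of the coordinates at f before and after the run. H and 1/H are Laurent,
    in the initial and in the final chart respectively, with constant term 1. A term of H with
    exponent u different from 0 is excluded by the growth of H along the curve with exponent u:
    either that growth is too slow for such a term, or 1/H decays along the curve, against its
    constant term. *)
Lemma sink_unique_pos q ks : skew q -> attached q -> all M ks ->
  (forall k, M k -> q f k <= 0) -> (forall k, M k -> qrun ks q f k <= 0) ->
  forall x : I -> R, pos x -> xrun ks q x f = x f.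
Proof.
move=> sq aq Mks sink sink' x px.
have sq' := qrun_skew ks sq; have aq' := attached_run sq Mks aq.
have Mrev : all M (rev ks) by rewrite all_rev.
have [s [sE s1]] := sink_pointed sq aq sink Mks.
have [s' [s'E s'1]] := sink_pointed sq' aq' sink' Mrev.
have HE y : pos y -> y f / xrun ks q y f = lsum s' y.
  move=> py; have := s'E _ ((chart_run R ks sq).1 _ py).
  by rewrite xrunK.
suff c0 u : u != [ffun=> 0] -> \sum_(p <- s' | p.2 == u) p.1 = 0.
  have := HE _ px; rewrite lsum_undup.
  have xf := px f; have Xf := (chart_run R ks sq).1 _ px f.
  suff -> : \sum_(u <- undup [seq p.2 | p <- s'])
     (\sum_(p <- s' | p.2 == u) p.1) * lmono u x = 1.
    by move/divr1_eq => ->.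
  pose z0 : {ffun I -> int} := [ffun=> 0].
  have z0in : z0 \in undup [seq p.2 | p <- s'].
    rewrite mem_undup; apply: contraT => z0n.
    have := s'1; rewrite big_seq_cond big1 => [/eqP|p /andP[ps /eqP pe]].
      by rewrite eq_sym oner_eq0.
    by move/negP: z0n; case; rewrite /z0 -pe map_f.
  rewrite (bigD1_seq z0) ?undup_uniq //= s'1 mul1r big1 => [|u uz].
    by rewrite addr0 /lmono big1 // => a _; rewrite ffunE expr0z.
  by rewrite c0 // mul0r.
move=> u0.
pose v' := trun ks q u.
have curve (w : I -> int) (y : I -> R) : pos y ->
    forall a, growth (w a) (fun t => y a * t ^ w a).
  by move=> py a; exists (y a), (y a); split=> // t _; rewrite lexx.
have grow (y : I -> R) : pos y ->
  growth (u f - v' f) (fun t => lsum s' (fun a => y a * t ^ u a)).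
  move=> py; have cu := curve u _ py.
  apply: eq_growth (growthM (cu f) (growthV (growth_xrun ks q cu f))) _ => t t1.
  by rewrite -HE // => a; rewrite mulr_gt0 // exprz_gt0 // (lt_le_trans _ t1).
have dirE (s0 : seq (R * {ffun I -> int})) (w : I -> int) (y : I -> R) (t : R) : 1 <= t ->
  lsum s0 (fun a => y a * t ^ w a) =
  \sum_(p <- [seq (p.1 * lmono p.2 y, idot p.2 w) | p : R * {ffun I -> int} <- s0]) p.1 * t ^ p.2.
  move=> t1; rewrite big_map /=; apply: eq_bigr => p _.
  by rewrite lmono_dir ?mulrA // gt_eqF // (lt_le_trans _ t1).
(* The growth bound holds for every positive starting point y, so terms with the same pairing
   against w cannot hide each other: [lsum_indep] in y separates them. *)
have extract (s0 : seq (R * {ffun I -> int})) (w : I -> int) (m e : int)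
    (u1 : {ffun I -> int}) : m < e -> idot u1 w = e ->
    (forall y, pos y -> growth m (fun t => lsum s0 (fun a => y a * t ^ w a))) ->
    \sum_(p <- s0 | p.2 == u1) p.1 = 0.
  move=> me u1e gy.
  have H : forall u, \sum_(p <- [seq p <- s0 | idot p.2 w == e] | p.2 == u) p.1 = 0.
    apply: lsum_indep => y y0; set y' := fun a => (y a)%:R.
    have py : pos y' by move=> a; rewrite ltr0n y0.
    have [c [C [c0 FC]]] := gy _ py.
    have := @laurent1_growth R [seq (p.1 * lmono p.2 y', idot p.2 w) | p : R * {ffun I -> int} <- s0] C m _ e me.
    rewrite big_map /= => <-; first by rewrite /lsum big_filter.
    move=> t t1; rewrite -dirE // ger0_norm; first by have /andP[] := FC _ t1.
    by rewrite ltW // (growth_gt0 (gy _ py)).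
  apply: etrans (H u1); rewrite big_filter_cond; apply: eq_bigl => p.
  by case: eqP => [->|_]; rewrite ?u1e ?eqxx // andbF.
(* H grows like t to this exponent. If it is nonpositive, it is less than the pairing of u with
   itself, which rules out the term u. *)
have [m0|m0] := leP (u f - v' f) 0.
  apply: (extract _ u (u f - v' f) (idot u u)) => //.
  apply: le_lt_trans m0 _.
  have [a ua] : exists a, u a != 0.
    apply: contrapT => nu; move/eqP: u0; apply; apply/ffunP => a; rewrite ffunE.
    by apply/eqP/negP => /negP ua; apply: nu; exists a.
  rewrite /idot (bigD1 a) //= ltr_wpDr ?sumr_ge0 // => [b _|].
    by rewrite -expr2 sqr_ge0.
  by rewrite -expr2 lt0r sqr_ge0 sqrf_eq0 ua.
(* Otherwise 1/H decays along the image curve, whose exponents in the final chart are v'; its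
   constant term would then be 0 and not 1. *)
suff : \sum_(p <- s | p.2 == [ffun=> 0]) p.1 = 0.
  by rewrite s1 => /eqP; rewrite oner_eq0.
apply: (extract _ v' (v' f - u f) 0) => //.
- by lia.
- by rewrite /idot big1 // => a _; rewrite ffunE mul0r.
move=> y py; have cv := curve v' _ py.
have cu := growth_xrun (rev ks) (qrun ks q) cv.
rewrite {1}/v' trunK // in cu.
apply: eq_growth (growthM (cv f) (growthV (cu f))) _ => t t1.
set z := fun a => _; have pz : pos z.
  by move=> a; rewrite mulr_gt0 // exprz_gt0 // (lt_le_trans _ t1).
have [z' pz' zE] := (chart_run R ks sq).2 _ pz.
by rewrite -[lsum s _]/(lsum s z) -zE -sE // xrunK // zE.
Qed.

End Pointed.

Lemma eq_frac (K : fieldType) (p q p' q' : K) : q != 0 -> q' != 0 ->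
  p * q' = p' * q -> p / q = p' / q'.
Proof. by move=> q0 q'0 e; apply/eqP; rewrite eqr_div // e. Qed.

(** * Rational functions evaluated on the positive orthant *)

Section Evaluation.
Variables (K : numFieldType) (I : finType).
Local Notation n := #|I|.
Implicit Types (z : {fraction (mpoly n K)}) (x : I -> K) (F G : (I -> K) -> K).

(** For complex K the order makes such a point real with positive coordinates. *)
Definition cpos x := forall a, 0 < x a.
Definition mev x (P : mpoly n K) : K := meval (fun i => x (enum_val i)) P.

(* F is the function defined by the rational function z on the positive orthant. *)
Definition rep z F := exists P Q, [/\ forall x, cpos x -> mev x Q != 0,
  z = tofrac P / tofrac Q & forall x, cpos x -> F x = mev x P / mev x Q].

Let ones : I -> K := fun=> 1.
Let ones_pos : cpos ones. Proof. by move=> a; apply: ltr01. Qed.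

Let tofrac_neq0 Q : (forall x, cpos x -> mev x Q != 0) -> tofrac Q != 0.
Proof.
move=> Q0; rewrite tofrac_eq0; apply: contraNneq (Q0 _ ones_pos) => ->.
by rewrite /mev meval0.
Qed.

Let mevM x P Q : mev x (P * Q) = mev x P * mev x Q.
Proof. exact: mevalM. Qed.
Let mevD x P Q : mev x (P + Q) = mev x P + mev x Q.
Proof. exact: mevalD. Qed.
Let mevB x P Q : mev x (P - Q) = mev x P - mev x Q.
Proof. exact: mevalB. Qed.

Lemma mev_eq0 (P : mpoly n K) : (forall x, cpos x -> mev x P = 0) -> P = 0.
Proof.
move=> P0.
pose ex (m : multinom n) : {ffun I -> int} := [ffun a => (m (enum_rank a))%:Z].
have exI : injective ex.
  move=> m m' /ffunP e; apply/mnmP => i; have := e (enum_val i).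
  by rewrite !ffunE enum_valK => -[].
pose s := [seq (mcoeff m P, ex m) | m <- msupp P].
have H u : \sum_(p <- s | p.2 == u) p.1 = 0.
  apply: lsum_indep => y y0; pose x a : K := (y a)%:R.
  have px : cpos x by move=> a; rewrite ltr0n.
  have := P0 _ px; rewrite /mev mevalE => e; apply: etrans e; rewrite /lsum [LHS]big_map.
  apply: eq_bigr => m _ /=; congr (_ * _).
  rewrite /lmono (reindex_onto enum_val enum_rank) /=; last by move=> a; rewrite enum_rankK.
  by apply: eq_big => i; rewrite ?enum_valK ?eqxx // ffunE enum_valK.
apply/mpolyP => m; rewrite mcoeff0; case ms: (m \in msupp P); last first.
  by apply: memN_msupp_eq0; rewrite ms.
apply: etrans (H (ex m)).
rewrite big_map (eq_bigl (pred1 m)); last by move=> m'; rewrite /= (inj_eq exI).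
by rewrite -big_filter filter_pred1_uniq ?msupp_uniq ?ms // big_seq1.
Qed.

Lemma rep_inj z z' F : rep z F -> rep z' F -> z = z'.
Proof.
move=> [P [Q [Q0 -> FE]]] [P' [Q' [Q'0 -> F'E]]].
have tQ := tofrac_neq0 Q0; have tQ' := tofrac_neq0 Q'0.
have e : P * Q' - P' * Q = 0.
  apply: mev_eq0 => x px; have Qx := Q0 _ px; have Q'x := Q'0 _ px.
  have /eqP := FE _ px; rewrite F'E // eqr_div // => /eqP e.
  by rewrite mevB !mevM e subrr.
apply: eq_frac tQ tQ' _; rewrite -[LHS]tofracM -[RHS]tofracM.
by congr tofrac; apply: subr0_eq.
Qed.

Lemma eq_rep z F G : rep z G -> (forall x, cpos x -> F x = G x) -> rep z F.
Proof.
by move=> [P [Q [Q0 -> GE]]] FG; exists P, Q; split=> // x px; rewrite FG ?GE.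
Qed.

Lemma repM z z' F G : rep z F -> rep z' G -> rep (z * z') (fun x => F x * G x).
Proof.
move=> [P [Q [Q0 -> FE]]] [P' [Q' [Q'0 -> GE]]].
exists (P * P'), (Q * Q'); split.
- by move=> x px; rewrite mevM mulf_neq0 ?Q0 ?Q'0.
- by rewrite !tofracM invfM mulrACA.
- by move=> x px; rewrite FE // GE // !mevM invfM mulrACA.
Qed.

Lemma repD z z' F G : rep z F -> rep z' G -> rep (z + z') (fun x => F x + G x).
Proof.
move=> [P [Q [Q0 -> FE]]] [P' [Q' [Q'0 -> GE]]].
have tQ := tofrac_neq0 Q0; have tQ' := tofrac_neq0 Q'0.
exists (P * Q' + P' * Q), (Q * Q'); split.
- by move=> x px; rewrite mevM mulf_neq0 ?Q0 ?Q'0.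
- by rewrite tofracD !tofracM; exact: addf_div tQ tQ'.
- by move=> x px; rewrite FE // GE // addf_div ?Q0 ?Q'0 // mevD !mevM.
Qed.

Lemma repV z F : (forall x, cpos x -> F x != 0) -> rep z F ->
  rep z^-1 (fun x => (F x)^-1).
Proof.
move=> F0 [P [Q [Q0 -> FE]]]; exists Q, P; split.
- move=> x px; have := F0 _ px; rewrite FE //.
  by apply: contraNneq => ->; rewrite mul0r.
- by rewrite invf_div.
- by move=> x px; rewrite FE // invf_div.
Qed.

Lemma rep_cst c : rep (tofrac (mpolyC n c)) (fun=> c).
Proof.
exists (mpolyC n c), 1; split=> [x px||x px].
- by rewrite /mev meval1 oner_eq0.
- by rewrite tofrac1 divr1.
- by rewrite /mev meval1 mevalC divr1.
Qed.

Lemma rep0 : rep 0 (fun=> 0).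
Proof. by have := rep_cst 0; rewrite mpolyC0 tofrac0. Qed.

Lemma rep1 : rep 1 (fun=> 1).
Proof. by have := rep_cst 1; rewrite mpolyC1 tofrac1. Qed.

Lemma rep_coord a : rep (tofrac (mpolyX K (mnm1 (enum_rank a)))) (fun x => x a).
Proof.
exists (mpolyX K (mnm1 (enum_rank a))), 1; split=> [x px||x px].
- by rewrite /mev meval1 oner_eq0.
- by rewrite tofrac1 divr1.
- by rewrite /mev meval1 mevalXU enum_rankK divr1.
Qed.

Lemma rep_exprz z F (m : int) : (forall x, cpos x -> F x != 0) -> rep z F ->
  rep (z ^ m) (fun x => F x ^ m).
Proof.
move=> F0 zF; have rX (k : nat) : rep (z ^+ k) (fun x => F x ^+ k).
  elim: k => [|k IH]; first exact: rep1.
  by rewrite exprS; apply: eq_rep (repM zF IH) _ => x _; rewrite exprS.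
case: m => m; first exact: rX.
rewrite NegzE -exprnN; apply: eq_rep (repV _ (rX m.+1)) _ => x px.
  by rewrite expf_neq0 ?F0.
by rewrite -exprnN.
Qed.

Lemma rep_sum (T : Type) (s : seq T) (P : pred T) (z : T -> {fraction (mpoly n K)})
    (F : T -> (I -> K) -> K) :
  (forall t, P t -> rep (z t) (F t)) ->
  rep (\sum_(t <- s | P t) z t) (fun x => \sum_(t <- s | P t) F t x).
Proof.
move=> zF; elim: s => [|t s IH].
  by rewrite big_nil; apply: eq_rep rep0 _ => x _; rewrite big_nil.
rewrite big_cons; case: ifP => Pt.
  by apply: eq_rep (repD (zF _ Pt) IH) _ => x _; rewrite big_cons Pt.
by apply: eq_rep IH _ => x _; rewrite big_cons Pt.
Qed.

Lemma rep_prod (T : Type) (s : seq T) (z : T -> {fraction (mpoly n K)})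
    (F : T -> (I -> K) -> K) : (forall t, rep (z t) (F t)) ->
  rep (\prod_(t <- s) z t) (fun x => \prod_(t <- s) F t x).
Proof.
move=> zF; elim: s => [|t s IH].
  by rewrite big_nil; apply: eq_rep rep1 _ => x _; rewrite big_nil.
by rewrite big_cons; apply: eq_rep (repM (zF t) IH) _ => x _; rewrite big_cons.
Qed.

Lemma xrun_cpos ks q x : cpos x -> cpos (xrun ks q x).
Proof.
elim: ks q x => [//|k ks IH] q x px /=; apply: IH => a.
rewrite /xmut; case: eqP => _; rewrite ?invr_gt0 ?px //.
by rewrite mulr_gt0 ?px // exprz_gt0 // addr_gt0 // exprz_gt0.
Qed.

Lemma rep_xrun ks q (z : I -> {fraction (mpoly n K)}) (F : (I -> K) -> I -> K) a :
  (forall x, cpos x -> cpos (F x)) -> (forall a, rep (z a) (F^~ a)) ->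
  rep (xrun ks q z a) (fun x => xrun ks q (F x) a).
Proof.
elim: ks q z F => [|k ks IH] q z F Fp zF /=; first exact: zF.
apply: IH => [x px|b]; first exact: (@xrun_cpos [:: k] q _ (Fp _ px)).
have F0 c x : cpos x -> F x c != 0 by move=> px; rewrite gt_eqF // Fp.
rewrite /xmut; case: eqP => _; first exact: repV (F0 k) (zF k).
apply: repM (zF b) _; apply: (rep_exprz (F := fun x => 1 + F x k ^ (- sgz (q b k)))).
  by move=> x px; rewrite gt_eqF // addr_gt0 // exprz_gt0 // Fp.
exact: (repD rep1 (rep_exprz (- sgz (q b k)) (F0 k) (zF k))).
Qed.

End Evaluation.

Lemma xrun_morph (I : eqType) (K L : fieldType) (h : {rmorphism K -> L}) (ks : seq I) q
    (x : I -> K) a : xrun ks q (h \o x) a = h (xrun ks q x a).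
Proof.
elim: ks q x => [//|k ks IH] q x /=; rewrite -IH; congr xrun; apply/funext => b.
rewrite /xmut /=; case: eqP => _; first by rewrite fmorphV.
by rewrite rmorphM /= !fmorphXz rmorphD rmorph1 /= fmorphXz.
Qed.

(** * The theta functions do not depend on the chosen sink seeds *)

Section SeedUniqueness.
Variables (R : realType) (r N : nat) (w : N.-tuple 'I_r).

Definition mrun ks q := foldl (fun q k => mutate_quiver w k q) q ks.

Lemma quiver0_skew : skew (quiver0 w).
Proof. by move=> a b; rewrite /quiver0 andbC; case: ifP => _; rewrite ?oppr0 ?opprB. Qed.

Lemma mutate_quiver_skew k q : skew q -> skew (mutate_quiver w k q).
Proof.
move=> sq a b; rewrite /mutate_quiver andbC orbC; case: ifP => _; first by rewrite oppr0.
by case: ifP => _; rewrite [q a b]sq ?opprK //; ring.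
Qed.

Fixpoint sxrun (K : fieldType) ks (q : face r N -> face r N -> int)
    (x : face r N -> K) : face r N -> K :=
  if ks is k :: ks' then sxrun ks' (mutate_quiver w k q) (xmut k q x) else x.

Lemma is_seed_run (s : seed R r N) : is_seed w s -> exists ks,
  [/\ all (fun k => ~~ frozen w k) ks, seed_quiver s = mrun ks (quiver0 w)
    & seed_coord s = sxrun ks (quiver0 w) (@X R r N)].
Proof.
elim=> [|{}s k _ [ks [Mks qE xE]] fk]; first by exists [::].
exists (rcons ks k); rewrite all_rcons fk; split=> //=.
  by rewrite /mrun -cats1 foldl_cat /= -/(mrun _ _) -qE.
rewrite qE xE -cats1; elim: ks (quiver0 w) (@X R r N) {Mks qE xE} => [//|l ks IH] q x /=.
by rewrite -IH.
Qed.

Variables f g : face r N.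
Hypotheses (ff : frozen w f) (gf : frozen w g) (fg : f != g).
Let M : pred (face r N) := fun k => ~~ frozen w k.
Let U : pred (face r N) := fun a => M a || (a == f).

(** The quiver on the unfrozen faces and f is kept, all other frozen faces are cut off, and another
    frozen face g is reused as the auxiliary vertex with its single arrow to f. The coordinate at f
    along a run only involves the entries that are kept. *)
Definition extended_quiver a b : int :=
  if U a && U b then quiver0 w a b
  else (((a == g) && (b == f))%:Z - ((b == g) && (a == f))%:Z).

Let agree (q q' : face r N -> face r N -> int) :=
  forall a b, U a -> U b -> q a b = q' a b.

Let agree_mut k q q' : M k -> skew q' -> agree q q' ->
  agree (mutate_quiver w k q) (qmut k q').
Proof.
move=> Mk sq' qq a b Ua Ub; have Uk : U k by rewrite /U Mk.
rewrite /mutate_quiver; case: ifP => [/andP[fa fb]|_].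
  have /eqP af : a == f by move: Ua; rewrite /U /M fa.
  have /eqP bf : b == f by move: Ub; rewrite /U /M fb.
  rewrite af bf; have := qmut_skew k sq' f f; move: (qmut k q' f f) => z; lia.
by rewrite /qmut !qq.
Qed.

Let agree_run ks q q' (K : fieldType) (x x' : face r N -> K) : all M ks -> skew q' ->
  agree q q' -> (forall a, U a -> x a = x' a) ->
  agree (mrun ks q) (qrun ks q') /\
  forall a, U a -> sxrun ks q x a = xrun ks q' x' a.
Proof.
elim: ks q q' x x' => [//|k ks IH] q q' x x' /= /andP[Mk Mks] sq' qq xx.
apply: IH => // [||a Ua]; [exact: qmut_skew | exact: agree_mut |].
have Uk : U k by rewrite /U Mk.
by rewrite /xmut !xx // !qq.
Qed.

(** Apply [sink_unique_pos] to the run that leads from s back to the initial seed and then on to t.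
    A rational function is determined on the positive orthant. *)
Lemma sink_seed_coord (s t : seed R r N) : sink_seed w f s -> sink_seed w f t ->
  seed_coord s f = seed_coord t f.
Proof.
move=> [/is_seed_run[ks [Mks qs xs]] ss] [/is_seed_run[kt [Mkt qt xt]] st].
have Uf : U f by rewrite /U eqxx orbT.
have Mf : ~~ M f by rewrite /M negbK.
have Mg : ~~ M g by rewrite /M negbK.
have Ug : U g = false by rewrite /U (negPf Mg) eq_sym (negPf fg).
have sq : skew extended_quiver.
  move=> a b; rewrite /extended_quiver andbC.
  by case: ifP => _; rewrite ?opprB //; apply: quiver0_skew.
have aq : attached f g extended_quiver.
  split=> [|a af]; rewrite /extended_quiver Ug /=.
    by rewrite !eqxx (negPf fg) /= subr0.
  by rewrite (negPf af) eq_sym andbF [g == f]eq_sym (negPf fg) andbF subr0.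
have qq : agree (quiver0 w) extended_quiver.
  by move=> a b Ua Ub; rewrite /extended_quiver Ua Ub.
have [qsE xsE] := agree_run Mks sq qq (fun a _ => erefl (@X R r N a)).
have [qtE xtE] := agree_run Mkt sq qq (fun a _ => erefl (@X R r N a)).
have UM k : M k -> U k by rewrite /U => ->.
rewrite xs xt xsE // xtE //.
have cX ls : rep (xrun ls extended_quiver (@X R r N) f)
    (fun x => xrun ls extended_quiver x f).
  by apply: (@rep_xrun _ _ ls extended_quiver _ id) => // a; apply: rep_coord.
apply: rep_inj (cX ks) _; apply: eq_rep (cX kt) _ => x px.
(* Positive complex points are real and mutation commutes with the inclusion of R, which reduces the
   claim to real points. *)
pose y a : R := complex.Re (x a).
have xy : x = real_complex R \o y.
  apply/funext => a; rewrite /= /y.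
  have := px a; case: (x a) => u v /=; rewrite ltcE /= => /andP[/eqP -> _].
  by [].
have py : pos y.
  by move=> a; have := px a; rewrite xy /= ltcR.
rewrite xy !xrun_morph; congr (real_complex R _).
have sqs := qrun_skew ks sq; have aqs := attached_run Mf Mg sq Mks aq.
have Mp : all M (rev ks ++ kt) by rewrite all_cat all_rev Mks.
have sks k : M k -> qrun ks extended_quiver f k <= 0.
  by move=> Mk; rewrite -qsE // ?UM // -qs ss.
have skt k : M k -> qrun (rev ks ++ kt) (qrun ks extended_quiver) f k <= 0.
  by move=> Mk; rewrite qrun_cat qrunK // -qtE // ?UM // -qt st.
have := sink_unique_pos Mf fg Mg sqs aqs Mp sks skt ((chart_run R ks sq).1 _ py).
by rewrite xrun_cat qrunK // xrunK.
Qed.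

End SeedUniqueness.

(** * Faces as intervals of time, and the strip of faces of one level *)

Section Faces.
Variables (r N : nat) (w : N.-tuple 'I_r).
Implicit Types (F G H : face r N) (i : 'I_r) (j : 'I_N).

Lemma fstart_le F : (fstart F <= N)%N.
Proof. by case: F => [i|j] //=. Qed.

Lemma fstart_letter F : (0 < fstart F)%N ->
  exists2 j : 'I_N, fstart F = j.+1 & tnth w j = level w F.
Proof. by case: F => [i|j] //= _; exists j. Qed.

Lemma fend_gt F : (fstart F < fend w F)%N.
Proof. by rewrite /fend ltnS leq_addr. Qed.

Lemma fend_le F : (fend w F <= N.+1)%N.
Proof.
rewrite /fend ltnS; have := find_size (pred1 (level w F)) (drop (fstart F) w).
rewrite size_drop size_tuple -(leq_add2l (fstart F)).
by rewrite subnKC ?fstart_le.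
Qed.

Lemma nth_drop_tuple (a t : nat) i0 (lt : (a + t < N)%N) :
  nth i0 (drop a w) t = tnth w (Ordinal lt).
Proof. by rewrite nth_drop (tnth_nth i0). Qed.

Lemma fend_letter F : (fend w F <= N)%N ->
  exists2 j : 'I_N, fend w F = j.+1 & tnth w j = level w F.
Proof.
rewrite /fend => h; exists (Ordinal h) => //.
set k := find _ _ in h *.
have hk : (k < size (drop (fstart F) w))%N.
  by rewrite size_drop size_tuple; have := fstart_le F; lia.
have := @nth_find _ (level w F) (pred1 (level w F)) (drop (fstart F) w).
by rewrite has_find => /(_ hk) /eqP; rewrite nth_drop_tuple.
Qed.

Lemma no_letter F j : (fstart F <= j)%N -> (j.+1 < fend w F)%N ->
  tnth w j != level w F.
Proof.
rewrite /fend => h1 h2.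
have := @before_find _ (level w F) (pred1 (level w F)) (drop (fstart F) w) (j - fstart F).
by rewrite nth_drop subnKC // -tnth_nth => h; apply/negbT/h; rewrite ltn_subLR.
Qed.

Lemma fend_unique F j : (fstart F <= j)%N -> tnth w j = level w F ->
  (forall j', (fstart F <= j' < j)%N -> tnth w j' != level w F) ->
  fend w F = j.+1.
Proof.
move=> h1 h2 h3; have [lt|gt|//] := ltngtP (fend w F) j.+1.
  have [|j' e] := @fend_letter F; first by have := ltn_ord j; lia.
  have := fend_gt F; rewrite e => gt.
  by move=> /eqP; rewrite (negPf (h3 j' _)) //; lia.
by have := no_letter h1 gt; rewrite h2 eqxx.
Qed.

Lemma fend_infinite F : (forall j, (fstart F <= j)%N -> tnth w j != level w F) ->
  fend w F = N.+1.
Proof.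
move=> h; have := fend_le F; rewrite leq_eqVlt ltnS => /orP[/eqP //|/fend_letter[j e lj]].
by have := h j; rewrite lj eqxx; have := fend_gt F; rewrite e ltnS => -> /(_ isT).
Qed.

Lemma fend_infty_no_letter F j : fend w F = N.+1 -> (fstart F <= j)%N ->
  tnth w j != level w F.
Proof. by move=> e h; apply: no_letter => //; rewrite e !ltnS. Qed.

(* Distinct faces of the same level occupy disjoint intervals of time. *)
Lemma same_level_disjoint F G : level w F = level w G -> (fstart F < fstart G)%N ->
  (fend w F <= fstart G)%N.
Proof.
move=> lFG lt; rewrite leqNgt; apply/negP => gt.
have [|j e lj] := @fstart_letter G; first by lia.
have h1 : (fstart F <= j)%N by rewrite -ltnS -e.
have h2 : (j.+1 < fend w F)%N by rewrite -e.
by have := no_letter h1 h2; rewrite lj lFG eqxx.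
Qed.

Lemma level_start_inj F G : level w F = level w G -> fstart F = fstart G -> F = G.
Proof.
case: F G => [i|j] [i'|j'] //=; first by move=> ->.
by move=> _ [] /val_inj ->.
Qed.

(** A crossing has only one level, so it cannot bound faces of two different levels. The side
    conditions exclude the times 0 and N+1, which stand for infinity and may be shared. *)
Lemma times_neq F G : level w F != level w G ->
  [/\ (0 < fstart F)%N -> fstart F <> fstart G, (0 < fstart F)%N -> fstart F <> fend w G,
      (fend w F <= N)%N -> fend w F <> fstart G & (fend w F <= N)%N -> fend w F <> fend w G].
Proof.
move=> ne.
have eqj (j j' : 'I_N) : j.+1 = j'.+1 -> tnth w j = level w F ->
    tnth w j' = level w G -> False.
  by move=> [] /val_inj -> e1 e2; rewrite -e1 -e2 eqxx in ne.
split.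
- move=> F0 e; have [j ej lj] := fstart_letter F0.
  have [|j' ej' lj'] := @fstart_letter G; first by rewrite -e.
  by apply: (eqj j j') => //; rewrite -ej e.
- move=> F0 e; have [j ej lj] := fstart_letter F0.
  have [|j' ej' lj'] := @fend_letter G; first by rewrite -e fstart_le.
  by apply: (eqj j j') => //; rewrite -ej e.
- move=> FN e; have [j ej lj] := fend_letter FN.
  have [|j' ej' lj'] := @fstart_letter G; first by rewrite -e ej.
  by apply: (eqj j j') => //; rewrite -ej e.
- move=> FN e; have [j ej lj] := fend_letter FN.
  have [|j' ej' lj'] := @fend_letter G; first by rewrite -e.
  by apply: (eqj j j') => //; rewrite -ej e.
Qed.

Definition strip i : seq (face r N) := inl i :: [seq inr j | j <- J w i].
Notation c i t := (nth (inl i) (strip i) t).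

Lemma size_strip i : size (strip i) = (size (J w i)).+1.
Proof. by rewrite /= size_map. Qed.

Lemma mem_strip i F : (F \in strip i) = (level w F == i).
Proof.
rewrite inE; case: F => [i'|j] /=.
  rewrite (_ : (_ \in _) = false) ?orbF //.
  by apply/negP => /mapP[].
by rewrite (mem_map (@inr_inj _ _)) mem_filter mem_enum andbT.
Qed.

Lemma level_strip i t : level w (c i t) = i.
Proof.
case: (ltnP t (size (strip i))) => [h|h]; last by rewrite nth_default.
by apply/eqP; rewrite -mem_strip mem_nth.
Qed.

Lemma strip_sorted i : sorted (fun F G => (fstart F < fstart G)%N) (strip i).
Proof.
rewrite /= path_min_sorted; last by apply/allP => _ /mapP[j _ ->].
rewrite sorted_map; apply: sorted_filter.
  by move=> a b d /=; rewrite !ltnS; apply: ltn_trans.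
rewrite -(@sorted_map _ _ (fun j : 'I_N => j.+1) ltn) map_comp.
rewrite val_enum_ord (sorted_map (f := S)).
by apply: sub_sorted (iota_ltn_sorted 0 N).
Qed.

Lemma strip_mono i s t : (s < t < size (strip i))%N -> (fstart (c i s) < fstart (c i t))%N.
Proof.
move=> /andP[st tn].
apply: (sorted_ltn_nth (leT := fun F G : face r N => (fstart F < fstart G)%N)) => //.
- by move=> a b d /=; apply: ltn_trans.
- exact: strip_sorted.
- by rewrite inE (ltn_trans st).
Qed.

Lemma strip_index i F : level w F = i ->
  exists2 t, (t < size (strip i))%N & F = c i t.
Proof.
move=> lF; have iF : F \in strip i by rewrite mem_strip lF.
by exists (index F (strip i)); rewrite ?index_mem ?nth_index.
Qed.

Lemma fend_strip i t : (t < size (J w i))%N -> fend w (c i t) = fstart (c i t.+1).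
Proof.
move=> tn; have h1 : (t < t.+1 < size (strip i))%N by rewrite size_strip ltnS leqnn ltnS.
have lt := strip_mono h1.
have [|j e lj] := @fstart_letter (c i t.+1); first by lia.
rewrite e; apply: fend_unique; first by lia.
  by rewrite lj !level_strip.
move=> j' /andP[h2 h3]; rewrite level_strip; apply/negP => /eqP lj'.
have [s sn es] := @strip_index i (inr j') lj'.
have es' : j'.+1 = fstart (c i s) by rewrite -es.
have [ts|] := ltnP t s; last first.
  rewrite leq_eqVlt => /orP[/eqP st|st]; first by rewrite st in es'; lia.
  have h : (s < t < size (strip i))%N by rewrite st size_strip ltnS ltnW.
  by have := strip_mono h; lia.
have [st|] := ltnP t.+1 s.
  have h : (t.+1 < s < size (strip i))%N by rewrite st.
  by have := strip_mono h; lia.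
by rewrite leq_eqVlt ltnS => /orP[/eqP st|]; [rewrite st in es' |]; lia.
Qed.

Lemma fend_right_face i : fend w (right_face w i) = N.+1.
Proof.
have -> : right_face w i = c i (size (J w i)).
  by rewrite /right_face (last_nth (inl i)) size_map.
apply: fend_infinite => j h; rewrite level_strip; apply/negP => /eqP lj.
have [s sn es] := @strip_index i (inr j) lj.
have es' : j.+1 = fstart (c i s) by rewrite -es.
move: sn; rewrite size_strip ltnS leq_eqVlt => /orP[/eqP sn|sn].
  by rewrite -sn in h; lia.
have h' : (s < size (J w i) < size (strip i))%N by rewrite sn size_strip leqnn.
by have := strip_mono h'; lia.
Qed.

Lemma right_unboundedP F : right_unbounded w F -> F = right_face w (level w F).
Proof.
rewrite /right_unbounded => /eqP e; have [t tn Ft] := strip_index (erefl (level w F)).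
rewrite /right_face (last_nth (inl (level w F))) size_map.
rewrite [LHS]Ft; congr (nth _ _ _); apply/eqP; rewrite eqn_leq.
rewrite -ltnS -size_strip tn /= leqNgt; apply/negP => /fend_strip.
by rewrite -Ft e => h; have := fstart_le (c (level w F) t.+1); rewrite -h ltnn.
Qed.

Lemma level_right_face i : level w (right_face w i) = i.
Proof. by rewrite /right_face (last_nth (inl i)) -/(strip i) level_strip. Qed.

End Faces.

#[local] Arguments strip : simpl never.

(** * The theta functions of the faces unbounded to the left *)

Section LeftFace.
Variables (r N : nat) (w : N.-tuple 'I_r) (i : 'I_r).
Local Notation n := (size (J w i)).
Local Notation c t := (nth (inl i : face r N) (strip w i) t).
Implicit Types (a b : face r N) (s t : nat).

Definition adjacent (l m : 'I_r) : bool := (l == m.+1 :> nat) || (m == l.+1 :> nat).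

Lemma adjacentC l m : adjacent l m = adjacent m l.
Proof. by rewrite /adjacent orbC. Qed.

Lemma adjacent_neq l m : adjacent l m -> l != m.
Proof. by rewrite /adjacent => h; apply/negP => /eqP e; move: h; rewrite e; lia. Qed.

Definition crosses a b : bool :=
  [&& (fstart b < fstart a)%N, (fstart a < fend w b)%N & (fend w b < fend w a)%N].

Lemma arrowE a b : arrow w a b =
  ((level w a == level w b) && (fend w a == fstart b))
  || (adjacent (level w a) (level w b) && crosses a b).
Proof. by []. Qed.

Lemma quiver0E a b : ~~ (frozen w a && frozen w b) ->
  quiver0 w a b = (arrow w a b)%:Z - (arrow w b a)%:Z.
Proof. by rewrite /quiver0 => /negPf ->. Qed.

Lemma strip_uniq s t : (s <= n)%N -> (t <= n)%N -> (c s == c t) = (s == t).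
Proof.
move=> sn tn; apply/eqP/eqP => [e|->//]; have [st|ts|//] := ltngtP s t.
  have h : (s < t < size (strip w i))%N by rewrite st size_strip ltnS.
  by have := strip_mono h; rewrite e ltnn.
have h : (t < s < size (strip w i))%N by rewrite ts size_strip ltnS.
by have := strip_mono h; rewrite e ltnn.
Qed.

Lemma strip0 : c 0 = inl i. Proof. by []. Qed.

Lemma strip_frozen t : (0 < t < n)%N -> ~~ frozen w (c t).
Proof.
move=> /andP[t0 tn]; rewrite /frozen /right_unbounded fend_strip //.
have h : (0 < t < size (strip w i))%N by rewrite t0 size_strip ltnS ltnW.
have := strip_mono h; rewrite strip0 /= => f0.
by rewrite gtn_eqF //= neq_ltn ltnS fstart_le.
Qed.

Lemma arrow_strip s t : (s <= n)%N -> (t <= n)%N -> arrow w (c s) (c t) = (t == s.+1).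
Proof.
move=> sn tn; rewrite arrowE !level_strip eqxx.
have -> : adjacent i i = false by apply/negP => /adjacent_neq; rewrite eqxx.
rewrite orbF /=; have [sn'|] := ltnP s n.
  rewrite fend_strip //; apply/eqP/eqP => [e|->//].
  apply/eqP; rewrite -strip_uniq //; apply/eqP/esym.
  by apply: (@level_start_inj _ _ w); rewrite // !level_strip.
move=> ns; have -> : s = n by apply/eqP; rewrite eqn_leq sn.
have -> : fend w (c n) = N.+1.
  have := fend_right_face w i; rewrite /right_face (last_nth (inl i)) size_map.
  by [].
by have := fstart_le (c t); case: eqP => [<-|_ _]; rewrite ?ltnn //; lia.
Qed.

Fixpoint left_quiver t : face r N -> face r N -> int :=
  if t is t'.+1 then mutate_quiver w (c t) (left_quiver t') else quiver0 w.

(* Row of c u in left_quiver u.-1. *)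
Definition next_row (u : nat) b : int :=
  if level w b == i then
    (b == c u.+1)%:Z + ((1 < u)%N && (b == c u.-1))%:Z - (b == c 0)%:Z
  else if adjacent (level w b) i then
    [&& (fstart b < fstart (c 1))%N, (fstart (c u) < fend w b)%N
       & (fend w b < fend w (c u))%N]%:Z
    - [&& (fstart (c 1) < fstart b)%N, (fstart b < fend w (c u))%N
         & (fend w (c u) < fend w b)%N]%:Z
  else 0.

(** Row of [c 0] in [left_quiver t], at unfrozen columns. *)
Definition left_row (t : nat) b : int :=
  if level w b == i then (b == c t.+1)%:Z - ((0 < t)%N && (b == c t))%:Z
  else if adjacent (level w b) i then
    - [&& (0 < fstart b)%N, (fstart b < fstart (c 1))%N
         & (fend w (c t) < fend w b)%N]%:Z
  else 0.

Lemma left_quiver_skew t : skew (left_quiver t).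
Proof.
elim: t => [|t IH]; [exact: quiver0_skew | exact: mutate_quiver_skew].
Qed.

(** Three kinds of rows control the subsequent mutations: those of the strip faces not yet close to
    being mutated, which are unchanged, that of the next face to be mutated, and that of the left
    face. *)
Let inv t : Prop := [/\
  forall s b, (t.+1 < s < n)%N -> left_quiver t (c s) b = quiver0 w (c s) b,
  (t.+1 < n)%N -> forall b, left_quiver t (c t.+1) b = next_row t.+1 b &
  forall b, ~~ frozen w b -> left_quiver t (c 0) b = left_row t b].

Lemma quiver0_strip s b : (0 < s < n)%N -> quiver0 w (c s) b =
  if level w b == i then (b == c s.+1)%:Z - (b == c s.-1)%:Z
  else if adjacent (level w b) i then (crosses (c s) b)%:Z - (crosses b (c s))%:Z
  else 0.
Proof.
move=> sn; have [s0 sn'] := andP sn.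
rewrite quiver0E; last by rewrite (negPf (strip_frozen sn)).
case: eqP => [lb|/eqP lb].
  have [t tn ->] := strip_index lb; move: tn; rewrite size_strip ltnS => tn.
  rewrite !arrow_strip ?(ltnW sn') // !strip_uniq //; last by lia.
  by case: s s0 {sn sn'} => // s _; rewrite eqSS [s == t]eq_sym.
have lb' : (i == level w b) = false by rewrite eq_sym (negPf lb).
rewrite !arrowE !level_strip lb' (negPf lb) !andFb !orFb [adjacent i _]adjacentC.
case: ifP => _ //.
Qed.

Lemma quiver0_left b : (0 < n)%N -> ~~ frozen w b -> quiver0 w (c 0) b = left_row 0 b.
Proof.
move=> n0 fb; rewrite quiver0E; last by rewrite (negPf fb) andbF.
rewrite /left_row; case: eqP => [lb|/eqP lb].
  have [t tn bE] := strip_index lb; move: tn; rewrite size_strip ltnS => tn.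
  rewrite bE !arrow_strip // !strip_uniq //; lia.
have lb' : (i == level w b) = false by rewrite eq_sym (negPf lb).
rewrite !arrowE !level_strip lb' (negPf lb) !andFb !orFb [adjacent i _]adjacentC.
case: ifP => _ //.
rewrite /crosses fend_strip // [fstart (c 0)]/=; lia.
Qed.

Let inv0 : (0 < n)%N -> inv 0.
Proof.
move=> n0; split=> // [n1 b|b fb]; last exact: quiver0_left.
rewrite -[left_quiver 0 _ b]/(quiver0 w (c 1) b) quiver0_strip // /next_row /=; case: ifP => _; first by rewrite addr0.
by case: ifP => // _; rewrite /crosses.
Qed.

(** The mutated face receives one arrow from [c 0] and sends one to [c t.+2]. The new rows of these
    two are therefore the old ones corrected by the positive or negative part of the row of the
    mutated face, and the rest is a comparison of times. *)
Let invS t : (t.+1 < n)%N -> inv t -> inv t.+1.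
Proof.
move=> tn [inv1 inv2 inv3].
have rk := inv2 tn; set k := c t.+1 in rk.
have fk : ~~ frozen w k by apply: strip_frozen.
have lk : level w k = i by rewrite level_strip.
have p0 : (fstart (c 1) <= fstart k)%N.
  rewrite /k; case: t {inv1 inv2 inv3 rk k fk lk} tn => // t tn.
  by apply/ltnW/strip_mono; rewrite size_strip /= ltnS ltnW.
have p1 : (0 < fstart (c 1))%N.
  have h : (0 < 1 < size (strip w i))%N by rewrite size_strip; lia.
  by have := strip_mono h; lia.
have km : (fstart k < fend w k)%N := fend_gt w k.
have kE : fend w k = fstart (c t.+2) by rewrite fend_strip.
have kS s : (0 < s)%N -> (s <= n)%N -> (c s == k) = (s == t.+1).
  by move=> s0 sn; rewrite strip_uniq // ltnW.
have kadj b : (level w b == i) = false -> (b == k) = false.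
  by move=> lb; apply: contraFF lb => /eqP ->; rewrite lk.
split=> [s b sn|tn2 b|b fb];
  rewrite -[left_quiver t.+1]/(mutate_quiver w k (left_quiver t)) /mutate_quiver.
- have [s1 s2] := andP sn.
  have fs : ~~ frozen w (c s) by apply: strip_frozen; rewrite s2 (leq_trans _ s1).
  rewrite (negPf fs) andFb.
  have e1 b' : left_quiver t (c s) b' = quiver0 w (c s) b'.
    by apply: inv1; rewrite s2 andbT ltnW.
  have sk : left_quiver t (c s) k = 0.
    rewrite e1 quiver0_strip ?s2 ?(leq_trans _ s1) // lk eqxx !strip_uniq; lia.
  have -> : (c s == k) = false by rewrite kS; lia.
  rewrite orFb.
  have ks : left_quiver t k (c s) = 0 by rewrite left_quiver_skew sk oppr0.
  case: eqP => [->|_]; first by rewrite sk -e1 sk.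
  by rewrite sk ks e1 /Num.max ltxx mul0r mulr0 subr0 addr0.
- have fs : ~~ frozen w (c t.+2) by apply: strip_frozen.
  rewrite (negPf fs) andFb.
  have e1 b' : left_quiver t (c t.+2) b' = quiver0 w (c t.+2) b'.
    by apply: inv1; rewrite ltnSn.
  have sk : left_quiver t (c t.+2) k = -1.
    rewrite e1 quiver0_strip // lk eqxx !strip_uniq; lia.
  have -> : (c t.+2 == k) = false by rewrite kS; lia.
  have ks : left_quiver t k (c t.+2) = 1 by rewrite left_quiver_skew sk.
  have bk : left_quiver t b k = - next_row t.+1 b by rewrite left_quiver_skew rk.
  rewrite orFb sk ks e1 bk.
  case: eqP => [->|/eqP nbk].
    rewrite -e1 sk /next_row lk eqxx /k !strip_uniq //; lia.
  have -> : Num.max 0 (-1 : int) = 0 by [].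
  have -> : Num.max 0 (1 : int) = 1 by [].
  rewrite mul0r addr0 mulr1 quiver0_strip //.
  rewrite /next_row; case: ifP => lb.
    have [s sn bE] := strip_index (eqP lb); move: sn; rewrite size_strip ltnS => sn.
    move: nbk; rewrite bE /k !strip_uniq //; lia.
  case: ifP => ab //; rewrite -/k.
  have lp : level w b != level w (c 1) by rewrite level_strip lb.
  have l2 : level w b != level w (c t.+2) by rewrite level_strip lb.
  have [A1 _ _ _] := times_neq lp.
  have [B1 _ _ B4] := times_neq l2.
  have m3 : fend w (c t.+2) = fstart (c t.+3) by rewrite fend_strip.
  have m3N := fstart_le (c t.+3); have sb := fend_gt w b.
  have m2 := fend_gt w (c t.+2); have eb := fend_le w b.
  rewrite /crosses kE m3 in B1 B4 *.
  move: A1 B1 B4 p0 p1 km sb m2 eb m3N; rewrite kE m3.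
  move: (fstart (c 1)) (fstart k) (fstart (c t.+2)) (fstart (c t.+3)) (fstart b) (fend w b).
  move=> p m1 m2' m3' s e; lia.
have fb' : frozen w b = false by apply/negP/negP.
rewrite fb' andbF.
have k0 : (c 0 == k) = false by rewrite strip_uniq // ltnW.
rewrite k0 orFb inv3 //.
have ck : left_quiver t (c 0) k = 1.
  rewrite inv3 // /left_row lk eqxx /k !strip_uniq; lia.
have kc : left_quiver t k (c 0) = -1 by rewrite left_quiver_skew ck.
rewrite ck kc rk.
have -> : Num.max 0 (-1 : int) = 0 by [].
have -> : Num.max 0 (1 : int) = 1 by [].
rewrite mulr0 subr0 mul1r.
case: eqP => [->|/eqP nbk]; first by rewrite /left_row lk eqxx /k !strip_uniq; lia.
have bc0 : b != c 0.
  by apply: contraNneq fb => ->; rewrite /frozen strip0.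
rewrite /left_row /next_row; case: ifP => lb.
  have [s sn bE] := strip_index (eqP lb); move: sn; rewrite size_strip ltnS => sn.
  by move: nbk bc0; rewrite bE /k !strip_uniq //; lia.
case: ifP => ab //; rewrite -/k.
have lp : level w b != level w (c 1) by rewrite level_strip lb.
have l2 : level w b != level w (c t.+2) by rewrite level_strip lb.
have [A1 A2 _ _] := times_neq lp.
have [_ _ B3 _] := times_neq l2.
have ct : fend w (c t) = fstart k by rewrite fend_strip // ltnW.
have kN := fstart_le (c t.+2).
have sb0 : (0 < fstart b)%N by move: fb'; rewrite /frozen; case: fstart.
have sb := fend_gt w b; have eb := fend_le w b.
rewrite ct kE.
move: A1 B3 p0 p1 km sb eb kN sb0; rewrite kE.
move: (fstart (c 1)) (fstart k) (fstart (c t.+2)) (fstart b) (fend w b).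
move=> p m1 m2 s e; lia.
Qed.

Lemma left_quiver_inv t : (t < n)%N -> inv t.
Proof.
by elim: t => [|t IH] tn; [exact: inv0 | apply: invS => //; apply: IH; apply: ltnW].
Qed.

Lemma left_quiver_frozen t a b : frozen w a -> frozen w b -> left_quiver t a b = 0.
Proof. by case: t => [|t] fa fb; rewrite /= /quiver0 /mutate_quiver fa fb. Qed.

Lemma left_quiver_sink b : (0 < n)%N -> left_quiver n.-1 (inl i) b <= 0.
Proof.
move=> n0; have [|_ _ H] := @left_quiver_inv n.-1; first by rewrite prednK.
rewrite -strip0; case fb: (frozen w b); first by rewrite left_quiver_frozen // /frozen strip0.
rewrite H ?fb // /left_row; case: ifP => lb; last by case: ifP => _ //; lia.
(* The only positive entry of the row sits at the last face of the strip, which is unbounded to the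
   right and hence frozen. *)
have -> : (b == c n.-1.+1) = false; last by lia.
rewrite prednK //; apply: contraFF fb => /eqP ->.
have <- : right_face w i = c n by rewrite /right_face (last_nth (inl i)) size_map.
by rewrite /frozen /right_unbounded fend_right_face eqxx orbT.
Qed.

Section Coordinates.
Variables (K : fieldType) (x : face r N -> K).

Fixpoint left_coord t : face r N -> K :=
  if t is t'.+1 then xmut (c t) (left_quiver t') (left_coord t') else x.

Definition left_prod u : K := \prod_(v < u) (x (c v.+1))^-1.
Definition left_sum t : K := \sum_(u < t.+1) left_prod u.

Hypotheses (x0 : forall a, x a != 0) (S0 : forall t, left_sum t != 0).

Let prod0 u : left_prod u != 0.
Proof. by apply/prodf_neq0 => v _; rewrite invr_eq0. Qed.

(** With S the partial sums and P the products, the coordinate of the mutated face is S_t / P_(t+1),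
    so the factor 1 + P_(t+1) / S_t equals S_(t+1) / S_t and the product of these factors
    telescopes. *)
Let left_coord_inv t : (t < n)%N -> [/\ left_coord t (c 0) = x (c 0) / left_sum t,
  (t.+1 < n)%N -> left_coord t (c t.+1) = left_sum t / left_prod t.+1 &
  forall s, (t.+1 < s < n)%N -> left_coord t (c s) = x (c s)].
Proof.
elim: t => [|t IH] tn.
  have s1 : left_sum 0 = 1 by rewrite /left_sum big_ord1 /left_prod big_ord0.
  rewrite s1; split=> //; first by rewrite divr1.
  by move=> _; rewrite /left_prod big_ord1 mul1r invrK.
have [IH1 /(_ tn) IH2 IH3] := IH (ltnW tn).
have [inv1 /(_ tn) inv2 _] := left_quiver_inv (ltnW tn).
have qk b : left_quiver t b (c t.+1) = - next_row t.+1 b.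
  by rewrite left_quiver_skew inv2.
have SS : left_sum t.+1 = left_sum t + left_prod t.+1 by rewrite /left_sum big_ord_recr.
have S1 := S0 t; have S2 := S0 t.+1; have P1 := prod0 t.+1.
rewrite -[left_coord t.+1]/(xmut (c t.+1) (left_quiver t) (left_coord t)) /xmut.
have k0 : (c 0 == c t.+1) = false by rewrite strip_uniq // ltnW.
split.
- have -> : left_quiver t (c 0) (c t.+1) = 1.
    by rewrite qk /next_row level_strip eqxx !strip_uniq; lia.
  rewrite k0 IH1 IH2 gtr0_sgz // !exprN1 SS; field.
  by rewrite -SS S1 S2 P1.
- move=> tn2; have -> : (c t.+2 == c t.+1) = false by rewrite strip_uniq; lia.
  have -> : left_quiver t (c t.+2) (c t.+1) = -1.
    by rewrite qk /next_row level_strip eqxx !strip_uniq; lia.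
  rewrite IH3 ?ltnSn ?tn2 // IH2 ltr0_sgz // !opprK !expr1z SS.
  have -> : left_prod t.+2 = left_prod t.+1 / x (c t.+2) by rewrite /left_prod big_ord_recr.
  field.
  by rewrite ?P1 ?x0.
move=> s sn; have [s1 s2] := andP sn.
have -> : (c s == c t.+1) = false by rewrite strip_uniq; lia.
have -> : left_quiver t (c s) (c t.+1) = 0.
  by rewrite qk /next_row level_strip eqxx !strip_uniq; lia.
by rewrite oppr0 expr0z mulr1 IH3 // s2 andbT ltnW.
Qed.

Lemma left_coordE : (0 < n)%N -> left_coord n.-1 (inl i) = x (inl i) / left_sum n.-1.
Proof. by move=> n0; have [|-> //] := @left_coord_inv n.-1; rewrite prednK. Qed.

End Coordinates.

Variable R : realType.

Fixpoint left_seed t : seed R r N :=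
  if t is t'.+1 then mutate w (c t) (left_seed t') else seed0 R w.

Let left_seedE t : seed_quiver (left_seed t) = left_quiver t /\
  seed_coord (left_seed t) = left_coord (@X R r N) t.
Proof.
elim: t => [|t [IHq IHx]]; first by split.
split; first by rewrite -[RHS]/(mutate_quiver w (c t.+1) (left_quiver t)) -IHq.
rewrite -[RHS]/(xmut (c t.+1) (left_quiver t) (left_coord (@X R r N) t)) -IHq -IHx.
by [].
Qed.

Lemma left_seed_is_seed t : (t < n)%N -> is_seed w (left_seed t).
Proof.
elim: t => [|t IH] tn; first exact: is_seed0.
by apply: is_seed_mutate; [apply/IH/ltnW | apply: strip_frozen].
Qed.

Lemma left_sink_seed : (0 < n)%N -> sink_seed w (inl i) (left_seed n.-1).
Proof.
move=> n0; split; first by apply: left_seed_is_seed; rewrite prednK.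
by move=> a; rewrite (left_seedE _).1; apply: left_quiver_sink.
Qed.

Lemma left_sink_coord : (0 < n)%N ->
  (forall t, left_sum (@X R r N) t != 0) -> (forall F, @X R r N F != 0) ->
  (seed_coord (left_seed n.-1) (inl i))^-1 = left_sum (@X R r N) n.-1 / X R (inl i).
Proof.
move=> n0 S0 X0; rewrite (left_seedE _).2 left_coordE // invf_div.
by [].
Qed.

End LeftFace.

(** * Wiring diagrams and marked faces in terms of natural numbers *)

Definition swp (l h : nat) : nat :=
  if h == l then l.+1 else if h == l.+1 then l else h.

(* Heights are numbered from 0; gap h lies below height h, so that level l is
   gap l.+1. *)
Fixpoint line (u : nat -> nat) (t h : nat) : nat :=
  if t is t'.+1 then line u t' (swp (u t') h) else h.

(** [P j] marks the face to the right of crossing j; the result is the mark of the face that slice t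
    meets in gap h. Faces unbounded to the left are never marked. *)
Fixpoint gap (u : nat -> nat) (P : nat -> bool) (t h : nat) : bool :=
  if t is t'.+1 then if h == (u t').+1 then P t' else gap u P t' h else false.

(* la, lb: orientations (true = leftward) of the lines that leave the crossing
   below and above on its left side. *)
Definition cross_ok (la lb below left right above : bool) : bool :=
  match la, lb with
  | true, true => [&& above ==> right, right ==> left & left ==> below]
  | false, false => [&& below ==> right, right ==> left & left ==> above]
  | true, false => [&& left ==> above, left ==> below, above ==> right & below ==> right]
  | false, true => false
  end.

(** The marked region, lying to the left of its boundary path, is below leftward and above rightward
    lines. When both lines point the same way, the implication from right to left excludes moreover
    the straight passage forbidden by rigour. *)
Definition crossing_ok (i : nat) (u : nat -> nat) (P : nat -> bool) (t : nat) : bool :=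
  cross_ok (line u t (u t) <= i)%N (line u t (u t).+1 <= i)%N
    (gap u P t (u t)) (gap u P t (u t).+1) (P t) (gap u P t (u t).+2).

(** Every crossing exchanges two lines still in their original order, so no two lines cross twice:
    this is how reducedness is used. *)
Definition increasing (u : nat -> nat) (m : nat) :=
  forall t, (t < m)%N -> (line u t (u t) < line u t (u t).+1)%N.

Lemma swpK l : involutive (swp l).
Proof. by move=> h; rewrite /swp; do !case: eqP; lia. Qed.

Lemma swpL l : swp l l = l.+1. Proof. by rewrite /swp eqxx. Qed.
Lemma swpR l : swp l l.+1 = l. Proof. by rewrite /swp eqxx gtn_eqF. Qed.
Lemma swp_above l : swp l l.+2 = l.+2.
Proof. by rewrite /swp; do !case: eqP; lia. Qed.
Lemma swp_below l : swp l.+1 l = l.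
Proof. by rewrite /swp; do !case: eqP; lia. Qed.
Definition swpE := (swpL, swpR, swp_above, swp_below).

Lemma swp_braid a b h : (a == b.+1) || (b == a.+1) ->
  swp a (swp b (swp a h)) = swp b (swp a (swp b h)).
Proof. by rewrite /swp => ab; do !case: eqP; lia. Qed.

Lemma swp_comm a b h : a != b -> a != b.+1 -> b != a.+1 ->
  swp a (swp b h) = swp b (swp a h).
Proof. by rewrite /swp => *; do !case: eqP; lia. Qed.

Lemma line_eq u u' t : (forall s, (s < t)%N -> u s = u' s) -> line u t =1 line u' t.
Proof.
elim: t => [//|t IH] uu h /=; rewrite uu // IH // => s st; apply: uu.
exact: ltnW.
Qed.

Lemma gap_eq u u' P P' t : (forall s, (s < t)%N -> u s = u' s) ->
  (forall s, (s < t)%N -> P s = P' s) -> gap u P t =1 gap u' P' t.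
Proof.
elim: t => [//|t IH] uu PP h /=; rewrite uu // PP // IH // => s st.
  by apply: uu; apply: ltnW.
by apply: PP; apply: ltnW.
Qed.

Lemma line_shift u u' t d : line u t =1 line u' t ->
  (forall s, (t <= s < t + d)%N -> u s = u' s) -> line u (t + d) =1 line u' (t + d).
Proof.
elim: d => [|d IH] e uu h; first by rewrite addn0.
rewrite addnS /= (uu (t + d)%N); last by rewrite leq_addr addnS ltnSn.
by apply: IH => // s /andP[s1 s2]; apply: uu; rewrite s1 addnS ltnW.
Qed.

Lemma gap_shift u u' P P' t d : gap u P t =1 gap u' P' t ->
  (forall s, (t <= s < t + d)%N -> u s = u' s) ->
  (forall s, (t <= s < t + d)%N -> P s = P' s) ->
  gap u P (t + d) =1 gap u' P' (t + d).
Proof.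
elim: d => [|d IH] e uu PP h; first by rewrite addn0.
have td : (t <= t + d < t + d.+1)%N by rewrite leq_addr addnS ltnSn.
rewrite addnS /= (uu (t + d)%N) // (PP (t + d)%N) // IH // => s /andP[s1 s2].
  by apply: uu; rewrite s1 addnS ltnW.
by apply: PP; rewrite s1 addnS ltnW.
Qed.

Section CommMove.
Variables (u u' : nat -> nat) (p : nat).
Hypotheses (far : [&& u p != u p.+1, u p != (u p.+1).+1 & u p.+1 != (u p).+1])
  (u'0 : u' p = u p.+1) (u'1 : u' p.+1 = u p)
  (uE : forall t, t != p -> t != p.+1 -> u' t = u t).

Lemma comm_line t : t != p.+1 -> line u' t =1 line u t.
Proof.
move=> tp; have lo s : (s <= p)%N -> line u' s =1 line u s.
  by move=> sp; apply: line_eq => q qs; apply: uE; lia.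
have hi : line u' p.+2 =1 line u p.+2.
  move=> h /=; rewrite u'0 u'1 lo // swp_comm //; case/and3P: far => *; lia.
case: (leqP t p) => [/lo //|pt]; have -> : t = (p.+2 + (t - p.+2))%N by lia.
by apply: line_shift hi _ => s /andP[s1 s2]; apply: uE; lia.
Qed.

Variables (P P' : nat -> bool).
Hypotheses (P'0 : P' p = P p.+1) (P'1 : P' p.+1 = P p)
  (PE : forall t, t != p -> t != p.+1 -> P' t = P t).

Lemma comm_gap t : t != p.+1 -> gap u' P' t =1 gap u P t.
Proof.
move=> tp; have lo s : (s <= p)%N -> gap u' P' s =1 gap u P s.
  by move=> sp; apply: gap_eq => q qs; [apply: uE | apply: PE]; lia.
have hi : gap u' P' p.+2 =1 gap u P p.+2.
  move=> h /=; rewrite u'0 u'1 P'0 P'1 lo //; case/and3P: far => *.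
  by do !case: eqP => ? //; lia.
case: (leqP t p) => [/lo //|pt]; have -> : t = (p.+2 + (t - p.+2))%N by lia.
by apply: gap_shift hi _ _ => s /andP[s1 s2]; [apply: uE | apply: PE]; lia.
Qed.

Lemma comm_crossing i t : t != p -> t != p.+1 ->
  crossing_ok i u' P' t = crossing_ok i u P t.
Proof.
by move=> t0 t1; rewrite /crossing_ok uE // PE // !comm_line // !comm_gap.
Qed.

Lemma comm_crossing0 i : crossing_ok i u' P' p = crossing_ok i u P p.+1.
Proof.
rewrite /crossing_ok u'0 P'0 /= !comm_line ?neq_ltn ?leqnn // !comm_gap ?neq_ltn ?leqnn //.
rewrite !eqSS; case/and3P: far => f1 f2 f3.
have s0 : swp (u p) (u p.+1) = u p.+1 by rewrite /swp; do !case: eqP => ?; lia.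
have s1 : swp (u p) (u p.+1).+1 = (u p.+1).+1 by rewrite /swp; do !case: eqP => ?; lia.
rewrite s0 s1.
have -> : (u p.+1 == (u p).+1) = false by lia.
have -> : (u p.+1 == u p) = false by lia.
by have -> : ((u p.+1).+1 == u p) = false by lia.
Qed.

End CommMove.

(** Admissibility at the three crossings with letters m, m+1, m, and in [down3] with letters m+1, m,
    m+1. X, Y, Z are the orientations of the three lines from bottom to top on the left, and k is
    the mark of the triangle. *)
Definition up3 (X Y Z below lo hi above k lo' hi' : bool) : bool :=
  [&& cross_ok X Y below lo k hi, cross_ok X Z k hi hi' above
    & cross_ok Y Z below k lo' hi'].

Definition down3 (X Y Z below lo hi above k lo' hi' : bool) : bool :=
  [&& cross_ok Y Z lo hi k above, cross_ok X Z below lo lo' k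
    & cross_ok X Y lo' k hi' above].

(* The two sides of the braid move, summed over the two states of the
   triangle. *)
Lemma braid_weights (K : fieldType) (y : K) (X Y Z below lo hi above lo' hi' : bool) :
  y != 0 -> 1 + y != 0 -> Y ==> X -> Z ==> Y ->
  (up3 X Y Z below lo hi above false lo' hi')%:R
    + (up3 X Y Z below lo hi above true lo' hi')%:R * y^-1
  = ((down3 X Y Z below lo hi above false lo' hi')%:R
    + (down3 X Y Z below lo hi above true lo' hi')%:R * y)
    * ((if lo then 1 + y^-1 else 1) * (if hi' then 1 + y^-1 else 1)
    / ((if hi then 1 + y else 1) * (if lo' then 1 + y else 1))).
Proof.
move=> y0 y1.
have e : 1 + y^-1 = (1 + y) / y by field.
rewrite e; rewrite /up3 /down3.
(* Orientations are monotone in the label, so only four triples remain; then all marks of the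
   surrounding faces are enumerated. *)
case: X; case: Y => //= _; case: Z => //= _.
all: case: below; case: lo; case: hi; case: above; case: lo'; case: hi'.
all: rewrite /= ?mul0r ?add0r ?addr0 ?mul0r ?mul1r ?divr1 ?mulr1 //.
all: by field; rewrite ?y0 ?y1 ?oner_eq0.
Qed.

Section BraidMove.
Variables (u u' : nat -> nat) (p : nat).
Hypotheses (adj : (u p == (u p.+1).+1) || (u p.+1 == (u p).+1)) (u2 : u p.+2 = u p)
  (u'0 : u' p = u p.+1) (u'1 : u' p.+1 = u p) (u'2 : u' p.+2 = u p.+1)
  (uE : forall t, t != p -> t != p.+1 -> t != p.+2 -> u' t = u t).

Lemma braid_line t : t != p.+1 -> t != p.+2 -> line u' t =1 line u t.
Proof.
move=> tp1 tp2; have lo s : (s <= p)%N -> line u' s =1 line u s.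
  by move=> sp; apply: line_eq => q qs; apply: uE; lia.
have hi : line u' p.+3 =1 line u p.+3.
  by move=> h; rewrite /= u'0 u'1 u'2 u2 lo // swp_braid // orbC.
case: (leqP t p) => [/lo //|pt]; have -> : t = (p.+3 + (t - p.+3))%N by lia.
by apply: line_shift hi _ => s /andP[s1 s2]; apply: uE; lia.
Qed.

Variables (P P' : nat -> bool).
Hypotheses (P'1 : P' p.+1 = P p.+2) (P'2 : P' p.+2 = P p.+1)
  (PE : forall t, t != p -> t != p.+1 -> t != p.+2 -> P' t = P t).

Lemma braid_gap t : t != p.+1 -> t != p.+2 -> gap u' P' t =1 gap u P t.
Proof.
move=> tp1 tp2; have lo s : (s <= p)%N -> gap u' P' s =1 gap u P s.
  by move=> sp; apply: gap_eq => q qs; [apply: uE | apply: PE]; lia.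
have hi : gap u' P' p.+3 =1 gap u P p.+3.
  move=> h; rewrite /= u'0 u'1 u'2 u2 P'1 P'2 lo //.
  by do !case: eqP => ? //; lia.
case: (leqP t p) => [/lo //|pt]; have -> : t = (p.+3 + (t - p.+3))%N by lia.
by apply: gap_shift hi _ _ => s /andP[s1 s2]; [apply: uE | apply: PE]; lia.
Qed.

Lemma braid_crossing i t : t != p -> t != p.+1 -> t != p.+2 ->
  crossing_ok i u' P' t = crossing_ok i u P t.
Proof.
by move=> t0 t1 t2; rewrite /crossing_ok uE // PE // !braid_line // !braid_gap.
Qed.

End BraidMove.

Section Triangle.
Variables (i : nat) (u : nat -> nat) (P : nat -> bool) (p m : nat).
Let o h := (line u p h <= i)%N.

Lemma three_up : u p = m -> u p.+1 = m.+1 -> u p.+2 = m ->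
  [&& crossing_ok i u P p, crossing_ok i u P p.+1 & crossing_ok i u P p.+2] =
  up3 (o m) (o m.+1) (o m.+2) (gap u P p m) (gap u P p m.+1) (gap u P p m.+2)
    (gap u P p m.+3) (P p) (P p.+2) (P p.+1).
Proof.
move=> e0 e1 e2; rewrite /crossing_ok /= e0 e1 e2 /up3 /o /swp.
have n1 : (m == m.+1) = false by lia.
have n2 : (m.+1 == m) = false by lia.
have n3 : (m == m.+2) = false by lia.
have n4 : (m.+2 == m) = false by lia.
by rewrite !eqxx !eqSS ?n1 ?n2 ?n3 ?n4 /= ?eqxx ?eqSS ?n1 ?n2 ?n3 ?n4 /= ?eqxx ?eqSS ?n1 ?n2 ?n3 ?n4.
Qed.

Lemma three_down : u p = m.+1 -> u p.+1 = m -> u p.+2 = m.+1 ->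
  [&& crossing_ok i u P p, crossing_ok i u P p.+1 & crossing_ok i u P p.+2] =
  down3 (o m) (o m.+1) (o m.+2) (gap u P p m) (gap u P p m.+1) (gap u P p m.+2)
    (gap u P p m.+3) (P p) (P p.+1) (P p.+2).
Proof.
move=> e0 e1 e2; rewrite /crossing_ok /= e0 e1 e2 /down3 /o /swp.
have n1 : (m == m.+1) = false by lia.
have n2 : (m.+1 == m) = false by lia.
have n3 : (m == m.+2) = false by lia.
have n4 : (m.+2 == m) = false by lia.
by rewrite !eqxx !eqSS ?n1 ?n2 ?n3 ?n4 /= ?eqxx ?eqSS ?n1 ?n2 ?n3 ?n4 /= ?eqxx ?eqSS ?n1 ?n2 ?n3 ?n4.
Qed.

End Triangle.

Definition ascent u t := (line u t (u t) < line u t (u t).+1)%N.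

Section Ascents.
Variables (u : nat -> nat) (p m : nat).
Let lt a b := (line u p a < line u p b)%N.

(** Before and after a braid move the same three pairs of lines cross, in a different order;
    [ascent_down] has the same right-hand side. *)
Lemma ascent_up : u p = m -> u p.+1 = m.+1 -> u p.+2 = m ->
  [&& ascent u p, ascent u p.+1 & ascent u p.+2] =
  [&& lt m m.+1, lt m m.+2 & lt m.+1 m.+2].
Proof.
move=> e0 e1 e2; rewrite /ascent /= e0 e1 e2 /lt /swp.
have n1 : (m == m.+1) = false by lia.
have n2 : (m.+1 == m) = false by lia.
have n3 : (m == m.+2) = false by lia.
have n4 : (m.+2 == m) = false by lia.
by rewrite !eqxx !eqSS ?n1 ?n2 ?n3 ?n4 /= ?eqxx ?eqSS ?n1 ?n2 ?n3 ?n4 /= ?eqxx ?eqSS ?n1 ?n2 ?n3 ?n4.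
Qed.

Lemma ascent_down : u p = m.+1 -> u p.+1 = m -> u p.+2 = m.+1 ->
  [&& ascent u p, ascent u p.+1 & ascent u p.+2] =
  [&& lt m m.+1, lt m m.+2 & lt m.+1 m.+2].
Proof.
move=> e0 e1 e2; rewrite /ascent /= e0 e1 e2 /lt /swp.
have n1 : (m == m.+1) = false by lia.
have n2 : (m.+1 == m) = false by lia.
have n3 : (m == m.+2) = false by lia.
have n4 : (m.+2 == m) = false by lia.
rewrite !eqxx !eqSS ?n1 ?n2 ?n3 ?n4 /= ?eqxx ?eqSS ?n1 ?n2 ?n3 ?n4 /= ?eqxx ?eqSS ?n1 ?n2 ?n3 ?n4.
by case: (_ < _)%N; case: (_ < _)%N; case: (_ < _)%N.
Qed.

End Ascents.

Section Increasing.
Variables (u u' : nat -> nat) (p m : nat).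

Lemma comm_increasing :
  [&& u p != u p.+1, u p != (u p.+1).+1 & u p.+1 != (u p).+1] ->
  u' p = u p.+1 -> u' p.+1 = u p ->
  (forall t, t != p -> t != p.+1 -> u' t = u t) -> (p.+1 < m)%N ->
  increasing u m -> increasing u' m.
Proof.
move=> far u'0 u'1 uE pm iu t tm.
have L s : s != p.+1 -> line u' s =1 line u s.
  exact: (@comm_line u u' p far u'0 u'1 uE).
have [->|tp] := eqVneq t p.
  rewrite u'0 !L ?neq_ltn ?leqnn //; have := iu _ pm; rewrite /= /swp.
  by case/and3P: far => f1 f2 f3; do !case: eqP => ?; lia.
have [->|tp1] := eqVneq t p.+1; last by rewrite uE // !L //; apply: iu.
have /iu : (p < m)%N by lia.
rewrite u'1 /= u'0 !L ?neq_ltn ?leqnn // /swp.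
by case/and3P: far => f1 f2 f3; do !case: eqP => ?; lia.
Qed.

Lemma braid_increasing : (u p == (u p.+1).+1) || (u p.+1 == (u p).+1) ->
  u p.+2 = u p -> u' p = u p.+1 -> u' p.+1 = u p -> u' p.+2 = u p.+1 ->
  (forall t, t != p -> t != p.+1 -> t != p.+2 -> u' t = u t) -> (p.+2 < m)%N ->
  increasing u m -> increasing u' m.
Proof.
move=> adj u2 u'0 u'1 u'2 uE pm iu t tm.
have L s : s != p.+1 -> s != p.+2 -> line u' s =1 line u s.
  exact: (@braid_line u u' p adj u2 u'0 u'1 u'2 uE).
have Lp : line u' p =1 line u p by apply: L; lia.
have i0 : (p < m)%N by lia.
have i1 : (p.+1 < m)%N by lia.
have iuE : [&& ascent u p, ascent u p.+1 & ascent u p.+2] by rewrite /ascent !iu.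
have : [&& ascent u' p, ascent u' p.+1 & ascent u' p.+2].
  have [e|e] := orP adj; move/eqP in e.
    rewrite (ascent_up (m := u p.+1)) ?u'0 ?u'1 // !Lp.
    by rewrite -(ascent_down (m := u p.+1)) // u2.
  rewrite (ascent_down (m := u p)) ?u'0 ?u'1 ?u'2 // !Lp.
  by rewrite -(ascent_up (m := u p)).
case/and3P=> a0 a1 a2.
have [->//|t0] := eqVneq t p; have [->//|t1] := eqVneq t p.+1.
have [->//|t2] := eqVneq t p.+2.
by rewrite uE // !L //; apply: iu.
Qed.

End Increasing.

(** * Braid moves between reduced words *)

Section Words.
Variable r : nat.
Implicit Types (v x y : seq 'I_r) (a b l : 'I_r).

Definition letter v t : nat := nth 0%N [seq val a | a <- v] t.

Inductive braid_eq : seq 'I_r -> seq 'I_r -> Prop :=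
| braid_refl v : braid_eq v v
| braid_trans v1 v2 v3 : braid_eq v1 v2 -> braid_eq v2 v3 -> braid_eq v1 v3
| braid_comm x y a b : a != b -> ~~ adjacent a b ->
    braid_eq (x ++ [:: a, b & y]) (x ++ [:: b, a & y])
| braid_braid x y a b : adjacent a b ->
    braid_eq (x ++ [:: a, b, a & y]) (x ++ [:: b, a, b & y]).

Lemma braid_eq_rcons v v' c : braid_eq v v' -> braid_eq (rcons v c) (rcons v' c).
Proof.
elim=> [v0|v1 v2 v3 _ h1 _ h2|x y a b ab nab|x y a b ab].
- exact: braid_refl.
- exact: braid_trans h1 h2.
- by rewrite !rcons_cat; apply: braid_comm.
- by rewrite !rcons_cat; apply: braid_braid.
Qed.

Lemma braid_eq_size v v' : braid_eq v v' -> size v = size v'.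
Proof. by elim=> [|v1 v2 v3 _ -> _ ->||] // *; rewrite !size_cat. Qed.

Lemma letter_cat x y t :
  letter (x ++ y) t = if (t < size x)%N then letter x t else letter y (t - size x).
Proof. by rewrite /letter map_cat nth_cat size_map. Qed.

Lemma letter_outside x y z t : size y = size z ->
  (t < size x)%N || (size x + size y <= t)%N ->
  forall s, letter (x ++ y ++ s) t = letter (x ++ z ++ s) t.
Proof.
move=> yz h s; rewrite !letter_cat -yz; case: ltnP => // xt.
by case: ltnP => //; move: h; lia.
Qed.

Lemma letter_at x y t : letter (x ++ y) (size x + t) = letter y t.
Proof. by rewrite letter_cat addKn ltnNge leq_addr. Qed.

Lemma far_letters a b : a != b -> ~~ adjacent a b ->
  [&& val a != val b, val a != (val b).+1 & val b != (val a).+1].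
Proof. by rewrite /adjacent negb_or => -> /andP[-> ->]. Qed.

Lemma comm_facts x y a b : let v := x ++ [:: a, b & y] in
  let v' := x ++ [:: b, a & y] in let p := size x in
  [/\ letter v p = a, letter v p.+1 = b, (p.+1 < size v)%N &
    forall t, t != p -> t != p.+1 -> letter v' t = letter v t].
Proof.
move=> v v' p; split.
- by rewrite -[p]addn0 letter_at.
- by rewrite -[p.+1]addn1 letter_at.
- by rewrite size_cat /= -!addSnnS leq_addr.
by move=> t t0 t1; apply: (@letter_outside x [:: b; a] [:: a; b]) => //=; lia.
Qed.

Lemma braid_facts x y a b : let v := x ++ [:: a, b, a & y] in
  let v' := x ++ [:: b, a, b & y] in let p := size x in
  [/\ letter v p = a, letter v p.+1 = b, letter v p.+2 = a, (p.+2 < size v)%N &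
    forall t, t != p -> t != p.+1 -> t != p.+2 -> letter v' t = letter v t].
Proof.
move=> v v' p; split.
- by rewrite -[p]addn0 letter_at.
- by rewrite -[p.+1]addn1 letter_at.
- by rewrite -[p.+2]addn2 letter_at.
- by rewrite size_cat /= -!addSnnS leq_addr.
by move=> t t0 t1 t2; apply: (@letter_outside x [:: b; a; b] [:: a; b; a]) => //=; lia.
Qed.

Lemma braid_eq_line v v' : braid_eq v v' ->
  line (letter v) (size v) =1 line (letter v') (size v').
Proof.
elim=> [//|v1 v2 v3 _ h1 _ h2 h|x y a b ab nab h|x y a b ab h].
- by rewrite h1 h2.
- have [e0 e1 sz eE] := comm_facts x y a b; have [e0' e1' _ _] := comm_facts x y b a.
  rewrite (_ : size (x ++ [:: b, a & y]) = size (x ++ [:: a, b & y])); last first.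
    by rewrite !size_cat.
  apply/esym; apply: (@comm_line _ _ (size x)); rewrite ?e0 ?e1 ?e0' ?e1' //.
    exact: far_letters.
  by rewrite gtn_eqF.
have [e0 e1 e2 sz eE] := braid_facts x y a b.
have [e0' e1' e2' _ _] := braid_facts x y b a.
rewrite (_ : size (x ++ [:: b, a, b & y]) = size (x ++ [:: a, b, a & y])); last first.
  by rewrite !size_cat.
apply/esym; apply: (@braid_line _ _ (size x)); rewrite ?e0 ?e1 ?e2 ?e0' ?e1' ?e2' //.
  by rewrite gtn_eqF // ltnW.
by rewrite gtn_eqF.
Qed.

Lemma braid_eq_increasing v v' : braid_eq v v' ->
  increasing (letter v) (size v) -> increasing (letter v') (size v').
Proof.
elim=> [//|v1 v2 v3 _ h1 _ h2 h|x y a b ab nab h|x y a b ab h].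
- exact/h2/h1.
- have [e0 e1 sz eE] := comm_facts x y a b; have [e0' e1' _ _] := comm_facts x y b a.
  rewrite (_ : size (x ++ [:: b, a & y]) = size (x ++ [:: a, b & y])); last first.
    by rewrite !size_cat.
  apply: (@comm_increasing (letter (x ++ [:: a, b & y])) _ (size x));
    rewrite ?e0 ?e1 ?e0' ?e1' //.
  exact: far_letters.
have [e0 e1 e2 sz eE] := braid_facts x y a b.
have [e0' e1' e2' _ _] := braid_facts x y b a.
rewrite (_ : size (x ++ [:: b, a, b & y]) = size (x ++ [:: a, b, a & y])); last first.
  by rewrite !size_cat.
by apply: (@braid_increasing (letter (x ++ [:: a, b, a & y])) _ (size x));
  rewrite ?e0 ?e1 ?e2 ?e0' ?e1' ?e2'.
Qed.

Lemma letter_rcons v l t : (t < size v)%N -> letter (rcons v l) t = letter v t.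
Proof. by move=> tv; rewrite -cats1 letter_cat tv. Qed.

Lemma letter_last v l : letter (rcons v l) (size v) = l.
Proof. by rewrite -cats1 letter_cat ltnn subnn. Qed.

Lemma line_rcons v l t : (t <= size v)%N ->
  line (letter (rcons v l)) t =1 line (letter v) t.
Proof. by move=> tv; apply: line_eq => s st; rewrite letter_rcons // (leq_trans st). Qed.

Lemma line_last v l h :
  line (letter (rcons v l)) (size v).+1 h = line (letter v) (size v) (swp l h).
Proof. by rewrite /= letter_last line_rcons. Qed.

Lemma increasing_rcons v l : increasing (letter (rcons v l)) (size v).+1 ->
  increasing (letter v) (size v) /\
  (line (letter v) (size v) l < line (letter v) (size v) l.+1)%N.
Proof.
move=> iv; split=> [t tv|].
  by have := iv t (ltnW tv); rewrite letter_rcons // !line_rcons // ltnW.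
by have := iv _ (ltnSn _); rewrite letter_last !line_rcons.
Qed.

(* The induction behind Matsumoto's theorem. *)
Lemma braid_to_descent v l : increasing (letter v) (size v) ->
  (line (letter v) (size v) l.+1 < line (letter v) (size v) l)%N ->
  exists v', braid_eq v (rcons v' l).
Proof.
have [k] := ubnP (size v); elim: k v l => [//|k IH] v l; rewrite ltnS.
case/lastP: v => [_ _|v m]; first by rewrite /= ltnNge leqnSn.
rewrite size_rcons => vk iv; have [iv1 iv2] := increasing_rcons iv.
rewrite !line_last => desc.
have [lm|lm] := eqVneq l m; first by exists v; rewrite lm; apply: braid_refl.
case lma: (adjacent l m); last first.
  have /and3P[f1 f2 f3] := far_letters lm (negbT lma).
  have e0 : swp m l = l by rewrite /swp (negPf f1) (negPf f2).
  have e1 : swp m l.+1 = l.+1.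
    by rewrite /swp eqSS (negPf f1) eq_sym (negPf f3).
  rewrite e0 e1 in desc.
  have [v' vv'] := IH v l vk iv1 desc.
  exists (rcons v' m); apply: braid_trans (braid_eq_rcons m vv') _.
  rewrite -!cats1 -!catA /=; apply: braid_comm => //.
  by rewrite lma.
(* The word v followed by m reverses the three lines near the levels l and m completely. So v can be
   made to end in m, l, and the braid move turns m, l, m into l, m, l. *)
have [v' vv'] : exists v', braid_eq v (rcons v' l).
  apply: IH => //; case/orP: lma => /eqP e; move: desc iv2; rewrite e !swpE.
    by move=> zx xy; apply: ltn_trans zx xy.
  by move=> zx yz; apply: ltn_trans yz zx.
have sv : size v = (size v').+1 by rewrite (braid_eq_size vv') size_rcons.
have iv' := braid_eq_increasing vv' iv1; rewrite size_rcons in iv'.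
have [iv'1 iv'2] := increasing_rcons iv'.
have lE h : line (letter v) (size v) h = line (letter v') (size v') (swp l h).
  by rewrite (braid_eq_line vv') size_rcons line_last.
have [v'' vv''] : exists v'', braid_eq v' (rcons v'' m).
  apply: IH => //; first by rewrite -ltnS -sv ltnW.
  by case/orP: lma => /eqP e; move: desc; rewrite !lE e !swpE.
exists (rcons (rcons v'' l) m).
apply: braid_trans (braid_eq_rcons m vv') _.
apply: braid_trans (braid_eq_rcons m (braid_eq_rcons l vv'')) _.
rewrite -!cats1 -!catA /=; apply: braid_braid.
by rewrite adjacentC.
Qed.

End Words.

Section Reduced.
Variable r : nat.
Implicit Types (v : seq 'I_r) (l : 'I_r) (h : 'I_r.+1).

Lemma val_simple_refl l h : val (simple_refl l h) = swp l h.
Proof.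
rewrite /simple_refl /swp permE /=.
have -> : (h == widen_ord (leqnSn r) l) = (val h == val l) by [].
case: eqP => // _; rewrite -[h == _]/(val h == bump 0 l) /bump leq0n add1n.
by case: eqP.
Qed.

Lemma letter_ord v t (tv : (t < size v)%N) l0 : letter v t = nth l0 v t.
Proof. by rewrite /letter (nth_map l0). Qed.

(** [line] peels off the last letter first, so it inverts the permutation of the prefix: it recovers
    the label of a line from its height. *)
Lemma line_height v t h : (t <= size v)%N ->
  line (letter v) t (wordperm (take t v) h) = h.
Proof.
elim: t h => [|t IH] h tv; first by rewrite take0 /wordperm big_nil perm1.
have l0 : 'I_r by case: (v) tv => // l.
rewrite (take_nth l0) // /wordperm -cats1 big_cat big_seq1 permM /= (letter_ord tv l0).
by rewrite val_simple_refl swpK IH // ltnW.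
Qed.

Lemma line_ord v t h : (t <= size v)%N -> exists h' : 'I_r.+1, line (letter v) t h = h'.
Proof.
move=> tv; exists ((wordperm (take t v))^-1%g h).
by rewrite -{1}(permKV (wordperm (take t v)) h) line_height.
Qed.

Lemma line_reversed v h : wordperm v = longest r ->
  line (letter v) (size v) h = (r - h)%N.
Proof.
move=> vE; have := @line_height v (size v) (rev_ord h) (leqnn _).
by rewrite take_size vE permE rev_ordK => ->; rewrite /= subSS.
Qed.

Definition inversions (f : 'I_r.+1 -> nat) : nat :=
  (\sum_(h1 < r.+1) \sum_(h2 < r.+1) ((h1 < h2) && (f h2 < f h1)))%N.

Lemma inversions_swap (f : 'I_r.+1 -> nat) l :
  (inversions (f \o simple_refl l) <=
   inversions f + (f (widen_ord (leqnSn r) l) < f (lift ord0 l)))%N.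
Proof.
rewrite /inversions.
rewrite (reindex_inj (@perm_inj _ (simple_refl l))) /=.
under eq_bigr => h1 _ do rewrite (reindex_inj (@perm_inj _ (simple_refl l))) /=.
have sK : involutive (simple_refl l) by move=> h; rewrite /simple_refl tpermK.
under eq_bigr => h1 _ do under eq_bigr => h2 _ do rewrite !sK.
set a := widen_ord _ l; set b : 'I_r.+1 := lift ord0 l.
have -> : nat_of_bool (f a < f b)%N =
    (\sum_(h1 < r.+1) \sum_(h2 < r.+1) [&& h1 == b, h2 == a & (f a < f b)])%N.
  rewrite (bigD1 b) //= (bigD1 a) //= !eqxx /= big1 => [|h /negPf ->//].
  by rewrite big1 ?addn0 // => h /negPf ->; rewrite big1.
rewrite -big_split; apply: leq_sum => h1 _; rewrite -big_split; apply: leq_sum => h2 _ /=.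
have [/andP[/eqP -> /eqP ->]|ne] := boolP ((h1 == b) && (h2 == a)).
  rewrite !eqxx /=; apply: leq_trans (leq_addl _ _).
  by case: (f a < f b)%N; rewrite ?andbF ?leq_b1.
have mono : (simple_refl l h1 < simple_refl l h2)%N -> (h1 < h2)%N.
  rewrite -!val_eqE /= /bump leq0n add1n in ne.
  rewrite !val_simple_refl /swp; move: ne.
  by do !case: eqP => ?; lia.
apply: leq_trans (leq_addr _ _).
by case: (f h2 < f h1)%N; rewrite ?andbF // !andbT; case: ltnP mono => // _ ->.
Qed.

Lemma inversions_longest : inversions (fun h => (r - h)%N) = (r.+1 * r)./2.
Proof.
rewrite /inversions exchange_big /=.
transitivity (\sum_(h < r.+1) h)%N; last first.
  by rewrite -(big_mkord xpredT id) bin2_sum bin2.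
apply: eq_bigr => h2 _.
transitivity (\sum_(h1 < r.+1 | (h1 < h2)%N) 1)%N.
  rewrite [RHS]big_mkcond; apply: eq_bigr => h1 _.
  have o1 := ltn_ord h1; have o2 := ltn_ord h2; case: ifP => h /=; lia.
rewrite sum1_card -[RHS](card_ord h2) -!sum1_card.
rewrite (big_ord_widen_cond r.+1 xpredT (fun=> 1%N)) //.
exact: ltnW.
Qed.

(** A crossing creates at most one inversion, and none unless it is an ascent. As w_0 has as many
    inversions as v has letters, every crossing is an ascent. *)
Lemma reduced_increasing v : size v = (r.+1 * r)./2 -> wordperm v = longest r ->
  increasing (letter v) (size v).
Proof.
move=> sv vE.
pose inv t := inversions (fun h => line (letter v) t h).
have invS t : (t < size v)%N -> (inv t.+1 <= inv t + ascent (letter v) t)%N.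
  move=> tv; have l0 : 'I_r by case: (v) tv => // l.
  have := inversions_swap (fun h => line (letter v) t h) (nth l0 v t).
  rewrite /inv /ascent (letter_ord tv l0) /= /bump leq0n add1n.
  congr (_ <= _)%N; rewrite /inversions; apply: eq_bigr => h1 _; apply: eq_bigr => h2 _.
  by rewrite /= !val_simple_refl (letter_ord tv l0).
have inv0 : inv 0%N = 0%N.
  rewrite /inv /inversions big1 // => h1 _; rewrite big1 // => h2 _ /=.
  by case: ltngtP.
have invN : inv (size v) = size v.
  transitivity (inversions (fun h : 'I_r.+1 => (r - h)%N)).
    rewrite /inv /inversions.
    by apply: eq_bigr => h1 _; apply: eq_bigr => h2 _; rewrite !line_reversed.
  by rewrite inversions_longest.
have le t : (t <= size v)%N -> (inv t <= \sum_(s < t) ascent (letter v) s)%N.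
  elim: t => [|t IH] tv; first by rewrite inv0.
  rewrite big_ord_recr; apply: leq_trans (invS _ tv) _.
  by rewrite leq_add2r IH // ltnW.
have := le _ (leqnn _); rewrite invN => h t tv; apply: contraT => na.
have : (\sum_(s < size v) ascent (letter v) s < size v)%N.
  rewrite (bigD1 (Ordinal tv)) //= (_ : ascent _ _ = false); last exact: negbTE.
  have e : size v = (1 + \sum_(s < size v | s != Ordinal tv) 1)%N.
    by rewrite -{1}(card_ord (size v)) -sum1_card (bigD1 (Ordinal tv)).
  rewrite add0n [X in (_ < X)%N]e add1n ltnS.
  by apply: leq_sum => s _; case: (ascent _ _).
by rewrite ltnNge h.
Qed.

End Reduced.

(** * The quiver under commutation moves and braid moves *)

Definition sw (x y t : nat) : nat := if t == x then y else if t == y then x else t.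

Lemma sw_lt x t1 t2 : ~~ ((t1 == x) && (t2 == x.+1)) -> ~~ ((t1 == x.+1) && (t2 == x)) ->
  (sw x x.+1 t1 < sw x x.+1 t2)%N = (t1 < t2)%N.
Proof. by rewrite /sw => h1 h2; do !case: eqP => ?; lia. Qed.

Lemma sw_inj x y : injective (sw x y).
Proof. by move=> t1 t2; rewrite /sw; do !case: eqP => ?; lia. Qed.

Lemma fendI r N (w : N.-tuple 'I_r) (F : face r N) e : (fstart F < e <= N.+1)%N ->
  (forall j : 'I_N, (fstart F <= j)%N -> (j.+1 < e)%N -> tnth w j != level w F) ->
  ((e <= N)%N -> exists2 j : 'I_N, e = j.+1 & tnth w j = level w F) ->
  fend w F = e.
Proof.
move=> /andP[lo hi] no yes; move: hi; rewrite leq_eqVlt ltnS => /orP[/eqP eN|eN].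
  by rewrite eN; apply: fend_infinite => j h; apply: no => //; rewrite eN ltnS.
have [j ej lj] := yes eN; rewrite ej; apply: fend_unique => //.
  by rewrite -ltnS -ej.
by move=> j' /andP[h1 h2]; apply: no => //; rewrite ej ltnS.
Qed.

Section CommQuiver.
Variables (r N : nat) (v v' : N.-tuple 'I_r) (p0 p1 : 'I_N).
Hypotheses (p01 : p1 = p0.+1 :> nat) (ne : tnth v p0 != tnth v p1)
  (nadj : ~~ adjacent (tnth v p0) (tnth v p1))
  (v'0 : tnth v' p0 = tnth v p1) (v'1 : tnth v' p1 = tnth v p0)
  (vE : forall j, j != p0 -> j != p1 -> tnth v' j = tnth v j).
Let tau : {perm (face r N)} := tperm (inr p0) (inr p1).
Let x := p0.+1.
Implicit Types F G : face r N.

Lemma comm_level F : level v' (tau F) = level v F.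
Proof.
rewrite /tau; case: tpermP => [->|->|] //=; case: F => [i|j] //= n0 n1.
by apply: vE; apply/eqP => e; [apply: n0 | apply: n1]; rewrite e.
Qed.

Lemma comm_fstart F : fstart (tau F) = sw x x.+1 (fstart F).
Proof.
rewrite /tau /sw /x; case: tpermP => [->|->|] /=; rewrite ?p01 ?eqxx //.
  by rewrite gtn_eqF.
case: F => [i|j] //= n0 n1; rewrite !eqSS -p01.
have -> : (val j == val p0) = (j == p0) by [].
have -> : (val j == val p1) = (j == p1) by [].
by case: eqP => [e|_]; [case: n0; rewrite e | case: eqP => // e; case: n1; rewrite e].
Qed.

Let Fs0 F : fstart F = x -> tnth v p0 = level v F.
Proof.
move=> e; have [|j ej <-] := @fstart_letter _ _ v F; first by rewrite e.
by congr tnth; apply: val_inj; move: ej; rewrite e /x => -[].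
Qed.

Let Fs1 F : fstart F = x.+1 -> tnth v p1 = level v F.
Proof.
move=> e; have [|j ej <-] := @fstart_letter _ _ v F; first by rewrite e.
by congr tnth; apply: val_inj; move: ej; rewrite e /x -p01 => -[].
Qed.

Let Fe0 F : fend v F = x -> tnth v p0 = level v F.
Proof.
move=> e; have [|j ej <-] := @fend_letter _ _ v F; first by rewrite e /x ltn_ord.
by congr tnth; apply: val_inj; move: ej; rewrite e /x => -[].
Qed.

Let Fe1 F : fend v F = x.+1 -> tnth v p1 = level v F.
Proof.
move=> e; have [|j ej <-] := @fend_letter _ _ v F.
  by rewrite e /x -p01 ltn_ord.
by congr tnth; apply: val_inj; move: ej; rewrite e /x -p01 => -[].
Qed.

Let not01 F : tnth v p0 = level v F -> tnth v p1 = level v F -> False.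
Proof. by move=> h0 h1; move: ne; rewrite h0 h1 eqxx. Qed.

Lemma comm_fend F : fend v' (tau F) = sw x x.+1 (fend v F).
Proof.
have N1 := ltn_ord p1; have gt := fend_gt v F; have le := fend_le v F.
have s0 := @Fs0 F; have s1 := @Fs1 F; have e0 := @Fe0 F; have e1 := @Fe1 F.
have n01 := @not01 F.
apply: fendI; rewrite ?comm_fstart ?comm_level.
- have se : ~ (fstart F = x /\ fend v F = x.+1).
    by move=> [/s0 h0 /e1 h1]; apply: n01.
  by rewrite /sw; do !case: eqP => ?; rewrite /x in se *; lia.
- move=> j js je; have [jp0|jp0] := eqVneq j p0.
    rewrite jp0 v'0; apply/negP => /eqP h1.
    have n0 : ~ (fend v F = x) by move=> /e0 h0; apply: n01.
    suff: tnth v p1 != level v F by rewrite h1 eqxx.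
    apply: no_letter.
      by move: js je; rewrite jp0 /sw /x; do !case: eqP => ?; lia.
    by move: js je n0; rewrite jp0 /sw /x; do !case: eqP => ?; lia.
  have [jp1|jp1] := eqVneq j p1.
    rewrite jp1 v'1; apply/negP => /eqP h0.
    have n0 : ~ (fstart F = x.+1) by move=> /s1 h1; apply: n01.
    suff: tnth v p0 != level v F by rewrite h0 eqxx.
    apply: no_letter.
      by move: js je n0; rewrite jp1 /sw /x; do !case: eqP => ?; lia.
    by move: js je; rewrite jp1 /sw /x; do !case: eqP => ?; lia.
  rewrite vE //; apply: no_letter.
    by move: js jp0 jp1; rewrite -!val_eqE /= /sw /x; do !case: eqP => ?; lia.
  by move: je jp0 jp1; rewrite -!val_eqE /= /sw /x; do !case: eqP => ?; lia.
rewrite /sw; case: eqP => [/e0 h0|n0]; first by exists p1; rewrite ?v'1 ?p01.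
case: eqP => [/e1 h1|n1]; first by exists p0; rewrite ?v'0.
move=> /fend_letter[j ej lj]; exists j => //; rewrite vE //; apply/negP => /eqP jp.
  by apply: n0; rewrite ej jp.
by apply: n1; rewrite ej jp p01.
Qed.

Lemma comm_right_unbounded F : right_unbounded v' (tau F) = right_unbounded v F.
Proof.
have N1 := ltn_ord p1; rewrite p01 in N1; rewrite /right_unbounded comm_fend /sw /x.
move: (fend v F) (val p0) N1 => e q N1.
by case: (e =P q.+1) => ?; [lia | case: (e =P q.+2) => ?; lia].
Qed.

Lemma comm_frozen F : frozen v' (tau F) = frozen v F.
Proof.
rewrite /frozen comm_right_unbounded comm_fstart; congr (_ || _); rewrite /sw /x.
by case: (_ =P p0.+1) => [->|_] //; case: (_ =P p0.+2) => [->|].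
Qed.

(** The move exchanges two consecutive times. This could only affect a comparison between those two,
    and they belong to faces of levels that are not adjacent. *)
Lemma comm_arrow F G : arrow v' (tau F) (tau G) = arrow v F G.
Proof.
rewrite !arrowE !comm_level comm_fend comm_fstart (inj_eq (@sw_inj _ _)).
congr (_ || _); case a: adjacent => //=.
have bad : ~ (tnth v p0 = level v G /\ tnth v p1 = level v F).
  by move=> [h0 h1]; move: nadj; rewrite h0 h1 adjacentC a.
have bad' : ~ (tnth v p1 = level v G /\ tnth v p0 = level v F).
  by move=> [h1 h0]; move: nadj; rewrite h0 h1 a.
rewrite /crosses !comm_fstart !comm_fend !sw_lt //; apply/negP => /andP[/eqP h /eqP h'].
all: by [apply: bad; split; by [apply: Fe0 | apply: Fs0 | apply: Fe1 | apply: Fs1]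
  | apply: bad'; split; by [apply: Fe0 | apply: Fs0 | apply: Fe1 | apply: Fs1]].
Qed.

Lemma comm_quiver F G : quiver0 v' (tau F) (tau G) = quiver0 v F G.
Proof. by rewrite /quiver0 !comm_frozen !comm_arrow. Qed.

End CommQuiver.

Lemma sw_le x y e m : (x <= m)%N -> (y <= m)%N -> (e <= m)%N -> (sw x y e <= m)%N.
Proof. by move=> *; rewrite /sw; do !case: ifP. Qed.

Lemma braid_times q s e : (s < e)%N -> s <> q.+1 -> e <> q.+3 ->
  let s' := sw q.+2 q.+3 s in let e' := sw q.+1 q.+2 e in
  [/\ (s = q.+2 \/ s = q.+3 -> (q.+3 < e)%N) -> (s' < e')%N,
    (s' <= q)%N -> (q.+1 < e')%N -> e <> q.+1 -> (s < q.+1)%N /\ (q.+3 < e)%N,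
    (s' <= q.+1)%N -> (q.+2 < e')%N -> s <> q.+2 -> s <> q.+3 -> (s < q.+1)%N /\ (q.+3 < e)%N,
    (s' <= q.+2)%N -> (q.+3 < e')%N -> s <> q.+3 -> s <> q.+2 -> (s < q.+1)%N /\ (q.+3 < e)%N &
    forall j, (s' <= j)%N -> (j.+1 < e')%N -> j <> q -> j <> q.+1 -> j <> q.+2 ->
      (s <= j)%N /\ (j.+1 < e)%N].
Proof.
move=> se sq eq s' e'; rewrite /s' /e' /sw.
split; last move=> j.
all: case: (s =P q.+2) => ?; case: (s =P q.+3) => ?; case: (e =P q.+1) => ?; case: (e =P q.+2) => ?; lia.
Qed.

(** The relation [arrow] in terms of levels and times alone, so that it is open to linear
    arithmetic. *)
Definition arr (la sa ea lb sb eb : nat) : bool :=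
  ((la == lb) && (ea == sb)) ||
  [&& (la == lb.+1) || (lb == la.+1), (sb < sa)%N, (sa < eb)%N & (eb < ea)%N].

Lemma triangle_arrows (l s e a b x : nat) :
  (s < e)%N -> s <> x -> e <> x.+2 -> (a == b.+1) || (b == a.+1) ->
  (s = x.+1 -> l = b) -> (s = x.+2 -> l = a) -> (e = x -> l = a) -> (e = x.+1 -> l = b) ->
  (s = x.+1 \/ s = x.+2 -> (x.+2 < e)%N) ->
  ((s < x)%N -> (x.+2 < e)%N -> l <> a /\ l <> b) ->
  (arr l s e a x x.+2)%:Z - (arr a x x.+2 l s e)%:Z =
  (e == x)%:Z + (s == x.+1)%:Z - (e == x.+1)%:Z - (s == x.+2)%:Z.
Proof.
move=> se sx ex ad H1 H2 H3 H4 sl sp.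
have {ad} ad : a = b.+1 \/ b = a.+1 by case/orP: ad => /eqP; [left|right].
case: (e =P x) => [ee|e0].
  rewrite (H3 ee) /arr ee; clear H1 H2 H3 H4 sl sp; lia.
case: (e =P x.+1) => [ee|e1].
  rewrite (H4 ee) /arr ee; clear H1 H2 H3 H4 sl sp; lia.
case: (s =P x.+1) => [es|s1].
  have := sl (or_introl es); rewrite (H1 es) /arr es; clear H1 H2 H3 H4 sl sp; lia.
case: (s =P x.+2) => [es|s2].
  have := sl (or_intror es); rewrite (H2 es) /arr es; clear H1 H2 H3 H4 sl sp; lia.
have h1 : (s < x)%N \/ (x.+2 < s)%N by lia.
have h2 : (e < x)%N \/ (x.+2 < e)%N by lia.
rewrite /arr; case: h1 => h1; case: h2 => h2; try lia.
Qed.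

Section BraidQuiver.
Variables (r N : nat) (v v' : N.-tuple 'I_r) (p0 p1 p2 : 'I_N).
Hypotheses (p01 : p1 = p0.+1 :> nat) (p02 : p2 = p0.+2 :> nat)
  (adj : adjacent (tnth v p0) (tnth v p1)) (v2 : tnth v p2 = tnth v p0)
  (v'0 : tnth v' p0 = tnth v p1) (v'1 : tnth v' p1 = tnth v p0)
  (v'2 : tnth v' p2 = tnth v p1)
  (vE : forall j, j != p0 -> j != p1 -> j != p2 -> tnth v' j = tnth v j).
(** The triangle keeps its name [inr p0] but changes level. The two faces starting at the second and
    the third crossing keep their levels and exchange their starting times, hence their names. *)
Let tau : {perm (face r N)} := tperm (inr p1) (inr p2).
Let k : face r N := inr p0.
Let x := p0.+1.
Let a := tnth v p0.
Let b := tnth v p1.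
Implicit Types F G : face r N.

Let ab : a != b. Proof. exact: adjacent_neq. Qed.
Let n01 : p0 != p1. Proof. by rewrite -val_eqE /= p01 ltn_eqF. Qed.
Let n02 : p0 != p2. Proof. by rewrite -val_eqE /= p02 ltn_eqF // ltnW. Qed.
Let n12 : p1 != p2. Proof. by rewrite -val_eqE /= p01 p02 ltn_eqF. Qed.

Lemma braid_triangle : tau k = k.
Proof.
rewrite /tau tpermD //; apply/eqP => -[] /eqP; rewrite eq_sym.
  exact/negP/n01.
exact/negP/n02.
Qed.

Lemma braid_level F : F != k -> level v' (tau F) = level v F.
Proof.
move=> Fk; rewrite /tau; case: tpermP => [->|->|/eqP n1 /eqP n2] /=; rewrite ?v'2 ?v'1 ?v2 //.
case: F Fk n1 n2 => [i|j] //= Fk n1 n2; apply: vE.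
- by apply: contraNneq Fk => ->.
- by apply: contraNneq n1 => ->.
- by apply: contraNneq n2 => ->.
Qed.

Lemma braid_fstart F : fstart (tau F) = sw x.+1 x.+2 (fstart F).
Proof.
rewrite /tau /sw /x; case: tpermP => [->|->|/eqP n1 /eqP n2] /=.
- by rewrite p01 p02 eqxx.
- by rewrite p01 p02 eqxx gtn_eqF.
case: F n1 n2 => [i|j] //= n1 n2; rewrite !eqSS -p02 -p01.
have -> : (val j == val p1) = (j == p1) by [].
have -> : (val j == val p2) = (j == p2) by [].
have -> : (j == p1) = false by apply: contraNF n1 => /eqP ->.
by have -> : (j == p2) = false by apply: contraNF n2 => /eqP ->.
Qed.

Let N2 : (p0.+2 < N)%N. Proof. by rewrite -p02. Qed.

Let Fs F (j : 'I_N) : fstart F = j.+1 -> tnth v j = level v F.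
Proof.
move=> e; have [|j' ej <-] := @fstart_letter _ _ v F; first by rewrite e.
by congr tnth; apply: val_inj; move: ej; rewrite e => -[].
Qed.

Let Fe F (j : 'I_N) : fend v F = j.+1 -> tnth v j = level v F.
Proof.
move=> e; have [|j' ej <-] := @fend_letter _ _ v F; first by rewrite e.
by congr tnth; apply: val_inj; move: ej; rewrite e => -[].
Qed.

Let kP F : (F == k) = (fstart F == x).
Proof. by case: F => [i|j]. Qed.

Lemma fend_triangle : fend v k = x.+2.
Proof.
apply: fendI => /= [|j h1 h2|_]; first by rewrite /x; lia.
  have -> : j = p1 by apply: val_inj; rewrite /= p01; rewrite /x in h1 h2; lia.
  by rewrite eq_sym ab.
by exists p2; rewrite ?p02.
Qed.

Lemma fend_triangle' : fend v' k = x.+2.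
Proof.
apply: fendI => /= [|j h1 h2|_]; first by rewrite /x; lia.
  have -> : j = p1 by apply: val_inj; rewrite /= p01; rewrite /x in h1 h2; lia.
  by rewrite v'0 v'1.
by exists p2; rewrite ?p02 ?v'2.
Qed.

Lemma triangle_position F : F != k ->
  [/\ fstart F <> x /\ fend v F <> x.+2,
    (fstart F = x.+1 -> level v F = b) /\ (fstart F = x.+2 -> level v F = a),
    (fend v F = x -> level v F = a) /\ (fend v F = x.+1 -> level v F = b),
    (fstart F = x.+1 \/ fstart F = x.+2 -> (x.+2 < fend v F)%N) &
    ((fstart F < x)%N -> (x.+2 < fend v F)%N -> level v F <> a /\ level v F <> b)].
Proof.
move=> Fk; have sx : fstart F <> x by move=> e; rewrite kP e eqxx in Fk.
have s1 : fstart F = x.+1 -> level v F = b.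
  by move=> e; rewrite -(Fs (j := p1)) // p01.
have s2 : fstart F = x.+2 -> level v F = a.
  by move=> e; rewrite -(Fs (j := p2)) ?v2 // p02.
have e0 : fend v F = x -> level v F = a by move=> e; rewrite -(Fe (j := p0)).
have e1 : fend v F = x.+1 -> level v F = b.
  by move=> e; rewrite -(Fe (j := p1)) // p01.
have gt := fend_gt v F.
have no0 : (fstart F < x)%N -> (x < fend v F)%N -> level v F <> a.
  by move=> h1 h2 la; have := @no_letter _ _ v F p0 h1 h2; rewrite -/a la eqxx.
have no1 : (fstart F < x.+1)%N -> (x.+1 < fend v F)%N -> level v F <> b.
  move=> h1 h2 lb; have := @no_letter _ _ v F p1; rewrite p01 -/b lb eqxx.
  by move=> H; apply: notF; apply: H.
have ex : fend v F <> x.+2.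
  move=> e; have la : level v F = a by rewrite -(Fe (j := p2)) ?v2 // p02.
  have [lt|] := ltnP (fstart F) x; first by apply: no0 la; rewrite // e.
  move=> ge; have s1' : fstart F = x.+1 by lia.
  by move: ab; rewrite -la s1 // eqxx.
split=> //.
- by case=> h; move: gt ex; rewrite h; case: ltngtP => // *; lia.
- by move=> h1 h2; split; [apply: no0 | apply: no1] => //; lia.
Qed.

Lemma braid_fend F : F != k -> fend v' (tau F) = sw x x.+1 (fend v F).
Proof.
move=> Fk; have [[sx ex] [s1 s2] [e0 e1] sl sp] := triangle_position Fk.
have gt := fend_gt v F; have le := fend_le v F.
have nab : level v F = a -> level v F = b -> False.
  by move=> la lb; move: ab; rewrite -la lb eqxx.
have [T0 T1 T2 T3 T4] := braid_times gt sx ex.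
apply: fendI; rewrite ?braid_fstart ?braid_level //.
- rewrite T0 //=; apply: sw_le => //; have := N2; rewrite /x; lia.
- move=> j js je; have [jp|j0] := eqVneq j p0.
    rewrite jp v'0 -/b; apply/negP => /eqP lb; rewrite jp in js je.
    have n0 : fend v F <> x by move=> /e0 la; apply: nab.
    by have [h1 h2] := T1 js je n0; have [_ /(_ (esym lb))] := sp h1 h2.
  have [jp|j1] := eqVneq j p1.
    rewrite jp v'1 -/a; apply/negP => /eqP la; rewrite jp p01 in js je.
    have n0 : fstart F <> x.+1 by move=> /s1 lb; apply: nab.
    have n0' : fstart F <> x.+2.
      by move=> h; move: js; rewrite h /sw /x; case: eqP => ?; rewrite ?eqxx; lia.
    by have [h1 h2] := T2 js je n0 n0'; have [/(_ (esym la))] := sp h1 h2.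
  have [jp|j2] := eqVneq j p2.
    rewrite jp v'2 -/b; apply/negP => /eqP lb; rewrite jp p02 in js je.
    have n0 : fstart F <> x.+2 by move=> /s2 la; apply: nab.
    have n0' : fstart F <> x.+1.
      by move=> h; move: js; rewrite h /sw eqxx /x ltnn.
    by have [h1 h2] := T3 js je n0 n0'; have [_ /(_ (esym lb))] := sp h1 h2.
  have [h1 h2] : (fstart F <= j)%N /\ (j.+1 < fend v F)%N.
    apply: T4 => // e.
    + by move/eqP: j0; apply; apply: val_inj.
    + by move/eqP: j1; apply; apply: val_inj; rewrite /= e p01.
    + by move/eqP: j2; apply; apply: val_inj; rewrite /= e p02.
  by rewrite vE //; apply: no_letter.
rewrite /sw; case: eqP => [/e0 h0|nx]; first by exists p1; rewrite ?v'1 ?p01.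
case: eqP => [/e1 h1|nx1]; first by exists p0; rewrite ?v'0.
move=> /fend_letter[j ej lj]; exists j => //; rewrite vE //; apply/negP => /eqP jp.
- by apply: nx; rewrite ej jp.
- by apply: nx1; rewrite ej jp p01.
by apply: ex; rewrite ej jp p02.
Qed.

Lemma braid_right_unbounded F : right_unbounded v' (tau F) = right_unbounded v F.
Proof.
rewrite /right_unbounded; have [->|Fk] := eqVneq F k.
  by rewrite braid_triangle fend_triangle fend_triangle'.
rewrite braid_fend // /sw /x; move: (fend v F) (val p0) N2 => e q hN.
by case: (e =P q.+1) => ?; [lia | case: (e =P q.+2) => ?; lia].
Qed.

Lemma braid_frozen F : frozen v' (tau F) = frozen v F.
Proof.
rewrite /frozen braid_right_unbounded braid_fstart; congr (_ || _); rewrite /sw /x.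
by case: (_ =P p0.+2) => [->|_] //; case: (_ =P p0.+3) => [->|].
Qed.

Lemma triangle_unfrozen : ~~ frozen v k.
Proof. by rewrite /frozen /right_unbounded fend_triangle /x /=; lia. Qed.

Let arrow_nat (u : N.-tuple 'I_r) F G :
  arrow u F G = arr (level u F) (fstart F) (fend u F) (level u G) (fstart G) (fend u G).
Proof. by []. Qed.

(** Only four faces are joined to the triangle: those ending at its first and at the middle
    crossing, and those starting at the middle and at the last one. *)
Definition to_triangle F : int :=
  (fend v F == x)%:Z + (fstart F == x.+1)%:Z - (fend v F == x.+1)%:Z - (fstart F == x.+2)%:Z.

Lemma quiver_to_triangle F : F != k -> quiver0 v F k = to_triangle F.
Proof.
move=> Fk; rewrite quiver0E; last by rewrite (negPf triangle_unfrozen) andbF.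
have [[sx ex] [s1 s2] [e0 e1] sl sp] := triangle_position Fk.
have gt := fend_gt v F.
rewrite !arrow_nat fend_triangle /to_triangle /= -/a -/x.
have := adj; rewrite /adjacent -/a -/b.
have H1 : fstart F = x.+1 -> level v F = b :> nat by move=> /s1 ->.
have H2 : fstart F = x.+2 -> level v F = a :> nat by move=> /s2 ->.
have H3 : fend v F = x -> level v F = a :> nat by move=> /e0 ->.
have H4 : fend v F = x.+1 -> level v F = b :> nat by move=> /e1 ->.
have H5 : (fstart F < x)%N -> (x.+2 < fend v F)%N ->
    level v F <> a :> nat /\ level v F <> b :> nat.
  by move=> h1 h2; have [n1 n2] := sp h1 h2; split=> /val_inj.
by move=> ad; rewrite -(triangle_arrows gt sx ex ad H1 H2 H3 H4 sl H5).
Qed.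

End BraidQuiver.

(* Position of a face (level l, times s and e) relative to the triangle of a
   braid move at the times x, x.+1, x.+2: its times s' and e' after the move
   and its number t of arrows to the triangle. *)
Variant braid_shape (x a b l s e : nat) : nat -> nat -> int -> Prop :=
| ShapeLA of e = x & l = a & (s < x)%N : braid_shape x a b l s e s x.+1 1
| ShapeLB of e = x.+1 & l = b & (s < x)%N : braid_shape x a b l s e s x (-1)
| ShapeRB of s = x.+1 & l = b & (x.+2 < e)%N : braid_shape x a b l s e x.+2 e 1
| ShapeRA of s = x.+2 & l = a & (x.+2 < e)%N : braid_shape x a b l s e x.+1 e (-1)
| ShapeO of (e < x)%N \/ (x.+2 < s)%N \/ [/\ (s < x)%N, (x.+2 < e)%N, l <> a & l <> b]
    : braid_shape x a b l s e s e 0.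

Lemma arr_same l s e s' e' : arr l s e l s' e' = (e == s').
Proof. by rewrite /arr eqxx [l == _](ltn_eqF (ltnSn l)) /= orbF. Qed.

Lemma arr_adjacent a b s e s' e' : (a == b.+1) || (b == a.+1) ->
  arr a s e b s' e' = [&& (s' < s)%N, (s < e')%N & (e' < e)%N].
Proof.
move=> ad; rewrite /arr ad andTb.
by have -> : (a == b) = false by apply/eqP => ab; move: ad; rewrite ab; lia.
Qed.

(* Moving a time inside the window of the braid move does not change its
   position relative to a time outside. *)
Definition outside (x z : nat) := (z < x)%N \/ (x.+2 < z)%N.
Definition moves (x t t' : nat) := t = t' \/ (x <= t <= x.+2)%N /\ (x <= t' <= x.+2)%N.

Lemma moves_cmp x t t' z : moves x t t' -> outside x z ->
  [/\ (t < z)%N = (t' < z)%N, (z < t)%N = (z < t')%N, (t == z) = (t' == z) & (z == t) = (z == t')].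
Proof. by rewrite /moves /outside => h1 h2; split; lia. Qed.

Lemma arr_outside x l s e s' e' l2 s2 e2 : moves x s s' -> moves x e e' ->
  outside x s2 -> outside x e2 ->
  arr l s e l2 s2 e2 = arr l s' e' l2 s2 e2 /\ arr l2 s2 e2 l s e = arr l2 s2 e2 l s' e'.
Proof.
move=> ms me os oe; rewrite /arr.
have [h1 h2 h3 h4] := moves_cmp ms os; have [g1 g2 g3 g4] := moves_cmp ms oe.
have [k1 k2 k3 k4] := moves_cmp me os; have [j1 j2 j3 j4] := moves_cmp me oe.
by rewrite ?h1 ?h2 ?h3 ?h4 ?g1 ?g2 ?g3 ?g4 ?k1 ?k2 ?k3 ?k4 ?j1 ?j2 ?j3 ?j4.
Qed.

Lemma braid_shape_moves x a b l s e s' e' t : braid_shape x a b l s e s' e' t ->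
  moves x s s' /\ moves x e e'.
Proof. by rewrite /moves; case=> *; split; lia. Qed.

Definition apart (lF sF eF lG sG eG : nat) :=
  (lF = lG -> (eF <= sG)%N \/ (eG <= sF)%N).

(** Mutation creates or cancels arrows only between neighbours of the triangle. Times move only
    inside the window of the move, so a pair containing a face whose times lie outside keeps its
    arrows ([arr_outside]); the pairs of neighbours are settled by arithmetic. *)
Lemma braid_shape_arrows N x a b lF sF eF sF' eF' tF lG sG eG sG' eG' tG :
  (a == b.+1) || (b == a.+1) -> (0 < x)%N -> (x.+2 <= N)%N ->
  (sF < eF)%N -> (sG < eG)%N -> (eF <= N.+1)%N -> (eG <= N.+1)%N ->
  braid_shape x a b lF sF eF sF' eF' tF -> braid_shape x a b lG sG eG sG' eG' tG ->
  apart lF sF eF lG sG eG ->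
  (lF <> lG -> ((0 < sF)%N -> sF <> sG) /\ ((eF <= N)%N -> eF <> eG)) ->
  ~ ((sF = 0%N \/ eF = N.+1) /\ (sG = 0%N \/ eG = N.+1)) ->
  (arr lF sF eF lG sG eG)%:Z - (arr lG sG eG lF sF eF)%:Z
    + Num.max 0 tF * Num.max 0 (- tG) - Num.max 0 tG * Num.max 0 (- tF)
  = (arr lF sF' eF' lG sG' eG')%:Z - (arr lG sG' eG' lF sF' eF')%:Z.
Proof.
move=> ad x0 xN lt1 lt2 le1 le2 SF SG; rewrite /apart => ap ne nf.
have ba : (b == a.+1) || (a == b.+1) by rewrite orbC.
have dif : lF <> lG -> sF <> sG /\ eF <> eG.
  move=> l; have [n1 n2] := ne l; split=> e; apply: nf.
    suff s0 : sF = 0%N by split; left; rewrite -?e.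
    by case: (posnP sF) => // /n1.
  suff s0 : eF = N.+1 by split; right; rewrite -?e.
  by have := le1; rewrite leq_eqVlt ltnS => /orP[/eqP|/n2].
have nab : a <> b by move=> e; move: ad; rewrite e; lia.
have [mF1 mF2] := braid_shape_moves SF; have [mG1 mG2] := braid_shape_moves SG.
have m00 : Num.max 0 (0 : int) = 0 by [].
case: SF mF1 mF2 => [e1 l1 s1|e1 l1 s1|e1 l1 s1|e1 l1 s1|o1] mF1 mF2; last first.
  have [os oe] : outside x sF /\ outside x eF.
    by rewrite /outside; case: o1 => [?|[?|[? ? _ _]]]; split; lia.
  have [-> ->] := arr_outside lG lF mG1 mG2 os oe.
  by rewrite oppr0 m00 mulr0 mul0r addr0 subr0.
all: case: SG mG1 mG2 => [e2 l2 s2|e2 l2 s2|e2 l2 s2|e2 l2 s2|o2] mG1 mG2.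
all: try (have [os oe] : outside x sG /\ outside x eG
    by (rewrite /outside; case: o2 => [?|[?|[? ? _ _]]]; split; lia));
  try (have [-> ->] := arr_outside lF lG mF1 mF2 os oe;
    by rewrite oppr0 m00 ?mulr0 ?mul0r ?addr0 ?subr0).
all: rewrite ?l1 ?l2 ?e1 ?e2 ?s1 ?s2 ?arr_same ?(arr_adjacent _ _ _ _ ad) ?(arr_adjacent _ _ _ _ ba).
all: have m0 : Num.max 0 (-1 : int) = 0 by [].
all: have m1 : Num.max 0 (1 : int) = 1 by [].
all: rewrite ?opprK ?m0 ?m1 ?mulr0 ?mul0r ?mulr1 ?addr0 ?subr0.
all: clear ne nf.
all: try (have := ap (etrans l1 (esym l2)); clear dif ap; lia).
all: have [|d1 d2] := dif; first by rewrite l1 l2 => e; apply: nab.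
all: clear dif ap nab; lia.
Qed.

Lemma arrow_arr r N (u : N.-tuple 'I_r) F G :
  arrow u F G = arr (level u F) (fstart F) (fend u F) (level u G) (fstart G) (fend u G).
Proof. by []. Qed.

Section BraidMutation.
Variables (r N : nat) (v v' : N.-tuple 'I_r) (p0 p1 p2 : 'I_N).
Hypotheses (p01 : p1 = p0.+1 :> nat) (p02 : p2 = p0.+2 :> nat)
  (adj : adjacent (tnth v p0) (tnth v p1)) (v2 : tnth v p2 = tnth v p0)
  (v'0 : tnth v' p0 = tnth v p1) (v'1 : tnth v' p1 = tnth v p0)
  (v'2 : tnth v' p2 = tnth v p1)
  (vE : forall j, j != p0 -> j != p1 -> j != p2 -> tnth v' j = tnth v j).
Let tau : {perm (face r N)} := tperm (inr p1) (inr p2).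
Let k : face r N := inr p0.
Let x := p0.+1.
Let a := tnth v p0.
Let b := tnth v p1.
Implicit Types F G : face r N.

Let fend' := braid_fend p01 p02 adj v2 v'0 v'1 v'2 vE.
Let fstart' : forall F, fstart (tau F) = sw x.+1 x.+2 (fstart F) := braid_fstart p01 p02.
Let unfrozen : ~~ frozen v k := triangle_unfrozen p01 p02 adj v2.

Lemma face_shape F : F != k ->
  braid_shape x a b (level v F) (fstart F) (fend v F)
    (fstart (tau F)) (fend v' (tau F)) (to_triangle v p0 F).
Proof.
move=> Fk; have [[sx ex] [s1 s2] [e0 e1] sl sp] := triangle_position p01 p02 adj v2 Fk.
have gt := fend_gt v F; rewrite fend' // fstart' /to_triangle.
have [es|n1] := eqVneq (fstart F) x.+1.
  have h := sl (or_introl es); rewrite [X in braid_shape _ _ _ _ _ _ _ _ X](_ : _ = 1); last lia.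
  rewrite (_ : sw _ _ (fstart F) = x.+2); last by rewrite /sw es eqxx.
  rewrite (_ : sw _ _ _ = fend v F); last by rewrite /sw; do !case: eqP => ?; lia.
  by apply: ShapeRB; rewrite ?s1.
have [es|n2] := eqVneq (fstart F) x.+2.
  have h := sl (or_intror es); rewrite [X in braid_shape _ _ _ _ _ _ _ _ X](_ : _ = -1); last lia.
  rewrite (_ : sw _ _ (fstart F) = x.+1); last by rewrite /sw; do !case: eqP => ?; lia.
  rewrite (_ : sw _ _ _ = fend v F); last by rewrite /sw; do !case: eqP => ?; lia.
  by apply: ShapeRA; rewrite ?s2.
rewrite (_ : sw _ _ (fstart F) = fstart F); last by rewrite /sw (negPf n1) (negPf n2).
have [ee|n3] := eqVneq (fend v F) x.
  rewrite [X in braid_shape _ _ _ _ _ _ _ _ X](_ : _ = 1); last lia.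
  rewrite (_ : sw _ _ _ = x.+1); last by rewrite /sw ee eqxx.
  by apply: ShapeLA; rewrite -?ee ?e0.
have [ee|n4] := eqVneq (fend v F) x.+1.
  rewrite [X in braid_shape _ _ _ _ _ _ _ _ X](_ : _ = -1); last lia.
  rewrite (_ : sw _ _ _ = x); last by rewrite /sw; do !case: eqP => ?; lia.
  by apply: ShapeLB; rewrite ?e1 //; move: sx gt; rewrite ee; lia.
rewrite [X in braid_shape _ _ _ _ _ _ _ _ X](_ : _ = 0); last lia.
rewrite (_ : sw _ _ _ = fend v F); last by rewrite /sw (negPf n3) (negPf n4).
apply: ShapeO; move/eqP: n1 n2 n3 n4 => n1 /eqP n2 /eqP n3 /eqP n4.
have [h1|h1] := ltnP (fstart F) x; last by right; left; lia.
have [h2|h2] := ltnP x.+2 (fend v F); last by left; lia.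
by right; right; have [] := sp h1 h2; split=> // /val_inj.
Qed.

Lemma to_triangle_braid F : F != k -> to_triangle v' p0 (tau F) = - to_triangle v p0 F.
Proof.
move=> Fk; have := face_shape Fk; rewrite [to_triangle v' _ _]/to_triangle.
have gt := fend_gt v F; rewrite -/x.
by case=> [*|*|*|*|[?|[?|[? ? _ _]]]]; lia.
Qed.

Lemma quiver0_diag (u : N.-tuple 'I_r) F : quiver0 u F F = 0.
Proof. by have := quiver0_skew u F F; lia. Qed.

Lemma braid_quiver F G :
  quiver0 v' (tau F) (tau G) = mutate_quiver v k (quiver0 v) F G.
Proof.
rewrite /mutate_quiver {1}/quiver0 !(braid_frozen p01 p02 adj v2 v'0 v'1 v'2 vE).
case: ifP => // /negbT nf; rewrite -quiver0E; last first.
  by rewrite !(braid_frozen p01 p02 adj v2 v'0 v'1 v'2 vE).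
have adj' : adjacent (tnth v' p0) (tnth v' p1) by rewrite v'0 v'1 adjacentC.
have v2' : tnth v' p2 = tnth v' p0 by rewrite v'2 v'0.
have tk : tau k = k by apply: braid_triangle.
have toK H : H != k -> quiver0 v' (tau H) k = - quiver0 v H k.
  move=> Hk; rewrite (quiver_to_triangle p01 p02 adj v2 Hk) -to_triangle_braid //.
  by apply: (quiver_to_triangle p01 p02 adj' v2'); apply: contraNneq Hk => e; rewrite -(inj_eq (@perm_inj _ tau)) e tk.
have [->|Fk] := eqVneq F k.
  have [->|Gk] := eqVneq G k; first by rewrite tk /= !quiver0_diag oppr0.
  by rewrite tk /= [LHS]quiver0_skew toK // [in RHS]quiver0_skew.
have [->|Gk] := eqVneq G k; first by rewrite tk toK.
rewrite /=.
have q_k H : quiver0 v k H = - quiver0 v H k by exact: quiver0_skew.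
rewrite !q_k !(quiver_to_triangle p01 p02 adj v2) //.
have [->|nFG] := eqVneq F G; first by rewrite !quiver0_diag; ring.
have [lF lG] := (face_shape Fk, face_shape Gk).
have N2 : (x.+2 <= N)%N by rewrite /x -p02 ltn_ord.
have ad : (a == b.+1 :> nat) || (b == a.+1 :> nat) := adj.
rewrite !quiver0E ?(braid_frozen p01 p02 adj v2 v'0 v'1 v'2 vE) //.
rewrite !arrow_arr !(braid_level v2 v'1 v'2 vE) //.
apply/esym/(braid_shape_arrows ad _ N2 _ _ _ _ lF lG); rewrite ?fend_gt ?fend_le //.
- move=> /val_inj lFG; have ns : fstart F <> fstart G.
    by move=> /(level_start_inj lFG) FG; rewrite FG eqxx in nFG.
  have [lt|lt] : (fstart F < fstart G)%N \/ (fstart G < fstart F)%N by lia.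
    by left; apply: same_level_disjoint.
  by right; apply: same_level_disjoint.
- move=> ne; have [|h1 _ _ h2] := @times_neq _ _ v F G; last by split.
  by apply/negP => /eqP e; apply: ne; rewrite e.
- move=> [h1 h2]; move: nf; rewrite /frozen /right_unbounded.
  by case: h1 => ->; case: h2 => ->; rewrite !eqxx ?orbT.
Qed.

End BraidMutation.

(** * Admissible sets of faces and invariance of their generating function *)

Section Gaps.
Variables (u : nat -> nat) (P : nat -> bool).

Lemma gap_last t j l : (j < t)%N -> u j = l ->
  (forall s, (j < s < t)%N -> u s <> l) -> gap u P t l.+1 = P j.
Proof.
elim: t => [//|t IH] /=; rewrite ltnS leq_eqVlt => /orP[/eqP ->|jt] uj no.
  by rewrite uj eqxx.
rewrite eqSS; case: eqP => [e|_]; last first.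
  by apply: IH => // s /andP[h1 h2]; apply: no; rewrite h1 ltnW.
by case: (no t); rewrite ?jt ?ltnSn.
Qed.

Lemma gap_none t l : (forall s, (s < t)%N -> u s <> l) -> gap u P t l.+1 = false.
Proof.
elim: t => [//|t IH] /= no; rewrite eqSS; case: eqP => [e|_]; first by case: (no t).
by apply: IH => s st; apply: no; rewrite ltnW.
Qed.

Lemma gap0 t : gap u P t 0 = false.
Proof. by elim: t. Qed.

End Gaps.

Section Admissible.
Variables (r N : nat).
Implicit Types (v : N.-tuple 'I_r) (i : nat) (phi : {ffun 'I_N -> bool}) (s : {perm 'I_N}).

Definition ext phi (t : nat) : bool := if insub t is Some j then phi j else false.

Lemma ext_ord phi (j : 'I_N) : ext phi j = phi j.
Proof. by rewrite /ext valK. Qed.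

Lemma letter_tnth v (j : 'I_N) : letter v j = tnth v j.
Proof. by rewrite (letter_ord _ (tnth v j)) ?size_tuple // -tnth_nth. Qed.

(** The combinatorial form of a region enclosed by a GP-path, phi marking its faces. On the last
    slice only the gap between the two end points is marked: lines i and i+1 end at heights r - i
    and r - i - 1, hence gap r - i. *)
Definition adm v i phi : bool :=
  [forall j : 'I_N, crossing_ok i (letter v) (ext phi) j] &&
  [forall h : 'I_r.+2, gap (letter v) (ext phi) N h == (h == (r - i)%N :> nat)].

Definition weight (K : fieldType) (y : face r N -> K) phi : K :=
  \prod_j (if phi j then (y (inr j))^-1 else 1).

Definition Theta (K : fieldType) v i (y : face r N -> K) : K :=
  \sum_(phi | adm v i phi) weight y phi.

Definition fperm s phi : {ffun 'I_N -> bool} := [ffun j => phi (s j)].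

Lemma fpermK s : (forall j, s (s j) = j) -> involutive (fperm s).
Proof. by move=> ss phi; apply/ffunP => j; rewrite !ffunE ss. Qed.

Lemma ext_other s phi t : (forall j : 'I_N, val j = t -> s j = j) ->
  ext (fperm s phi) t = ext phi t.
Proof.
by rewrite /ext; case: insubP => // j _ <- sj; rewrite ffunE sj.
Qed.

Lemma forall_perm s (C : pred 'I_N) :
  [forall j, C (s j)] = [forall j, C j].
Proof.
apply/forallP/forallP => H j; last exact: H.
by rewrite -(permKV s j) H.
Qed.

Lemma weight_perm (K : fieldType) (y : face r N -> K) s phi :
  weight y (fperm s phi) = \prod_j (if phi j then (y (inr (s^-1%g j)))^-1 else 1).
Proof.
rewrite /weight (reindex_inj (@perm_inj _ s^-1%g)).
by apply: eq_bigr => j _; rewrite ffunE permKV.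
Qed.

End Admissible.

Section CommTheta.
Variables (r N : nat) (v v' : N.-tuple 'I_r) (p0 p1 : 'I_N).
Hypotheses (p01 : p1 = p0.+1 :> nat) (ne : tnth v p0 != tnth v p1)
  (nadj : ~~ adjacent (tnth v p0) (tnth v p1))
  (v'0 : tnth v' p0 = tnth v p1) (v'1 : tnth v' p1 = tnth v p0)
  (vE : forall j, j != p0 -> j != p1 -> tnth v' j = tnth v j).
Let tau : {perm (face r N)} := tperm (inr p0) (inr p1).
Let s : {perm 'I_N} := tperm p0 p1.
Let u := letter v.
Let u' := letter v'.

Let tauE j : tau (inr j) = inr (s j).
Proof.
rewrite /tau /s; case: (tpermP p0 p1 j) => [->|->|n0 n1]; rewrite ?tpermL ?tpermR //.
by rewrite tpermD //; apply/eqP => -[e]; [apply: n0 | apply: n1].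
Qed.

Let n01 : p0 != p1. Proof. by rewrite -val_eqE /= p01 ltn_eqF. Qed.

Let uE t : t != p0 :> nat -> t != p0.+1 -> u' t = u t.
Proof.
move=> t0 t1; have [tN|tN] := ltnP t N; last first.
  by rewrite /u /u' /letter !nth_default ?size_map ?size_tuple.
have -> : t = Ordinal tN by [].
rewrite /u /u' !letter_tnth vE // -val_eqE //= p01 //.
Qed.

Let u'0 : u' p0 = u p0.+1.
Proof. by rewrite /u' letter_tnth v'0 -p01 /u letter_tnth. Qed.
Let u'1 : u' p0.+1 = u p0.
Proof. by rewrite -p01 /u' letter_tnth v'1 /u letter_tnth. Qed.
Let far : [&& u p0 != u p0.+1, u p0 != (u p0.+1).+1 & u p0.+1 != (u p0).+1].
Proof. by rewrite -p01 /u !letter_tnth; apply: far_letters. Qed.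
Let far' : [&& u' p0 != u' p0.+1, u' p0 != (u' p0.+1).+1 & u' p0.+1 != (u' p0).+1].
Proof. by rewrite u'0 u'1 eq_sym; case/and3P: far => -> -> ->. Qed.

Lemma comm_adm i phi : adm v' i (fperm s phi) = adm v i phi.
Proof.
have P'0 : ext (fperm s phi) p0 = ext phi p0.+1.
  by rewrite ext_ord ffunE /s tpermL -p01 ext_ord.
have P'1 : ext (fperm s phi) p0.+1 = ext phi p0.
  by rewrite -p01 ext_ord ffunE /s tpermR ext_ord.
have PE t : t != p0 :> nat -> t != p0.+1 -> ext (fperm s phi) t = ext phi t.
  move=> t0 t1; apply: ext_other => j jt; rewrite /s tpermD //.
    by apply: contraNneq t0 => ->; rewrite jt.
  by apply: contraNneq t1 => e; rewrite -jt -e; apply/eqP.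
rewrite /adm; congr (_ && _); last first.
  apply: eq_forallb => h; rewrite (comm_gap far u'0 u'1 uE P'0 P'1 PE) //.
  by rewrite -p01 neq_ltn ltn_ord orbT.
rewrite -(forall_perm s); apply: eq_forallb => j.
rewrite /s; case: tpermP => [->|->|/eqP j0 /eqP j1].
- rewrite p01 -(comm_crossing0 far' (esym u'1) (esym u'0) _ (esym P'1) (esym P'0)) //.
    by move=> t t0 t1; rewrite uE.
  by move=> t t0 t1; rewrite PE.
- by rewrite p01 (comm_crossing0 far u'0 u'1 uE P'0 P'1 PE).
- by rewrite (comm_crossing far u'0 u'1 uE P'0 P'1 PE) -?p01.
Qed.

Lemma comm_Theta (K : fieldType) i (y : face r N -> K) :
  Theta v' i (y \o tau) = Theta v i y.
Proof.
have sK j : s (s j) = j by rewrite /s tpermK.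
rewrite /Theta (reindex_inj (inv_inj (fpermK sK))) /=.
apply: eq_big => phi; first exact: comm_adm.
move=> _; rewrite weight_perm; apply: eq_bigr => j _.
by rewrite /= tauE permKV.
Qed.

End CommTheta.

Lemma fend_inj r N (v : N.-tuple 'I_r) (F G : face r N) :
  fend v F = fend v G -> (fend v F <= N)%N -> F = G.
Proof.
move=> e le; have [j ej lF] := fend_letter le.
have [j' ej' lG] : exists2 j : 'I_N, fend v G = j.+1 & tnth v j = level v G.
  by apply: fend_letter; rewrite -e.
have jj : j = j' by apply: val_inj; move: ej'; rewrite -e ej => -[].
have lFG : level v F = level v G by rewrite -lF -lG jj.
have gF := fend_gt v F; have gG := fend_gt v G.
have [lt|lt|st] := ltngtP (fstart F) (fstart G); last exact: level_start_inj lFG st.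
  by have := same_level_disjoint lFG lt; lia.
by have := same_level_disjoint (esym lFG) lt; lia.
Qed.

Lemma gap_face r N (v : N.-tuple 'I_r) phi (q : 'I_N) :
  gap (letter v) (ext phi) q (tnth v q).+1 =
  [exists j, phi j && (fend v (inr j) == q.+1)].
Proof.
have [j0 /andP[j0q lj0]|no] := pickP (fun j : 'I_N => (j < q)%N && (tnth v j == tnth v q)).
  have := @arg_maxnP _ j0 (fun j : 'I_N => (j < q)%N && (tnth v j == tnth v q)) val.
  case; rewrite ?j0q ?lj0 // => j /andP[jq /eqP lj] jmax.
  have no s : (j < s < q)%N -> letter v s <> tnth v q.
    move=> /andP[js sq]; have sN := ltn_trans sq (ltn_ord q).
    rewrite -[s]/(val (Ordinal sN)) letter_tnth => /val_inj ls.
    by have := jmax (Ordinal sN); rewrite sq ls eqxx => /(_ isT) /=; lia.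
  have fj : fend v (inr j) = q.+1.
    apply: fend_unique => //= j' /andP[h1 h2]; apply/eqP => l'; apply: (no j').
      by rewrite h1.
    by rewrite letter_tnth l' -lj.
  rewrite (gap_last _ jq) ?letter_tnth ?lj // ext_ord.
  apply/idP/existsP => [pj|[j' /andP[pj' /eqP fj']]]; first by exists j; rewrite pj fj eqxx.
  suff [<-] : inr j' = inr j :> face r N by [].
  by apply: (@fend_inj _ _ v); rewrite fj' // fj.
rewrite gap_none => [|s sq].
  apply/esym/existsP => -[j /andP[_ /eqP fj]].
  have [|q' e lq] := @fend_letter _ _ v (inr j); first by rewrite fj.
  have qq : q' = q by apply: val_inj; move: e; rewrite fj => -[].
  have := no j; rewrite -qq lq eqxx andbT qq.
  by have := fend_gt v (inr j); rewrite fj /= ltnS => ->.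
have sN := ltn_trans sq (ltn_ord q).
rewrite -[s]/(val (Ordinal sN)) letter_tnth => /val_inj ls.
by have := no (Ordinal sN); rewrite sq ls eqxx.
Qed.

Lemma prod_unique (K : fieldType) (J : finType) (c : pred J) (A : K) :
  (forall j j', c j -> c j' -> j = j') ->
  \prod_j (if c j then A else 1) = if [exists j, c j] then A else 1.
Proof.
move=> uc; case: existsP => [[j cj]|no].
  rewrite (bigD1 j) //= cj big1 ?mulr1 // => j' jj; case: ifP => // cj'.
  by rewrite (uc _ _ cj' cj) eqxx in jj.
by rewrite big1 // => j _; case: ifP => // cj; case: no; exists j.
Qed.

Lemma shape_factor (K : fieldType) (Y : K) x a b l s e s' e' t :
  braid_shape x a b l s e s' e' t -> (s < e)%N ->
  (1 + Y ^ (- sgz t)) ^ t =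
  (if e == x then 1 + Y^-1 else 1) * (if s == x.+1 then 1 + Y^-1 else 1)
  / ((if e == x.+1 then 1 + Y else 1) * (if s == x.+2 then 1 + Y else 1)).
Proof.
have F (m n : nat) : m <> n -> (m == n) = false by move=> /eqP/negPf.
case=> [-> _ h|-> _ h|-> _ h|-> _ h|o] se.
- by rewrite eqxx !F ?expr1z /= ?mulr1 ?invr1 ?mulr1 //; lia.
- by rewrite eqxx !F /= ?mul1r ?mulr1 ?expr1z //; lia.
- by rewrite eqxx !F ?expr1z /= ?mul1r ?mulr1 ?invr1 ?mulr1 //; lia.
- by rewrite eqxx !F /= ?mul1r ?mulr1 ?expr1z //; lia.
by case: o => [?|[?|[? ? _ _]]]; rewrite !F ?expr0z /= ?mulr1 ?invr1 ?mulr1 //; lia.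
Qed.

Lemma sum_pairs (K : fieldType) (N : nat) (q : 'I_N) (f : {ffun 'I_N -> bool} -> K) :
  let set b (phi : {ffun 'I_N -> bool}) := [ffun j => if j == q then b else phi j] in
  \sum_phi f phi = \sum_(phi : {ffun 'I_N -> bool} | ~~ phi q) (f phi + f (set true phi)).
Proof.
move=> set; rewrite (bigID (fun phi : {ffun 'I_N -> bool} => ~~ phi q)) /= big_split /=.
congr (_ + _); rewrite (reindex_onto (set true) (set false)) /=.
  apply: eq_bigl => phi; rewrite ffunE eqxx /=; apply/eqP/negPf => [<-|pq].
    by rewrite !ffunE eqxx.
  by apply/ffunP => j; rewrite !ffunE; case: eqP => // ->.
move=> phi; rewrite negbK => pq; apply/ffunP => j; rewrite !ffunE.
by case: eqP => // ->.
Qed.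

Section BraidTheta.
Variables (r N : nat) (v v' : N.-tuple 'I_r) (p0 p1 p2 : 'I_N).
Hypotheses (p01 : p1 = p0.+1 :> nat) (p02 : p2 = p0.+2 :> nat)
  (adj : adjacent (tnth v p0) (tnth v p1)) (v2 : tnth v p2 = tnth v p0)
  (v'0 : tnth v' p0 = tnth v p1) (v'1 : tnth v' p1 = tnth v p0)
  (v'2 : tnth v' p2 = tnth v p1)
  (vE : forall j, j != p0 -> j != p1 -> j != p2 -> tnth v' j = tnth v j).
Let tau : {perm (face r N)} := tperm (inr p1) (inr p2).
Let k : face r N := inr p0.
Let s : {perm 'I_N} := tperm p1 p2.
Let u := letter v.
Let u' := letter v'.
Implicit Types phi psi : {ffun 'I_N -> bool}.

Let n01 : p0 != p1. Proof. by rewrite -val_eqE /= p01 ltn_eqF. Qed.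
Let n02 : p0 != p2. Proof. by rewrite -val_eqE /= p02 ltn_eqF // ltnW. Qed.
Let n12 : p1 != p2. Proof. by rewrite -val_eqE /= p01 p02 ltn_eqF. Qed.

Let tauE j : tau (inr j) = inr (s j).
Proof.
rewrite /tau /s; case: (tpermP p1 p2 j) => [->|->|m0 m1]; rewrite ?tpermL ?tpermR //.
by rewrite tpermD //; apply/eqP => -[e]; [apply: m0 | apply: m1].
Qed.

Let s0 : s p0 = p0. Proof. by rewrite /s tpermD // eq_sym. Qed.

Let outsideP (j : 'I_N) : [&& val j != p0 :> nat, val j != p0.+1 & val j != p0.+2] =
  [&& j != p0, j != p1 & j != p2].
Proof. by rewrite -p02 -p01. Qed.

Let uE t : t != p0 :> nat -> t != p0.+1 -> t != p0.+2 -> u' t = u t.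
Proof.
move=> t0 t1 t2; have [tN|tN] := ltnP t N; last first.
  by rewrite /u /u' /letter !nth_default ?size_map ?size_tuple.
have /and3P[j0 j1 j2] : [&& Ordinal tN != p0, Ordinal tN != p1 & Ordinal tN != p2].
  by rewrite -outsideP t0 t1 t2.
by rewrite -[t]/(val (Ordinal tN)) /u /u' !letter_tnth vE.
Qed.

Let u0 : u p0 = tnth v p0. Proof. by rewrite /u letter_tnth. Qed.
Let u1 : u p0.+1 = tnth v p1. Proof. by rewrite -p01 /u letter_tnth. Qed.
Let u2 : u p0.+2 = u p0. Proof. by rewrite -p02 /u !letter_tnth v2. Qed.
Let u'0 : u' p0 = u p0.+1. Proof. by rewrite /u' letter_tnth v'0 u1. Qed.
Let u'1 : u' p0.+1 = u p0. Proof. by rewrite -p01 /u' letter_tnth v'1 u0. Qed.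
Let u'2 : u' p0.+2 = u p0.+1. Proof. by rewrite -p02 /u' letter_tnth v'2 u1. Qed.
Let ad : (u p0 == (u p0.+1).+1) || (u p0.+1 == (u p0).+1).
Proof. by rewrite u0 u1. Qed.
Let N2 : (p0.+2 < N)%N. Proof. by rewrite -p02. Qed.

Let inside (j : 'I_N) := [|| j == p0, j == p1 | j == p2].

(* Admissibility away from the three crossings of the move. *)
Let rest (w : N.-tuple 'I_r) i phi :=
  [forall j : 'I_N, inside j || crossing_ok i (letter w) (ext phi) j] &&
  [forall h : 'I_r.+2, gap (letter w) (ext phi) N h == (h == (r - i)%N :> nat)].

Let adm_rest w i phi : adm w i phi =
  [&& crossing_ok i (letter w) (ext phi) p0, crossing_ok i (letter w) (ext phi) p0.+1
    & crossing_ok i (letter w) (ext phi) p0.+2] && rest w i phi.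
Proof.
rewrite /adm /rest andbA; congr (_ && _); rewrite -p02 -p01.
apply/forallP/andP => [H|[/and3P[c0 c1 c2] /forallP H] j].
  by split; [rewrite !H | apply/forallP => j; rewrite H orbT].
by have /orP[/or3P[/eqP->|/eqP->|/eqP->]|] := H j.
Qed.

Let rest_braid i phi psi : psi p1 = phi p2 -> psi p2 = phi p1 ->
  (forall j, j != p0 -> j != p1 -> j != p2 -> psi j = phi j) ->
  rest v' i psi = rest v i phi.
Proof.
move=> e1 e2 eE.
have P'1 : ext psi p0.+1 = ext phi p0.+2 by rewrite -p02 -p01 !ext_ord.
have P'2 : ext psi p0.+2 = ext phi p0.+1 by rewrite -p02 -p01 !ext_ord.
have PE t : t != p0 :> nat -> t != p0.+1 -> t != p0.+2 -> ext psi t = ext phi t.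
  move=> t0 t1 t2; rewrite /ext; case: insubP => // j _ jt.
  have /and3P[j0 j1 j2] : [&& j != p0, j != p1 & j != p2].
    by rewrite -outsideP jt t0 t1 t2.
  exact: eE.
rewrite /rest; congr (_ && _); last first.
  apply: eq_forallb => h; rewrite (braid_gap ad u2 u'0 u'1 u'2 uE P'1 P'2 PE) //; lia.
apply: eq_forallb => j; case ij: (inside j) => //=.
have /and3P[j0 j1 j2] : [&& val j != p0 :> nat, val j != p0.+1 & val j != p0.+2].
  by rewrite outsideP -!negb_or -/(inside j) ij.
by rewrite (braid_crossing ad u2 u'0 u'1 u'2 uE P'1 P'2 PE).
Qed.

Let set b phi : {ffun 'I_N -> bool} := [ffun j => if j == p0 then b else phi j].

Let rest' i phi : rest v' i (fperm s phi) = rest v i phi.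
Proof.
apply: rest_braid => [||j j0 j1 j2]; rewrite ffunE /s ?tpermL ?tpermR //.
by rewrite tpermD // eq_sym.
Qed.

Let rest_set i b phi : rest v i (set b phi) = rest v i phi.
Proof.
rewrite -rest'; apply: rest_braid => [||j j0 j1 j2]; rewrite !ffunE /s ?tpermL ?tpermR //.
- by rewrite eq_sym (negPf n02).
- by rewrite eq_sym (negPf n01).
have -> : tperm p1 p2 j = j by rewrite tpermD // eq_sym.
by rewrite (negPf j0).
Qed.

Variables (K : fieldType) (y : face r N -> K).
Let Y := y k.
Let ym := xmut k (quiver0 v) y.
Hypotheses (Y0 : Y != 0) (Y1 : 1 + Y != 0).
Let A := 1 + Y^-1.
Let B := 1 + Y.

Let gA phi := gap u (ext phi) p0 (tnth v p0).+1.
Let gB phi := gap u (ext phi) p0 (tnth v p1).+1.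

(** Apart from the triangle, its four neighbours are the only faces whose coordinates change under
    the mutation; each of them that is marked contributes the inverse of its mutation factor. *)
Let factor phi : K :=
  (if gA phi then A else 1) * (if phi p1 then A else 1)
  / ((if gB phi then B else 1) * (if phi p2 then B else 1)).

Let weight_set phi (z : face r N -> K) : ~~ phi p0 ->
  weight z (set true phi) = weight z phi * (z k)^-1.
Proof.
move=> p; rewrite /weight (bigD1 p0) // [X in _ = X * _](bigD1 p0) //=.
rewrite ffunE eqxx (negPf p) mul1r mulrC; congr (_ * _).
by apply: eq_bigr => j j0; rewrite ffunE (negPf j0).
Qed.

Let weight_mut phi : ~~ phi p0 -> weight ym phi = weight y phi * factor phi.
Proof.
move=> p; pose t j := to_triangle v p0 (inr j).
have ymE j : phi j -> (ym (inr j))^-1 = (y (inr j))^-1 * (1 + Y ^ (- sgz (t j))) ^ t j.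
  move=> pj; have jk : inr j != k by apply: contraNneq p => -[<-].
  rewrite /ym /xmut (negPf jk) (quiver_to_triangle p01 p02 adj v2) // invfM.
  by rewrite invr_expz opprK.
have uniqF q : (q <= N)%N -> forall j j', phi j && (fend v (inr j : face r N) == q) ->
    phi j' && (fend v (inr j' : face r N) == q) -> j = j'.
  move=> qN j j' /andP[_ /eqP fj] /andP[_ /eqP fj'].
  suff [] : inr j = inr j' :> face r N by [].
  by apply: (@fend_inj _ _ v); rewrite fj ?fj'.
have prodE q (c : K) : (q <= N)%N ->
    \prod_j (if phi j then (if fend v (inr j : face r N) == q then c else 1) else 1) =
    if [exists j, phi j && (fend v (inr j : face r N) == q)] then c else 1.
  move=> qN; rewrite -(prod_unique c (uniqF q qN)).
  by apply: eq_bigr => j _; case: (phi j).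
have prod1 (j0 : 'I_N) (c : K) : \prod_j (if phi j then (if j == j0 then c else 1) else 1) =
    if phi j0 then c else 1.
  rewrite (bigD1 j0) //= eqxx big1 ?mulr1 // => j /negPf ->.
  by case: (phi j).
transitivity (\prod_j ((if phi j then (y (inr j))^-1 else 1) *
   (((if phi j then (if fend v (inr j : face r N) == p0.+1 then A else 1) else 1) *
     (if phi j then (if j == p1 then A else 1) else 1)) /
    ((if phi j then (if fend v (inr j : face r N) == p1.+1 then B else 1) else 1) *
     (if phi j then (if j == p2 then B else 1) else 1))))).
  apply: eq_bigr => j _; case pj: (phi j); last by rewrite !mulr1 invr1 !mulr1.
  rewrite ymE //; congr (_ * _).
  have jk : inr j != k by apply: contraNneq p => -[<-].
  rewrite (shape_factor Y (face_shape p01 p02 adj v2 v'0 v'1 v'2 vE jk)) ?fend_gt //.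
  have -> : (fstart (inr j : face r N) == p0.+2) = (j == p1) by rewrite /= eqSS -p01.
  have -> : (fstart (inr j : face r N) == p0.+3) = (j == p2) by rewrite /= eqSS -p02.
  by rewrite -p01.
rewrite big_split /= big_split /= prodfV !big_split /= !prodE ?ltn_ord // !prod1.
rewrite /weight /factor; congr (_ * (_ * _ / (_ * _))).
  by rewrite /gA gap_face.
have -> : gB phi = gap u (ext phi) p1 (tnth v p1).+1.
  rewrite p01 /= u0 eqSS; case: eqP => // /val_inj e.
  by have := adjacent_neq adj; rewrite e eqxx.
by rewrite gap_face.
Qed.

Hypotheses (inc : increasing u N).

Let low_gap (w : N.-tuple 'I_r) phi psi :
  (forall t, (t < p0)%N -> letter w t = u t) -> (forall j : 'I_N, (j < p0)%N -> psi j = phi j) ->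
  gap (letter w) (ext psi) p0 =1 gap u (ext phi) p0.
Proof.
move=> wE pE; apply: gap_eq => // t t0.
by rewrite /ext; case: insubP => // j _ jt; apply: pE; rewrite -jt in t0.
Qed.

Let lowE t : (t < p0)%N -> u' t = u t.
Proof. by move=> t0; apply: uE; rewrite neq_ltn ?ltnS ?(ltnW t0) ?(leqW (ltnW t0)) ?t0. Qed.

Let low_s phi (j : 'I_N) : (j < p0)%N -> fperm s phi j = phi j.
Proof.
by move=> j0; rewrite ffunE /s tpermD // -val_eqE /= ?p01 ?p02 gtn_eqF // ?ltnS ?(ltnW j0) ?(leqW (ltnW j0)).
Qed.

Let low_set phi (j : 'I_N) : (j < p0)%N -> set true phi j = phi j.
Proof. by move=> j0; rewrite ffunE -val_eqE ltn_eqF. Qed.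

Let o i h := (line u p0 h <= i)%N.
Let o' i h : (line u' p0 h <= i)%N = o i h.
Proof. by rewrite (line_eq lowE). Qed.

Let three (w : N.-tuple 'I_r) i phi :=
  [&& crossing_ok i (letter w) (ext phi) p0, crossing_ok i (letter w) (ext phi) p0.+1
    & crossing_ok i (letter w) (ext phi) p0.+2].

Let e0 phi : ext phi p0 = phi p0. Proof. exact: ext_ord. Qed.
Let e1 phi : ext phi p0.+1 = phi p1. Proof. by rewrite -p01 ext_ord. Qed.
Let e2 phi : ext phi p0.+2 = phi p2. Proof. by rewrite -p02 ext_ord. Qed.

Let set_E phi : [/\ set true phi p0 = true, set true phi p1 = phi p1 & set true phi p2 = phi p2].
Proof. by split; rewrite ffunE ?eqxx // eq_sym ?(negPf n01) ?(negPf n02). Qed.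

Let fperm_E phi : [/\ fperm s phi p0 = phi p0, fperm s phi p1 = phi p2
  & fperm s phi p2 = phi p1].
Proof. by split; rewrite ffunE ?s0 // /s ?tpermL ?tpermR. Qed.

Let pair_eq i phi : ~~ phi p0 ->
  (adm v i phi)%:R * weight y phi + (adm v i (set true phi))%:R * weight y (set true phi)
  = (adm v' i (fperm s phi))%:R * weight ym phi
    + (adm v' i (fperm s (set true phi)))%:R * weight ym (set true phi).
Proof.
move=> pp; rewrite !weight_set // weight_mut // !adm_rest !rest' !rest_set.
rewrite -!/(three _ _ _).
have -> : (ym k)^-1 = Y by rewrite /ym /xmut eqxx invrK.
case: (rest v i phi); last by rewrite !andbF !mul0r !addr0.
rewrite !andbT.
suff E : (three v i phi)%:R + (three v i (set true phi))%:R * Y^-1 =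
    ((three v' i (fperm s phi))%:R + (three v' i (fperm s (set true phi)))%:R * Y)
    * factor phi.
  transitivity (((three v i phi)%:R + (three v i (set true phi))%:R * Y^-1) * weight y phi).
    by rewrite -/Y; ring.
  by rewrite E; ring.
have [s1 s2 s3] := set_E phi; have [f1 f2 f3] := fperm_E phi.
have [g1 g2 g3] := fperm_E (set true phi).
have gs : gap u (ext (set true phi)) p0 =1 gap u (ext phi) p0.
  by apply: low_gap => // j; apply: low_set.
have gf : gap u' (ext (fperm s phi)) p0 =1 gap u (ext phi) p0.
  by apply: low_gap => // j; apply: low_s.
have gsf : gap u' (ext (fperm s (set true phi))) p0 =1 gap u (ext phi) p0.
  by apply: low_gap => // j j0; rewrite low_s // low_set.
have asc : [&& ascent u p0, ascent u p0.+1 & ascent u p0.+2].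
  by apply/and3P; split; apply: inc; rewrite ?N2 // ?(ltnW N2) ?(ltnW (ltnW N2)).
have imp a b : (line u p0 a < line u p0 b)%N -> o i b ==> o i a.
  by move=> lt; apply/implyP; apply: leq_trans (ltnW lt).
have A0 : A != 0.
  have -> : A = (1 + Y) / Y by rewrite /A; field.
  by rewrite mulf_neq0 ?invr_eq0.
have [up|dn] := orP ad; last first.
  have {}dn : u p0.+1 = (u p0).+1 by apply/eqP.
  have c : u' p0.+2 = (u p0).+1 by rewrite u'2 dn.
  have c0 : u' p0 = (u p0).+1 by rewrite u'0 dn.
  rewrite /three -!/u -!/u' !(three_up _ _ (erefl (u p0)) dn u2) !(three_down _ _ c0 u'1 c).
  rewrite !e0 !e1 !e2 !gs !gf !gsf s1 s2 s3 f1 f2 f3 g1 g2 g3 !o' -!/(o _ _) s1 s2 s3 (negPf pp).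
  have := asc; rewrite (ascent_up (erefl (u p0)) dn u2) => /and3P[l1 _ l2].
  rewrite (braid_weights _ _ _ _ _ _ Y0 Y1 (imp _ _ l1) (imp _ _ l2)).
  by rewrite /factor /gA /gB -u0 -u1 dn.
have {}up : u p0 = (u p0.+1).+1 by apply/eqP.
have d2 : u p0.+2 = (u p0.+1).+1 by rewrite u2.
have d1 : u' p0.+1 = (u p0.+1).+1 by rewrite u'1.
(* In this direction the move is the reverse of the one in [braid_weights], which is applied with
   1/Y in place of Y; the two correction factors then cancel. *)
have Yi0 : Y^-1 != 0 by rewrite invr_eq0.
rewrite /three -!/u -!/u' !(three_down _ _ up (erefl _) d2) !(three_up _ _ u'0 d1 u'2).
rewrite !e0 !e1 !e2 !gs !gf !gsf s1 s2 s3 f1 f2 f3 g1 g2 g3 !o' -!/(o _ _) s1 s2 s3 (negPf pp).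
have := asc; rewrite (ascent_down up (erefl _) d2) => /and3P[l1 _ l2].
have := @braid_weights _ _ (o i (u p0.+1)) (o i (u p0.+1).+1) (o i (u p0.+1).+2)
  (gap u (ext phi) p0 (u p0.+1)) (gap u (ext phi) p0 (u p0.+1).+1)
  (gap u (ext phi) p0 (u p0.+1).+2) (gap u (ext phi) p0 (u p0.+1).+3)
  (phi p1) (phi p2) Yi0 A0 (imp _ _ l1) (imp _ _ l2).
rewrite invrK => ->; rewrite /factor /gA /gB -u0 -u1 up.
rewrite -[LHS]mulr1 -[RHS]mulrA; congr (_ * _).
rewrite -/A -/B; set b1 := gap _ _ _ _; set b2 := gap _ _ _ _.
have nz (b b' : bool) (c : K) : c != 0 -> (if b then c else 1) * (if b' then c else 1) != 0.
  by move=> c0; rewrite mulf_neq0 //; case: ifP; rewrite ?oner_eq0.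
have B0 : B != 0 by [].
by rewrite mulrA divfK ?nz // divff ?nz.
Qed.

(** Marked sets are grouped into pairs that differ only at the triangle. For each pair the
    conditions away from the move agree on both sides, and the local identity [braid_weights] does
    the rest. *)
Lemma braid_Theta i : Theta v' i (ym \o tau) = Theta v i y.
Proof.
have sK j : s (s j) = j by rewrite /s tpermK.
have w' phi : weight (ym \o tau) (fperm s phi) = weight ym phi.
  by rewrite weight_perm; apply: eq_bigr => j _; rewrite /= tauE permKV.
rewrite /Theta (reindex_inj (inv_inj (fpermK sK))) /=.
rewrite big_mkcond [RHS]big_mkcond /=.
pose f phi := (adm v i phi)%:R * weight y phi.
pose g phi := (adm v' i (fperm s phi))%:R * weight ym phi.
transitivity (\sum_phi g phi).
  by apply: eq_bigr => phi _; rewrite /g w'; case: ifP; rewrite ?mul1r ?mul0r.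
transitivity (\sum_phi f phi); last first.
  by apply: eq_bigr => phi _; rewrite /f; case: ifP; rewrite ?mul1r ?mul0r.
rewrite (sum_pairs p0 f) (sum_pairs p0 g); apply: eq_bigr => phi pp.
by rewrite /f /g pair_eq.
Qed.

End BraidTheta.

Lemma rep_neq0 (K : numFieldType) (I : finType) z (F : (I -> K) -> K) :
  rep z F -> (forall x, cpos x -> F x != 0) -> z != 0.
Proof.
move=> [P [Q [Q0 -> FE]]] F0; pose ones (a : I) : K := 1; have p1 : cpos ones by move=> a; apply: ltr01.
have P0 : mev ones P != 0.
  by have := F0 _ p1; rewrite FE //; apply: contraNneq => ->; rewrite mul0r.
have nz S : mev ones S != 0 -> tofrac S != 0 :> {fraction (mpoly #|I| K)}.
  by move=> S0; rewrite tofrac_eq0; apply: contraNneq S0 => ->; rewrite /mev meval0.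
exact: mulf_neq0 (nz _ P0) (invr_neq0 (nz _ (Q0 _ p1))).
Qed.

(** * Transport of seeds along braid moves *)

Section Transport.
Variables (R : realType) (r N : nat) (w : N.-tuple 'I_r).
Implicit Types (s : seed R r N) (v : N.-tuple 'I_r).

Lemma seed_rep s : is_seed w s -> exists F : (face r N -> R[i]) -> face r N -> R[i],
  (forall x, cpos x -> cpos (F x)) /\ forall a, rep (seed_coord s a) (F^~ a).
Proof.
elim=> [|{}s k _ [F [Fp sF]] _].
  by exists id; split=> // a; apply: rep_coord.
exists (fun x => xrun [:: k] (seed_quiver s) (F x)); split.
  by move=> x px; apply: xrun_cpos; apply: Fp.
by move=> a; apply: (@rep_xrun _ _ [:: k] (seed_quiver s) (seed_coord s) F a).
Qed.

Lemma seed_coord_neq0 s a : is_seed w s -> seed_coord s a != 0.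
Proof.
move=> /seed_rep[F [Fp sF]]; apply: rep_neq0 (sF a) _ => x px.
by rewrite gt_eqF // Fp.
Qed.

Lemma seed_coord_neqN1 s a : is_seed w s -> 1 + seed_coord s a != 0.
Proof.
move=> /seed_rep[F [Fp sF]]; apply: rep_neq0 (repD (rep1 _ _) (sF a)) _ => x px.
by rewrite gt_eqF // addr_gt0 // Fp.
Qed.

(* s is, up to the relabelling sigma, the seed of the arrangement of v. *)
Definition transported v s (sigma : {perm (face r N)}) : Prop :=
  [/\ is_seed w s,
      forall a b, seed_quiver s a b = quiver0 v (sigma a) (sigma b),
      forall a, frozen v (sigma a) = frozen w a,
      forall a, right_unbounded w a ->
        right_unbounded v (sigma a) /\ level v (sigma a) = level w a
    & forall i, Theta w i (@X R r N) = Theta v i (seed_coord s \o sigma^-1%g)].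

Lemma transported0 : transported w (seed0 R w) 1.
Proof.
split=> [|a b|a|a ra|i]; rewrite ?perm1 //; first exact: is_seed0.
by congr (Theta w i _); apply/funext => a; rewrite /= invg1 perm1.
Qed.

Lemma transported_comm v v' s sigma (p0 p1 : 'I_N) : p1 = p0.+1 :> nat ->
  tnth v p0 != tnth v p1 -> ~~ adjacent (tnth v p0) (tnth v p1) ->
  tnth v' p0 = tnth v p1 -> tnth v' p1 = tnth v p0 ->
  (forall j, j != p0 -> j != p1 -> tnth v' j = tnth v j) ->
  transported v s sigma -> transported v' s (sigma * tperm (inr p0) (inr p1)).
Proof.
move=> p01 ne nadj v'0 v'1 vE [ss qs fs rs Ts]; set tau := tperm _ _.
split=> // [a b|a|a ra|i].
- by rewrite !permM (comm_quiver p01 ne nadj v'0 v'1 vE).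
- by rewrite permM (comm_frozen p01 ne nadj v'0 v'1 vE).
- rewrite permM (comm_right_unbounded p01 ne nadj v'0 v'1 vE).
  by rewrite (comm_level v'0 v'1 vE); apply: rs.
rewrite Ts -(comm_Theta p01 ne nadj v'0 v'1 vE) -/tau; congr (Theta v' i _).
by apply/funext => a; rewrite /= invMg permM tpermV.
Qed.

Lemma transported_braid v v' s sigma (p0 p1 p2 : 'I_N) :
  p1 = p0.+1 :> nat -> p2 = p0.+2 :> nat ->
  adjacent (tnth v p0) (tnth v p1) -> tnth v p2 = tnth v p0 ->
  tnth v' p0 = tnth v p1 -> tnth v' p1 = tnth v p0 -> tnth v' p2 = tnth v p1 ->
  (forall j, j != p0 -> j != p1 -> j != p2 -> tnth v' j = tnth v j) ->
  increasing (letter v) N ->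
  transported v s sigma ->
  transported v' (mutate w (sigma^-1%g (inr p0)) s) (sigma * tperm (inr p1) (inr p2)).
Proof.
move=> p01 p02 adj v2 v'0 v'1 v'2 vE inc [ss qs fs rs Ts].
set tau := tperm _ _; set k' := sigma^-1%g _; pose k : face r N := inr p0.
have sk' : sigma k' = k by rewrite permKV.
have eqk a : (a == k') = (sigma a == k) by rewrite -sk' (inj_eq perm_inj).
have uk : ~~ frozen v k := triangle_unfrozen p01 p02 adj v2.
have uk' : ~~ frozen w k' by rewrite -fs sk'.
split=> [|a b|a|a ra|i].
- exact: is_seed_mutate.
- rewrite !permM (braid_quiver p01 p02 adj v2 v'0 v'1 v'2 vE) /= /mutate_quiver.
  by rewrite !fs !qs !eqk sk'.
- by rewrite permM (braid_frozen p01 p02 adj v2 v'0 v'1 v'2 vE).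
- have [ra' la] := rs a ra; have ak : sigma a != k.
    by apply: contraNneq uk => <-; rewrite /frozen ra' orbT.
  rewrite permM (braid_right_unbounded p01 p02 adj v2 v'0 v'1 v'2 vE).
  by rewrite (braid_level v2 v'1 v'2 vE).
pose y : face r N -> ratfun R r N := seed_coord s \o sigma^-1%g.
have y0 : y k != 0 by apply: seed_coord_neq0 ss.
have y1 : 1 + y k != 0 by apply: seed_coord_neqN1 ss.
rewrite Ts -(braid_Theta p01 p02 adj v2 v'0 v'1 v'2 vE y0 y1 inc) -/tau.
congr (Theta v' i _); apply/funext => a; rewrite /= invMg permM tpermV.
by rewrite /xmut eqk permKV qs permKV sk'.
Qed.

Lemma transported_braid_eq v v' : braid_eq v v' -> increasing (letter v) N ->
  (exists s sigma, transported v s sigma) -> exists s sigma, transported v' s sigma.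
Proof.
suff H (x y : seq 'I_r) : braid_eq x y -> forall v v' : N.-tuple 'I_r, val v = x -> val v' = y ->
    increasing (letter x) N ->
    (exists s sigma, transported v s sigma) -> exists s sigma, transported v' s sigma.
  by move=> E inc; apply: H E v v' erefl erefl inc.
elim=> [{}x|x1 x2 x3 E1 H1 E2 H2|{}x {}y a b ab nab|{}x {}y a b ab] {}v {}v' vx v'x inc.
- by have -> : v = v' by apply: val_inj; rewrite /= vx v'x.
- have sz : size x2 == N by rewrite -(braid_eq_size E1) -vx size_tuple.
  move=> /(H1 v (Tuple sz) vx erefl inc); apply: H2 => //.
  rewrite -[N](eqP sz); apply: braid_eq_increasing E1 _.
  by rewrite -vx size_tuple vx.
- have [e0 e1 sz eE] := comm_facts x y a b; have [e0' e1' _ _] := comm_facts x y b a.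
  have sN : size (x ++ [:: a, b & y]) = N by rewrite -vx size_tuple.
  rewrite sN in sz; pose p1 := Ordinal sz; pose p0 := Ordinal (ltnW sz).
  have at_ (j : 'I_N) : (tnth v j = letter (x ++ [:: a, b & y]) j :> nat)
      /\ (tnth v' j = letter (x ++ [:: b, a & y]) j :> nat).
    by rewrite -vx -v'x !letter_tnth.
  have v0 : tnth v p0 = a by apply: val_inj; rewrite /= (at_ _).1.
  have v1 : tnth v p1 = b by apply: val_inj; rewrite /= (at_ _).1.
  have v'0 : tnth v' p0 = b by apply: val_inj; rewrite /= (at_ _).2.
  have v'1 : tnth v' p1 = a by apply: val_inj; rewrite /= (at_ _).2.
  have vE j : j != p0 -> j != p1 -> tnth v' j = tnth v j.
    by move=> j0 j1; apply: val_inj; rewrite /= (at_ _).1 (at_ _).2 eE.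
  case=> s [sigma T]; exists s, (sigma * tperm (inr p0) (inr p1))%g.
  by apply: (transported_comm (p0 := p0) (p1 := p1)) T; rewrite ?v0 ?v1.
have [e0 e1 e2 sz eE] := braid_facts x y a b; have [e0' e1' e2' _ _] := braid_facts x y b a.
have sN : size (x ++ [:: a, b, a & y]) = N by rewrite -vx size_tuple.
rewrite sN in sz.
pose p2 := Ordinal sz; pose p1 := Ordinal (ltnW sz); pose p0 := Ordinal (ltnW (ltnW sz)).
have at_ (j : 'I_N) : (tnth v j = letter (x ++ [:: a, b, a & y]) j :> nat)
    /\ (tnth v' j = letter (x ++ [:: b, a, b & y]) j :> nat).
  by rewrite -vx -v'x !letter_tnth.
have v0 : tnth v p0 = a by apply: val_inj; rewrite /= (at_ _).1.
have v1 : tnth v p1 = b by apply: val_inj; rewrite /= (at_ _).1.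
have v2 : tnth v p2 = a by apply: val_inj; rewrite /= (at_ _).1.
have v'0 : tnth v' p0 = b by apply: val_inj; rewrite /= (at_ _).2.
have v'1 : tnth v' p1 = a by apply: val_inj; rewrite /= (at_ _).2.
have v'2 : tnth v' p2 = b by apply: val_inj; rewrite /= (at_ _).2.
have vE j : j != p0 -> j != p1 -> j != p2 -> tnth v' j = tnth v j.
  by move=> j0 j1 j2; apply: val_inj; rewrite /= (at_ _).1 (at_ _).2 eE.
case=> s [sigma T]; exists (mutate w (sigma^-1%g (inr p0)) s), (sigma * tperm (inr p1) (inr p2))%g.
by apply: (transported_braid (p0 := p0) (p1 := p1) (p2 := p2)) T; rewrite ?v0 ?v1 ?v2 ?vx.
Qed.

End Transport.

(** * Words ending in a prescribed letter, and the theta functions of right faces *)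

Lemma cross_ok_false (la lb : bool) : (lb -> la) -> cross_ok la lb false false false false.
Proof. by case: la; case: lb => // ->. Qed.

(* A crossing with no enclosed face on its right has none on its left. *)
Lemma cross_ok_empty (la lb left right : bool) : cross_ok la lb false left right false ->
  (right -> la && ~~ lb) -> left = false.
Proof. by case: la; case: lb; case: left; case: right => //= _ /(_ isT). Qed.

Section Empty.
Variables (i : nat) (u : nat -> nat) (P : nat -> bool).

(** An empty slice stays empty when moved to the left, since a crossing with nothing marked below,
    above and to its right has nothing marked to its left. *)
Lemma gap_empty t : (forall h, gap u P t h = false) ->
  (forall t', (t' < t)%N -> crossing_ok i u P t') -> forall t', (t' < t)%N -> P t' = false.
Proof.
elim: t => [//|t IH] g c; have Pt : P t = false.
  by have := g (u t).+1; rewrite /= eqxx.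
have gt h : h != (u t).+1 -> gap u P t h = false.
  by move=> n; have := g h; rewrite /= (negPf n).
have g0 : gap u P t (u t) = false by rewrite gt // neq_ltn ltnSn.
have g2 : gap u P t (u t).+2 = false by rewrite gt // neq_ltn ltnSn orbT.
have g1 : gap u P t (u t).+1 = false.
  have := c t (ltnSn t); rewrite /crossing_ok g0 g2 Pt => h.
  by apply: cross_ok_empty h _.
have g' h : gap u P t h = false.
  by have [->|] := eqVneq h (u t).+1; last exact: gt.
move=> t'; rewrite ltnS leq_eqVlt => /orP[/eqP -> //|].
by apply: IH => // t'' lt; apply: c; apply: ltnW.
Qed.

Lemma gap_false t h : (forall t', (t' < t)%N -> P t' = false) -> gap u P t h = false.
Proof.
elim: t => [//|t IH] Pf /=; case: ifP => _; first exact: Pf.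
by apply: IH => t' lt; apply: Pf; apply: ltnW.
Qed.

End Empty.

Section Last.
Variables (r N : nat) (v : N.-tuple 'I_r) (q : 'I_N).
Hypothesis qN : q.+1 = N.

Lemma last_right_unbounded : right_unbounded v (inr q).
Proof.
rewrite /right_unbounded; apply/eqP; apply: fend_infinite => j /=; rewrite qN.
by move=> h; have := ltn_ord j; lia.
Qed.

(** This face starts at time N and ends at N+1: no face starts at N+1 and none ends strictly in
    between. *)
Lemma last_sink F : quiver0 v (inr q) F <= 0.
Proof.
have fq : fend v (inr q) = N.+1 by apply/eqP: last_right_unbounded.
rewrite /quiver0; case: ifP => // _; suff -> : arrow v (inr q) F = false by case: (arrow _ _ _).
rewrite arrow_arr fq /arr /= qN; have := fstart_le F; have := fend_le v F.
move: (fstart F) (fend v F) => s e es sN.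
by apply/negP => /orP[/andP[_ /eqP]|/and4P[_ h1 h2 h3]]; lia.
Qed.

Hypotheses (inc : increasing (letter v) N)
  (rv : forall h : 'I_r.+1, line (letter v) N h = (r - h)%N).
Let l := tnth v q.
Let i : nat := rev_ord l.
Let u := letter v.
Let uq : u q = l. Proof. exact: letter_tnth. Qed.

Let line_q : line u q l.+1 = (r - l)%N /\ line u q l = i.
Proof.
have E (h : 'I_r.+1) : line u q (swp l h) = (r - h)%N.
  by rewrite -rv -uq; exact: esym (congr1 (fun t => line u t h) (esym qN)).
have := E (widen_ord (leqnSn r) l); have := E (lift ord0 l).
by rewrite /= /bump /= swpL add1n swpR.
Qed.

(** The condition on the last slice forces the last face to be marked and all other gaps there to be
    empty. The last crossing, with a leftward lower and a rightward upper line, then has an empty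
    face on its left, and [gap_empty] clears everything before. *)
Lemma adm_last phi : adm v i phi = (phi == [ffun j => j == q]).
Proof.
have [l1 l0] := line_q; have ri : (r - i)%N = l.+1 by rewrite /i /= subKn.
have li : (l.+1 < r.+2)%N by have := ltn_ord l; lia.
have lt : (i < r - l)%N by have := ltn_ord l; rewrite /i /=; lia.
have cq P : crossing_ok i u P q = cross_ok true false (gap u P q l) (gap u P q l.+1)
    (P q) (gap u P q l.+2).
  by rewrite /crossing_ok uq l0 l1 leqnn leqNgt lt.
have gN P h : gap u P N h = if h == l.+1 then P q else gap u P q h.
  by rewrite -uq; exact: (congr1 (fun t => gap u P t h) (esym qN)).
have big h P : (r.+1 < h)%N -> gap u P q h = false.
  case: h => // h hr; apply: gap_none => s _ e.
  have [sN|sN] := ltnP s (size v); last first.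
    by move: hr; rewrite -e /u /letter nth_default ?size_map //; lia.
  by have := ltn_ord (nth l v s); rewrite -(letter_ord sN l) -/u e; lia.
apply/andP/eqP => [[/forallP c /forallP b]|->].
  have {}c t : (t < N)%N -> crossing_ok i u (ext phi) t.
    by move=> tN; have := c (Ordinal tN).
  have {}b h : gap u (ext phi) N h = (h == l.+1).
    have [hr|hr] := ltnP h r.+2; first by have /eqP := b (Ordinal hr); rewrite ri.
    have hl : (h == l.+1) = false by apply/eqP; have := ltn_ord l; lia.
    by rewrite gN hl big.
  have pq : phi q by have := b l.+1; rewrite gN eqxx ext_ord.
  have g h : h != l.+1 -> gap u (ext phi) q h = false.
    by move=> hl; have := b h; rewrite gN (negPf hl).
  have g0 : gap u (ext phi) q l = false by rewrite g // neq_ltn ltnSn.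
  have g2 : gap u (ext phi) q l.+2 = false by rewrite g // neq_ltn ltnSn orbT.
  have g1 : gap u (ext phi) q l.+1 = false.
    have := c q (ltn_ord q); rewrite cq g0 g2 => h.
    by apply: cross_ok_empty h _.
  have ga h : gap u (ext phi) q h = false.
    by have [->|] := eqVneq h l.+1; last exact: g.
  apply/ffunP => j; rewrite ffunE; have [->|jq] := eqVneq j q; first by rewrite pq.
  rewrite -ext_ord; apply: (gap_empty ga) => [t tq|]; first exact/c/(ltn_trans tq).
  by have := ltn_ord j; rewrite -[X in (_ < X)%N]qN ltnS leq_eqVlt (negPf (jq : val j != q)).
set phi0 := [ffun j => j == q].
have P0 t : (t < q)%N -> ext phi0 t = false.
  by rewrite /ext; case: insubP => // j _ <- jq; rewrite ffunE -val_eqE ltn_eqF.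
have gf t h : (t <= q)%N -> gap u (ext phi0) t h = false.
  by move=> tq; apply: gap_false => t' t't; apply: P0; apply: leq_trans tq.
split; last first.
  by apply/forallP => h; rewrite -/u gN gf // ext_ord ffunE eqxx ri; case: ifP.
apply/forallP => j; have [->|jq] := eqVneq j q; first by rewrite -/u cq !gf // ext_ord ffunE eqxx.
have jlt : (j < q)%N.
  by have := ltn_ord j; rewrite -[X in (_ < X)%N]qN ltnS leq_eqVlt (negPf (jq : val j != q)).
rewrite /crossing_ok -/u !gf ?P0 ?(ltnW jlt) //; apply: cross_ok_false.
by apply: leq_trans; apply/ltnW/inc/ltn_ord.
Qed.

Lemma Theta_last (K : fieldType) (y : face r N -> K) : Theta v i y = (y (inr q))^-1.
Proof.
rewrite /Theta (eq_bigl _ _ adm_last) big_pred1_eq /weight (bigD1 q) //= ffunE eqxx.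
by rewrite big1 ?mulr1 // => j jq; rewrite ffunE (negPf jq).
Qed.

End Last.

Section RightFace.
Variables (R : realType) (r N : nat) (w : N.-tuple 'I_r).
Hypotheses (inc : increasing (letter w) N) (rw : wordperm w = longest r).

(** After moving to a word ending in l, the right face of level l is bounded by the last crossing,
    where it is a sink and [Theta] is a single monomial. Compatibility of [Theta] with the moves
    expresses this in the initial coordinates. *)
Lemma right_sink (l : 'I_r) : exists s : seed R r N,
  sink_seed w (right_face w l) s /\
  (seed_coord s (right_face w l))^-1 = Theta w (rev_ord l) (@X R r N).
Proof.
have rev (h : 'I_r.+1) : line (letter w) N h = (r - h)%N.
  by have := line_reversed h rw; rewrite size_tuple.
have [||v' E] := @braid_to_descent r w l; first by rewrite size_tuple.
  rewrite size_tuple; have := rev (widen_ord (leqnSn r) l); have := rev (lift ord0 l).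
  by rewrite /= /bump /= add1n => -> ->; have := ltn_ord l; lia.
have sz : size (rcons v' l) == N by rewrite -(braid_eq_size E) size_tuple.
pose v := Tuple sz.
have qlt : (size v' < N)%N by rewrite -(eqP sz) size_rcons.
pose q := Ordinal qlt; have qN : q.+1 = N by rewrite -[RHS](eqP sz) size_rcons.
have vq : tnth v q = l.
  by apply: val_inj; rewrite /= -letter_tnth /= letter_last.
have incv : increasing (letter v) N.
  have := @braid_eq_increasing _ _ _ E; rewrite size_tuple => /(_ inc).
  by rewrite (eqP sz).
have rv (h : 'I_r.+1) : line (letter v) N h = (r - h)%N.
  by have := braid_eq_line E h; rewrite size_tuple rev (eqP sz).
have [s [sigma [ss qs fs rs Ts]]] : exists s sigma, @transported R r N w v s sigma.
  apply: (@transported_braid_eq R r N w w v E inc); exists (seed0 R w), 1%g; exact: transported0.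
have ra : right_unbounded w (right_face w l).
  by rewrite /right_unbounded fend_right_face.
have [rsa la] := rs _ ra; rewrite level_right_face in la.
have sa : sigma (right_face w l) = inr q.
  rewrite (right_unboundedP rsa) la; apply: esym.
  by rewrite (right_unboundedP (last_right_unbounded v qN)) /= vq.
exists s; split; first by split=> // a; rewrite qs sa; apply: last_sink.
rewrite Ts -[in RHS]vq (Theta_last qN incv rv) /=.
by rewrite -sa permK.
Qed.

End RightFace.

(* cross_ok for winding numbers in place of truth values. *)
Definition zcross_ok (la lb : bool) (below left right above : int) : bool :=
  match la, lb with
  | true, true => [&& above <= right, right <= left & left <= below]
  | false, false => [&& below <= right, right <= left & left <= above]
  | true, false => [&& left <= above, left <= below, above <= right & below <= right]
  | false, true => false
  end.

Lemma zcross_okE la lb (below left right above : bool) :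
  zcross_ok la lb below left right above = cross_ok la lb below left right above.
Proof. by case: la; case: lb; case: below; case: left; case: right; case: above. Qed.

(** * Winding numbers of GP-paths *)

Section MaximumPrinciple.
Variables (u : nat -> nat) (la lb : nat -> bool) (N : nat) (V : nat -> nat -> int) (M : int).
Hypotheses (Vfar : forall j g, (j < N)%N -> g != (u j).+1 -> V j.+1 g = V j g)
  (Vcross : forall j, (j < N)%N -> zcross_ok (la j) (lb j)
    (V j (u j)) (V j (u j).+1) (V j.+1 (u j).+1) (V j (u j).+2))
  (V0 : forall g, V 0%N g = 0) (VN : forall g, V N g <= M).

Let neq1 m : m != m.+1. Proof. by rewrite neq_ltn ltnSn. Qed.
Let neq2 m : m.+2 != m.+1. Proof. by rewrite neq_ltn ltnSn orbT. Qed.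

Lemma max_principle t g : (t <= N)%N -> 0 <= V t g <= M.
Proof.
have lo s : (s <= N)%N -> forall h, 0 <= V s h.
  elim: s => [|s IH] sN h; first by rewrite V0.
  have [->|n] := eqVneq h (u s).+1; last by rewrite Vfar // IH // ltnW.
  have := Vcross sN; have := IH (ltnW sN) (u s); have := IH (ltnW sN) (u s).+2.
  case: (la s); case: (lb s) => //= h2 h0.
  - by case/and3P => a1 _ _; apply: le_trans a1.
  - by case/and4P => _ _ a1 _; apply: le_trans a1.
  - by case/and3P => a1 _ _; apply: le_trans a1.
have hi k s : (s + k = N)%N -> forall h, V s h <= M.
  elim: k s => [|k IH] s sk h; first by rewrite -[s]addn0 sk.
  have sN : (s < N)%N by rewrite -sk addnS ltnS leq_addr.
  have {}IH h' : V s.+1 h' <= M by apply: IH; rewrite addSnnS.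
  have [->|n] := eqVneq h (u s).+1; last by rewrite -Vfar.
  have := Vcross sN; have := IH (u s); have := IH (u s).+2; rewrite (Vfar sN (neq1 _)) (Vfar sN (neq2 _)).
  case: (la s); case: (lb s) => //= h2 h0.
  - by case/and3P => _ _ a1; apply: le_trans a1 _.
  - by case/and4P => a1 _ _ _; apply: le_trans a1 _.
  - by case/and3P => _ _ a1; apply: le_trans a1 _.
by move=> tN; rewrite lo // (hi (N - t)%N) // subnKC.
Qed.

End MaximumPrinciple.

Section Heights.
Variables (r N : nat) (w : N.-tuple 'I_r).
Let u := letter w.
Implicit Types (l a b : 'I_r.+1) (j : 'I_N).

Lemma height0 l : height w 0 l = l.
Proof. by rewrite /height take0 /wordperm big_nil perm1. Qed.

Lemma heightS j l : height w j.+1 l = swp (u j) (height w j l) :> nat.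
Proof.
rewrite /height (take_nth (tnth w j)) ?size_tuple // /wordperm -cats1 big_cat big_seq1 /=.
by rewrite permM val_simple_refl -tnth_nth /u letter_tnth.
Qed.

Lemma height_inj t : injective (height w t).
Proof. exact: perm_inj. Qed.

Lemma line_at t l : (t <= N)%N -> line u t (height w t l) = l.
Proof. by move=> tN; apply: line_height; rewrite size_tuple. Qed.

Lemma meetsE j l : Defs.meets w j l =
  (height w j l == u j :> nat) || (height w j l == (u j).+1 :> nat).
Proof. by rewrite /Defs.meets /u letter_tnth. Qed.

Lemma crossing_lines j : exists a b, [/\ height w j a = u j :> nat,
  height w j b = (u j).+1 :> nat, line u j (u j) = a & line u j (u j).+1 = b].
Proof.
have H (h : 'I_r.+1) : exists l, height w j l = h.
  by exists ((wordperm (take j w))^-1%g h); rewrite /height permKV.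
have [a ea] := H (widen_ord (leqnSn r) (tnth w j)).
have [b eb] := H (lift ord0 (tnth w j)).
have uj : u j = tnth w j by rewrite /u letter_tnth.
exists a, b; split; rewrite ?ea ?eb ?uj //.
  by have := line_at a (ltnW (ltn_ord j)); rewrite ea.
by have := line_at b (ltnW (ltn_ord j)); rewrite eb.
Qed.

Lemma height_far j l : ~~ Defs.meets w j l -> height w j.+1 l = height w j l :> nat.
Proof. by rewrite meetsE heightS /swp => /norP[/negPf-> /negPf->]. Qed.

(* Only the two crossing lines change their side with respect to a height. *)
Lemma height_ge j l g : g != (u j).+1 ->
  (g <= height w j.+1 l)%N = (g <= height w j l)%N.
Proof.
rewrite heightS /swp; move: (val (height w j l)) (u j) => h m.
by case: (h =P m) => ?; case: (h =P m.+1) => ?; lia.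
Qed.

End Heights.

(** Summation by parts along the path: each step pairs the entry term of its source with the exit
    term of its target. *)
Lemma path_sum (T : eqType) (e : rel T) (E X : T -> int) x q :
  (forall y z, e y z -> E y <= X z) -> path e x q ->
  \sum_(z <- x :: q) (E z - X z) <= E (last x q) - X x.
Proof.
move=> EX; elim: q x => [|y q IH] x; first by rewrite big_seq1.
rewrite /= big_cons => /andP[xy /IH h].
apply: le_trans (lerD (lexx _) h) _; have := EX _ _ xy; lia.
Qed.

Lemma path_sum_ends (T : eqType) (e : rel T) (E X : T -> int) x q :
  (forall y z, e y z -> X y = 0 /\ E z = 0) -> path e x q ->
  \sum_(z <- x :: q) (E z - X z) = E x - X (last x q).
Proof.
move=> EX; elim: q x => [|y q IH] x; first by rewrite big_seq1.
rewrite /= big_cons => /andP[xy /IH ->]; have [-> ->] := EX _ _ xy; lia.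
Qed.

Section Winding.
Variables (r N : nat) (w : N.-tuple 'I_r) (i : 'I_r).
Hypotheses (inc : increasing (letter w) N) (rw : wordperm w = longest r).
Let u := letter w.
Notation point := ('I_r.+1 * nat)%type.
Implicit Types (x y : point) (p q : seq point) (l : 'I_r.+1) (j : 'I_N).

Lemma height_end l : height w N l = (r - l)%N :> nat.
Proof. by rewrite /height take_oversize ?size_tuple // rw permE /= subSS. Qed.

Definition entry (j : nat) l : nat := if leftward i l then j.+1 else j.
Definition exit (j : nat) l : nat := if leftward i l then j else j.+1.

Lemma stepP x y : step w i x y -> exists j, [/\ x.2 = entry j x.1, y.2 = exit j y.1
  & if x.1 == y.1 then ~~ forbidden w i j x.1 else Defs.meets w j x.1 && Defs.meets w j y.1].
Proof. by case/existsP => j /and3P[/eqP e1 /eqP e2 h]; exists j. Qed.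

Definition sgn l : int := if leftward i l then 1 else -1.

(** The winding number around the face in gap g of slice t, taken on every slice and not only where
    the face starts, so that it can be followed through the crossings. *)
Definition wind p (t g : nat) : int :=
  \sum_(x <- p) (if (x.2 == t) && (g <= height w x.2 x.1)%N then sgn x.1 else 0).

Lemma winding_wind p F : winding w i p F = wind p (fstart F) (level w F).+1.
Proof.
rewrite /winding /wind; elim: p => [|x p IH]; first by rewrite big_nil.
rewrite big_cons -IH /= /sgn.
have -> : (x.2 == fstart F) && (level w F < height w x.2 x.1)%N =
  (x.2 == fstart F) && (level w F < height w (fstart F) x.1)%N by case: eqP => // ->.
move: (count _ p) (count _ p) => c1 c2.
by case: (x.2 == _); case: (level w F < _)%N; case: (leftward i x.1) => /=; lia.
Qed.

Let En j g x : int := (x.2 == entry j x.1) && (g <= height w x.2 x.1)%N.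
Let Ex j g x : int := (x.2 == exit j x.1) && (g <= height w x.2 x.1)%N.

Let wind_diff p j g : wind p j.+1 g - wind p j g = \sum_(x <- p) (En j g x - Ex j g x).
Proof.
rewrite /wind -sumrB; apply: eq_bigr => x _; rewrite /En /Ex /entry /exit /sgn.
case: x => l t /=; case: (leftward i l); case: (t == j); case: (t == j.+1).
all: by case: (g <= _)%N.
Qed.

Let entry_neq j j' l : j != j' -> (entry j' l == entry j l) = false.
Proof. by move=> /negPf n; rewrite /entry; case: ifP; rewrite ?eqSS eq_sym. Qed.

Let exit_neq j j' l : j != j' -> (exit j' l == exit j l) = false.
Proof. by move=> /negPf n; rewrite /exit; case: ifP; rewrite ?eqSS eq_sym. Qed.

Let far_side j g l t : g != (u j).+1 -> (t == j :> nat) || (t == j.+1) ->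
  (g <= height w t l)%N = (g <= height w j l)%N.
Proof. by move=> gn /orP[/eqP->|/eqP->] //; apply: height_ge. Qed.

Let entryP (j : nat) l : (entry j l == j) || (entry j l == j.+1).
Proof. by rewrite /entry; case: ifP; rewrite eqxx ?orbT. Qed.
Let exitP (j : nat) l : (exit j l == j) || (exit j l == j.+1).
Proof. by rewrite /exit; case: ifP; rewrite eqxx ?orbT. Qed.

Let far_meets j g l : g != (u j).+1 -> Defs.meets w j l ->
  (g <= height w j l)%N = (g <= u j)%N.
Proof. by rewrite meetsE => gn /orP[/eqP->|/eqP->] //; rewrite leq_eqVlt (negPf gn). Qed.

Let far_step j g x y : g != (u j).+1 -> step w i x y -> En j g x = Ex j g y.
Proof.
move=> gn /stepP[j' [e1 e2 h]]; rewrite /En /Ex e1 e2; move: h.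
have [<-|n] := eqVneq j j'; last by rewrite (entry_neq _ n) (exit_neq _ n).
rewrite !eqxx /= !(far_side _ gn) ?entryP ?exitP //.
case: eqP => [->//|_ /andP[m1 m2]].
by rewrite (far_meets gn m1) (far_meets gn m2).
Qed.

Variables (q : seq point).
Let x0 : point := (widen_ord (leqnSn r) i, N).
Let xN : point := (lift ord0 i, N).
Let p := x0 :: q.
Hypotheses (pq : path (step w i) x0 q) (lq : last x0 q = xN).

Let left0 : leftward i x0.1. Proof. by rewrite /leftward /=. Qed.
Let leftN : leftward i xN.1 = false. Proof. by rewrite /leftward /= /bump /= add1n ltnn. Qed.

Let En_last j g : En j g (last x0 q) = 0.
Proof. by rewrite lq /En /entry leftN (gtn_eqF (ltn_ord j)). Qed.
Let Ex_first j g : Ex j g x0 = 0.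
Proof. by rewrite /Ex /exit left0 (gtn_eqF (ltn_ord j)). Qed.

(** Away from the gap of the crossing, each step through the strip enters and leaves on the same
    side of gap g, so both inequalities of [path_sum] hold. *)
Lemma wind_far (j g : nat) : (j < N)%N -> g != (u j).+1 -> wind p j.+1 g = wind p j g.
Proof.
move=> jN gn; rewrite -[j]/(val (Ordinal jN)) in gn *; move: (Ordinal jN) gn => {jN}j gn.
have fs x y : step w i x y -> En j g x = Ex j g y := far_step gn.
have le := @path_sum _ (step w i) (En j g) (Ex j g) x0 q _ pq.
have ge := @path_sum _ (step w i) (fun z => - En j g z) (fun z => - Ex j g z) x0 q _ pq.
have {}le : \sum_(z <- p) (En j g z - Ex j g z) <= 0.
  by apply: (le_trans (le _)) => [x y /fs ->//|]; rewrite En_last Ex_first.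
have {}ge : \sum_(z <- p) - (En j g z - Ex j g z) <= 0.
  rewrite (eq_bigr (fun z => - En j g z - - Ex j g z)); last by move=> z _; lia.
  by apply: (le_trans (ge _)) => [x y /fs ->//|]; rewrite En_last Ex_first.
move: ge le; rewrite sumrN -!wind_diff; move: (wind _ _ _) (wind _ _ _) => a b; lia.
Qed.

(** When both lines point the same way, a straight passage could increase the winding number from
    left to right only along the line for which rigour forbids it. *)
Lemma wind_turn (j : 'I_N) a b : height w j a = u j :> nat -> height w j b = (u j).+1 :> nat ->
  (a < b)%N -> leftward i a = leftward i b -> wind p j.+1 (u j).+1 <= wind p j (u j).+1.
Proof.
move=> ha hb ab lab; rewrite -subr_le0 wind_diff.
have ma : Defs.meets w j a by rewrite meetsE ha eqxx.
have mb : Defs.meets w j b by rewrite meetsE hb eqxx orbT.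
have ha' : height w j.+1 a = (u j).+1 :> nat by rewrite heightS ha swpL.
have hb' : height w j.+1 b = u j :> nat by rewrite heightS hb swpR.
have nab : a != b by rewrite -val_eqE /= neq_ltn ab.
have mab l : Defs.meets w j l -> l = a \/ l = b.
  rewrite meetsE => /orP[] /eqP h; [left|right]; apply: (@height_inj _ _ w j).
    by apply: val_inj; rewrite /= h ha.
  by apply: val_inj; rewrite /= h hb.
have fa : leftward i a -> forbidden w i j a.
  move=> la; rewrite /forbidden ma; apply/existsP; exists b.
  by rewrite eq_sym nab mb ab la -lab la.
have fb : ~~ leftward i b -> forbidden w i j b.
  move=> lb; rewrite /forbidden mb; apply/existsP; exists a.
  by rewrite nab ma ab lb lab lb orbT.
have := @path_sum _ (step w i) (En j (u j).+1) (Ex j (u j).+1) x0 q _ pq.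
rewrite En_last Ex_first subr0; apply=> x y /stepP[j' [e1 e2 h]]; rewrite /En /Ex e1 e2.
have [ej|n] := eqVneq j j'; last first.
  by rewrite (entry_neq _ n) (exit_neq _ n).
move: h; rewrite -ej !eqxx /=; case: eqP => [->|nxy /andP[/mab h1 /mab h2]].
  case my: (Defs.meets w j y.1); last first.
    rewrite (_ : (height w (entry _ _) _ : nat) = height w (exit j y.1) y.1) //.
    have E := height_far (negbT my).
    by rewrite /entry /exit; case: ifP => _; rewrite E.
  have [->|->] := mab _ my.
    rewrite /entry /exit; case la: (leftward i a); first by rewrite fa.
    by rewrite ha ltnn.
  rewrite /entry /exit; case lb: (leftward i b); first by rewrite hb' ltnn.
  by rewrite fb ?lb.
case: h1 h2 nxy => -> [] -> // _; rewrite /entry /exit ?lab.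
  by case: (leftward i b); rewrite ?ha ?hb ?ha' ?hb' ?ltnn ?ltnSn //; case: (_ < _)%N.
by case: (leftward i b); rewrite ?ha ?hb ?ha' ?hb' ?ltnn ?ltnSn //; case: (_ < _)%N.
Qed.

End Winding.

Section PathsAdmissible.
Variables (r N : nat) (w : N.-tuple 'I_r) (i : 'I_r).
Hypotheses (inc : increasing (letter w) N) (rw : wordperm w = longest r).
Let u := letter w.
Notation point := ('I_r.+1 * nat)%type.
Let x0 : point := (widen_ord (leqnSn r) i, N).
Let xN : point := (lift ord0 i, N).

Let left0 : leftward i x0.1. Proof. by rewrite /leftward /=. Qed.
Let leftN : leftward i xN.1 = false. Proof. by rewrite /leftward /= /bump /= add1n ltnn. Qed.

Lemma gp_pathP p : gp_path w i p ->
  exists q, [/\ p = x0 :: q, path (step w i) x0 q & last x0 q = xN].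
Proof. by case: p => //= x q /and3P[/eqP-> pq /eqP lq]; exists q. Qed.

Lemma wind_sign p t g l : height w t l = g :> nat ->
  if leftward i l then wind w i p t g.+1 <= wind w i p t g
  else wind w i p t g <= wind w i p t g.+1.
Proof.
move=> hl; case L: (leftward i l); apply: ler_sum => x _; case: eqP => //= ->.
all: rewrite [(g <= _)%N]leq_eqVlt; case: eqP => [e|_] //=.
all: have -> : x.1 = l by apply: (@height_inj _ _ w t); apply: val_inj; rewrite /= -e hl.
all: by rewrite -hl ltnn /sgn L.
Qed.

Lemma line_height_at (a : 'I_r.+1) t h : (t <= N)%N -> height w t a = h :> nat ->
  line u t h = a.
Proof. by move=> tN <-; apply: line_at. Qed.

Section OnePath.
Variable q : seq point.
Let p := x0 :: q.
Hypotheses (pq : path (step w i) x0 q) (lq : last x0 q = xN).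
Let W := wind w i p.

Lemma wind_zcross j : (j < N)%N ->
  zcross_ok (line u j (u j) <= i)%N (line u j (u j).+1 <= i)%N
    (W j (u j)) (W j (u j).+1) (W j.+1 (u j).+1) (W j (u j).+2).
Proof.
move=> jN; have [a [b [ha hb la lb]]] := crossing_lines w (Ordinal jN).
rewrite /= in ha hb la lb; have ab : (a < b)%N.
  by have := inc jN; rewrite -/u la lb.
have ha' : height w j.+1 a = (u j).+1 :> nat by rewrite (heightS w (Ordinal jN)) ha swpL.
have hb' : height w j.+1 b = u j :> nat by rewrite (heightS w (Ordinal jN)) hb swpR.
have far g : g != (u j).+1 -> W j.+1 g = W j g := wind_far pq lq jN.
have s1 := wind_sign p ha; have s2 := wind_sign p hb.
have s3 := wind_sign p ha'; have s4 := wind_sign p hb'.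
have turn := @wind_turn _ _ _ _ _ pq lq (Ordinal jN) a b ha hb ab.
rewrite /= -/p -/W -/u in turn s1 s2 s3 s4.
have f0 : W j.+1 (u j) = W j (u j) by apply: far; rewrite neq_ltn ltnSn.
have f2 : W j.+1 (u j).+2 = W j (u j).+2 by apply: far; rewrite neq_ltn ltnSn orbT.
rewrite f0 in s4; rewrite f2 in s3.
rewrite la lb -!/(leftward i _).
move: s1 s2 s3 s4 turn; case A: (leftward i a); case B: (leftward i b) => /=.
- by move=> *; apply/and3P; split; auto.
- by move=> *; apply/and4P; split; auto.
- by move: A B; rewrite /leftward; lia.
- by move=> *; apply/and3P; split; auto.
Qed.

(** The path never visits slice 0: a leftward line could not be left there, and a rightward line
    could not have been reached. *)
Lemma wind_start g : W 0 g = 0.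
Proof.
have H x s : path (step w i) x s -> leftward i (last x s).1 = false -> (0 < N)%N ->
    (last x s).2 = N -> (~~ leftward i x.1 -> (0 < x.2)%N) -> forall z, z \in x :: s -> (0 < z.2)%N.
  elim: s x => [|y s IH] x /=.
    by move=> _ lx N0 xN' _ z; rewrite inE => /eqP ->; rewrite xN'.
  move=> /andP[/stepP[j [e1 e2 _]] ys] ls N0 sN xl z; rewrite inE => /orP[/eqP->|].
    case L: (leftward i x.1); last by apply: xl; rewrite L.
    by rewrite e1 /entry L.
  by apply: (IH y) => // yl; rewrite e2 /exit (negPf yl).
have N0 : (0 < N)%N.
  have E t : t = 0%N -> height w t ord0 = ord0 by move=> ->; apply: height0.
  rewrite lt0n; apply/negP => /eqP N0; have := height_end rw ord0.
  by rewrite (E _ N0) /= subn0; have := ltn_ord i; lia.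
rewrite /W /wind big_seq big1 // => z zp.
have := H x0 q pq; rewrite lq leftN => /(_ erefl N0 erefl); rewrite left0 => /(_ (fun h => False_ind _ (notF h)) z zp).
by case: z.2.
Qed.

Lemma wind_end g : W N g = (g == (r - i)%N).
Proof.
pose E (x : point) : int := [&& x.2 == N, leftward i x.1 & (g <= height w x.2 x.1)%N].
pose X (x : point) : int := [&& x.2 == N, ~~ leftward i x.1 & (g <= height w x.2 x.1)%N].
have -> : W N g = \sum_(x <- p) (E x - X x).
  apply: eq_bigr => x _; rewrite /E /X /sgn.
  by case: (x.2 == N); case: (leftward i x.1); case: (g <= _)%N.
rewrite /p (path_sum_ends (e := step w i)) // => [|y z /stepP[j [e1 e2 _]]].
  rewrite lq /E /X left0 leftN !eqxx /= !(height_end rw) /= /bump /= add1n.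
  have := ltn_ord i; lia.
rewrite /X /E e1 e2 /entry /exit; case: (leftward i y.1); case: (leftward i z.1) => /=.
all: by rewrite ?(ltn_eqF (ltn_ord j)) ?andbF.
Qed.

(** The winding numbers vanish on the first slice and are 0 or 1 on the last one, so the maximum
    principle bounds all of them. Hence [enclosed] loses no information. *)
Lemma wind_bounds t g : (t <= N)%N -> 0 <= W t g <= 1.
Proof.
move=> tN; apply: (max_principle (u := u) (N := N)
    (la := fun j => (line u j (u j) <= i)%N)
    (lb := fun j => (line u j (u j).+1 <= i)%N)) => //.
- by move=> j h jN hn; exact: (wind_far pq lq jN hn).
- exact: wind_zcross.
- exact: wind_start.
by move=> h; rewrite wind_end; case: (_ == _).
Qed.

Definition path_phi : {ffun 'I_N -> bool} := [ffun j => enclosed w i p (inr j)].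

Lemma wind_gap t g : (t <= N)%N -> W t g = gap u (ext path_phi) t g.
Proof.
elim: t g => [|t IH] g tN; first by rewrite wind_start.
rewrite /=; case: eqP => [->|/eqP gn]; last first.
  by rewrite -IH ?(ltnW tN) //; exact: (wind_far pq lq tN gn).
rewrite -[t in ext _ t]/(val (Ordinal tN)) ext_ord ffunE /enclosed winding_wind /=.
rewrite -letter_tnth /=; have := wind_bounds (u t).+1 tN; rewrite -/u -/W.
by case: (W _ _) => // -[|[]].
Qed.

Lemma path_adm : adm w i path_phi.
Proof.
apply/andP; split.
  apply/forallP => j; have := wind_zcross (ltn_ord j).
  rewrite !wind_gap ?(ltnW (ltn_ord j)) // zcross_okE /crossing_ok -/u.
  by rewrite [gap _ _ j.+1 _]/= eqxx.
apply/forallP => h; have := wind_end h; rewrite wind_gap // -/u.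
by case: (gap _ _ _ _); case: (_ == _).
Qed.

End OnePath.
End PathsAdmissible.

(* The difference of two admissible families, the second of which follows
   strands of the first. *)
Lemma zcross_sub (la lb b l r a b' l' r' a' : bool) :
  cross_ok la lb b l r a -> cross_ok la lb b' l' r' a' ->
  (b' != l') ==> (b != l) -> (l' != a') ==> (l != a) ->
  (r' != a') ==> (r != a) -> (b' != r') ==> (b != r) ->
  zcross_ok la lb (b%:Z - b'%:Z) (l%:Z - l'%:Z) (r%:Z - r'%:Z) (a%:Z - a'%:Z).
Proof. by move: la lb b l r a b' l' r' a'; do 10!case. Qed.

(** * Tracing the boundary of an admissible set *)

Section Tracing.
Variables (r N : nat) (w : N.-tuple 'I_r) (i : 'I_r).
Hypotheses (inc : increasing (letter w) N) (rw : wordperm w = longest r).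
Let u := letter w.
Notation point := ('I_r.+1 * nat)%type.
Let x0 : point := (widen_ord (leqnSn r) i, N).
Let xN : point := (lift ord0 i, N).
Variable phi : {ffun 'I_N -> bool}.
Hypothesis ad : adm w i phi.
Let G := gap u (ext phi).

Let crossG j : (j < N)%N -> crossing_ok i u (ext phi) j.
Proof. by move=> jN; have /andP[/forallP c _] := ad; apply: (c (Ordinal jN)). Qed.

Let endG (h : nat) : (h < r.+2)%N -> G N h = (h == (r - i)%N).
Proof. by move=> hr; have /andP[_ /forallP c] := ad; have /eqP := c (Ordinal hr). Qed.

Definition active (x : point) : bool :=
  G x.2 (height w x.2 x.1) != G x.2 (height w x.2 x.1).+1.

Let GS j : (j < N)%N -> G j.+1 (u j).+1 = ext phi j.
Proof. by move=> jN; rewrite /G /= eqxx. Qed.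

Let GE j g : g != (u j).+1 -> G j.+1 g = G j g.
Proof. by rewrite /G /= => /negPf ->. Qed.

Let active_far (j : 'I_N) l : ~~ Defs.meets w j l -> active (l, j.+1) = active (l, j : nat).
Proof.
move=> m; have e := height_far m; move: m; rewrite meetsE => /norP[n0 n1].
by rewrite /active /= e !GE // eqSS.
Qed.

Let strands (j : 'I_N) : exists a b, [/\ forall l, Defs.meets w j l = (l == a) || (l == b),
  cross_ok (leftward i a) (leftward i b)
    (G j (u j)) (G j (u j).+1) (G j.+1 (u j).+1) (G j (u j).+2), (a < b)%N &
  [/\ active (a, j : nat) = (G j (u j) != G j (u j).+1),
      active (b, j : nat) = (G j (u j).+1 != G j (u j).+2),
      active (a, j.+1) = (G j.+1 (u j).+1 != G j (u j).+2)
    & active (b, j.+1) = (G j (u j) != G j.+1 (u j).+1)]].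
Proof.
have [a [b [ha hb la lb]]] := crossing_lines w j.
have ha' : height w j.+1 a = (u j).+1 :> nat by rewrite heightS ha swpL.
have hb' : height w j.+1 b = u j :> nat by rewrite heightS hb swpR.
have f0 : G j.+1 (u j) = G j (u j) by apply: GE; rewrite neq_ltn ltnSn.
have f2 : G j.+1 (u j).+2 = G j (u j).+2 by apply: GE; rewrite neq_ltn ltnSn orbT.
exists a, b; split.
- move=> l; rewrite meetsE -hb -ha.
  by congr (_ || _); rewrite -[RHS](inj_eq (@height_inj _ _ w j)).
- have := crossG (ltn_ord j); rewrite /crossing_ok la lb GS ?ltn_ord //.
- by have := inc (ltn_ord j); rewrite la lb.
by rewrite /active /= ha hb ha' hb' f0 f2.
Qed.

(** The admissible marks around a crossing never make both crossing lines boundary strands on their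
    incoming sides. This makes the successor map below injective. *)
Let unique_entry (j : 'I_N) l l' : Defs.meets w j l -> Defs.meets w j l' ->
  active (l, entry i j l) -> active (l', entry i j l') -> l = l'.
Proof.
have [a [b [mE c ab [a0 b0 a1 b1]]]] := strands j.
have na : ~~ (active (a, entry i j a) && active (b, entry i j b)).
  move: c a0 b0 a1 b1; rewrite /entry; case: (leftward i a); case: (leftward i b) => /= c a0 b0 a1 b1; rewrite ?a0 ?b0 ?a1 ?b1;
    by move: (G j (u j)) (G j (u j).+1) (G j.+1 (u j).+1) (G j (u j).+2) c => [] [] [] [].
rewrite !mE => /orP[]/eqP-> /orP[]/eqP-> // h h'; case/negP: na; by rewrite h h'.
Qed.

(** An active strand entering a crossing has an active continuation, and the condition that right
    implies left ensures that a nonforbidden one exists. *)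
Let next_exit (j : 'I_N) l : active (l, entry i j l) -> exists l',
  active (l', exit i j l') /\
  if l == l' then ~~ forbidden w i j l else Defs.meets w j l && Defs.meets w j l'.
Proof.
move=> al; case m: (Defs.meets w j l); last first.
  exists l; rewrite eqxx /forbidden m; split=> //; have := active_far (negbT m).
  by move: al; rewrite /entry /exit; case: ifP => _ al; [move=> <- | move=> ->].
have [a [b [mE c ab [a0 b0 a1 b1]]]] := strands j.
have nab : a != b by rewrite -val_eqE /= neq_ltn ab.
have ma : Defs.meets w j a by rewrite mE eqxx.
have mb : Defs.meets w j b by rewrite mE eqxx orbT.
have fa : forbidden w i j a -> leftward i a && leftward i b.
  case/andP => _ /existsP[l' /and3P[n m' h]]; move: m'; rewrite mE (negPf n) /= => /eqP e.
  by move: h; rewrite e ab ltnNge (ltnW ab) /= orbF.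
have fb : forbidden w i j b -> ~~ leftward i a && ~~ leftward i b.
  case/andP => _ /existsP[l' /and3P[n m' h]]; move: m'; rewrite mE (negPf n) orbF => /eqP e.
  by move: h; rewrite e ab [(b < a)%N]ltnNge (ltnW ab) /= andbC.
have ex : active (l, entry i j l) ->
  (active (a, exit i j a) && ((l == a) ==> ~~ forbidden w i j a)) ||
  (active (b, exit i j b) && ((l == b) ==> ~~ forbidden w i j b)).
  move: m; rewrite mE => /orP[]/eqP->; rewrite ?eqxx ?(negPf nab) ?[b == a]eq_sym ?(negPf nab).
    have -> : ~~ forbidden w i j a = ~~ (leftward i a && leftward i b) || ~~ forbidden w i j a.
      by case F: (forbidden w i j a); rewrite ?orbT // (fa F).
    move: c a0 b0 a1 b1; rewrite /entry /exit; case: (leftward i a); case: (leftward i b) => /= c a0 b0 a1 b1; rewrite ?a0 ?b0 ?a1 ?b1;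
    by move: (G j (u j)) (G j (u j).+1) (G j.+1 (u j).+1) (G j (u j).+2) c => [] [] [] [].
  have -> : ~~ forbidden w i j b = ~~ (~~ leftward i a && ~~ leftward i b) || ~~ forbidden w i j b.
    by case F: (forbidden w i j b); rewrite ?orbT // (fb F).
  move: c a0 b0 a1 b1; rewrite /entry /exit; case: (leftward i a); case: (leftward i b) => /= c a0 b0 a1 b1; rewrite ?a0 ?b0 ?a1 ?b1;
    by move: (G j (u j)) (G j (u j).+1) (G j.+1 (u j).+1) (G j (u j).+2) c => [] [] [] [].
case/orP: (ex al) => /andP[h1 h2]; [exists a | exists b]; rewrite ?ma ?mb; split=> //.
  by move: h2; case: eqP => //= ->.
by move: h2; case: eqP => //= ->.
Qed.

Let T : finType := ('I_r.+1 * 'I_N.+1)%type.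
Let pt (z : T) : point := (z.1, val z.2).
Let z0 : T := (widen_ord (leqnSn r) i, ord_max).
Let zN : T := (lift ord0 i, ord_max).

Let pt_inj : injective pt.
Proof. by move=> [l t] [l' t'] [-> /val_inj ->]. Qed.

Let act0 : active x0.
Proof.
by rewrite /active /= (height_end rw) /= !endG; have := ltn_ord i; lia.
Qed.

Let left0 : leftward i x0.1. Proof. by rewrite /leftward /=. Qed.

Let act_right l : active (l, N) -> ~~ leftward i l -> l = lift ord0 i.
Proof.
rewrite /active /= (height_end rw) /= => h L; apply: val_inj; rewrite /= /bump /= add1n.
have e1 : G N (r - l) = (r - l == r - i)%N by apply: endG; lia.
have e2 : G N (r - l).+1 = ((r - l).+1 == r - i)%N by apply: endG; lia.
have lr := ltn_ord l; have ir := ltn_ord i.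
by move: h L; rewrite e1 e2 /leftward; clear e1 e2; lia.
Qed.

Let succ z : active (pt z) -> z != zN ->
  exists z', active (pt z') && step w i (pt z) (pt z').
Proof.
case: z => l t az nz; rewrite /pt /= in az *.
have [j tj] : exists j : 'I_N, t = entry i j l :> nat.
  rewrite /entry; case L: (leftward i l).
    case: (posnP t) => [t0|tp]; first by move: az; rewrite t0 /active /= /G /=.
    have tN : (t.-1 < N)%N by have := ltn_ord t; lia.
    by exists (Ordinal tN); rewrite /= prednK.
  have [tN|tN] := ltnP t N; first by exists (Ordinal tN).
  have tE : t = N :> nat by have := ltn_ord t; lia.
  rewrite tE in az; case/eqP: nz; congr (_, _); first by apply: act_right az _; rewrite L.
  exact: val_inj.
rewrite tj in az *; have [l' [al' h]] := next_exit az.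
have eN : (exit i j l' < N.+1)%N.
  by have := ltn_ord j; rewrite /exit; case: ifP => _; lia.
exists (l', Ordinal eN); rewrite /= al' /=; apply/existsP; exists j.
by rewrite /= !eqxx.
Qed.

Let pred_unique x y z : active x -> active y -> step w i x z -> step w i y z -> x = y.
Proof.
case: x => l t; case: y => l' t'; case: z => l'' t'' ax ay.
move=> /stepP[j /= [e1 e2 h]] /stepP[j' /= [e1' e2' h']].
have jj : j = j' by apply: val_inj; move: e2'; rewrite e2 /exit; case: ifP => _ // -[].
rewrite -{j'}jj in e1' e2' h'; rewrite e1 in ax; rewrite e1' in ay; rewrite e1 e1'.
have [->//|n] := eqVneq l l'; suff -> : l = l' by [].
have [m m'] : Defs.meets w j l /\ Defs.meets w j l'.
  move: h h'; case: eqP => [<-|_]; last case: eqP => [<-|_].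
  - by rewrite eq_sym (negPf n) => _ /andP[-> ->].
  - by move=> /andP[-> ->].
  - by move=> /andP[-> _] /andP[-> _].
exact: unique_entry m m' ax ay.
Qed.

Let no_pred x : ~~ step w i x x0.
Proof.
apply/negP => /stepP[j [_ e _]]; move: e; rewrite /exit left0 /= => e.
by have := ltn_ord j; rewrite -[X in (X < _)%N]e ltnn.
Qed.

(** The successor along the boundary, closed up by sending the end point back to the start, with
    inactive points fixed. It is an injective self-map of a finite set, hence a permutation. *)
Let f (z : T) : T :=
  if ~~ active (pt z) then z else if z == zN then z0
  else odflt z [pick z' | active (pt z') && step w i (pt z) (pt z')].

Let f_act z : active (pt z) -> z != zN -> active (pt (f z)) && step w i (pt z) (pt (f z)).
Proof.
move=> az nz; rewrite /f az (negPf nz) /=; case: pickP => [//|no].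
by have [z'] := succ az nz; rewrite no.
Qed.

Let f_inactive z : ~~ active (pt z) -> f z = z.
Proof. by rewrite /f => ->. Qed.

Let f_end : active (pt zN) -> f zN = z0.
Proof. by rewrite /f => ->; rewrite eqxx. Qed.

Let act_f z : active (pt z) -> active (pt (f z)).
Proof.
move=> az; have [e|n] := eqVneq z zN; last by case/andP: (f_act az n).
by rewrite e f_end ?act0 // -e.
Qed.

Let f_inj : injective f.
Proof.
move=> y z fyz; case ay: (active (pt y)); last first.
  case az: (active (pt z)); last by rewrite -(f_inactive (negbT ay)) fyz f_inactive ?az.
  by have := act_f az; rewrite -fyz f_inactive ay.
case az: (active (pt z)); last first.
  by have := act_f ay; rewrite fyz f_inactive az.
have stp y' : active (pt y') -> f y' = z0 -> y' = zN.
  move=> ay' e; apply/eqP; apply: contraT => n; have /andP[_] := f_act ay' n.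
  by rewrite e (negPf (no_pred _)).
have [yN|yN] := eqVneq y zN.
  by rewrite yN; apply/esym/stp => //; rewrite -fyz yN f_end // -yN.
have [zN'|zN'] := eqVneq z zN.
  by rewrite zN'; apply: stp => //; rewrite fyz zN' f_end // -zN'.
have /andP[_ s1] := f_act ay yN; have /andP[_ s2] := f_act az zN'.
by apply: pt_inj; rewrite fyz in s1; apply: pred_unique s1 s2.
Qed.

(** The starting point has no predecessor along a step, so its preimage under the permutation [f] is
    the end point, which therefore lies on its orbit. *)
Let reach : fconnect f z0 zN.
Proof.
have az0 : active (pt z0) := act0.
have fy : f (finv f z0) = z0 := f_finv f_inj z0.
suff <- : finv f z0 = zN by apply: fconnect_finv.
have ay : active (pt (finv f z0)).
  by apply: contraT => na; have e := f_inactive na; move: na; rewrite -e fy az0.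
apply/eqP; apply: contraT => n; have /andP[_] := f_act ay n.
by rewrite fy (negPf (no_pred _)).
Qed.

Let trace z m : active (pt z) -> (forall k, (k < m)%N -> iter k f z != zN) ->
  [/\ path (step w i) (pt z) (map pt (traject f (f z) m)),
      last (pt z) (map pt (traject f (f z) m)) = pt (iter m f z)
    & all active (map pt (traject f (f z) m))].
Proof.
elim: m z => [//|m IH] z az nz; have /andP[a1 s1] := f_act az (nz 0%N isT).
have [k km|h1 h2 h3] := IH (f z) a1; first by have := nz k.+1 km; rewrite iterSr.
by split; [rewrite /= s1 | rewrite [LHS]/= h2 iterSr | rewrite /= a1].
Qed.

Lemma gp_path_exists : exists2 q, gp_path w i (x0 :: q) & all active (x0 :: q).
Proof.
have e := iter_findex reach; set m := findex f z0 zN in e.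
have [|h1 h2 h3] := @trace z0 m act0.
  move=> k km; apply/negP => /eqP ek.
  have := findex_iter (f := f) (x := z0) (i := k) (ltn_trans km (findex_max reach)).
  by rewrite ek -/m => mk; move: km; rewrite -[k in (k < _)%N]mk ltnn.
exists (map pt (traject f (f z0) m)); first by rewrite /= eqxx h1 h2 e /=; apply/eqP.
by rewrite /= h3 andbT; apply: act0.
Qed.

End Tracing.

Section EnclosedRegions.
Variables (r N : nat) (w : N.-tuple 'I_r) (i : 'I_r).
Hypotheses (inc : increasing (letter w) N) (rw : wordperm w = longest r).
Let u := letter w.
Notation point := ('I_r.+1 * nat)%type.
Let x0 : point := (widen_ord (leqnSn r) i, N).

Lemma wind_support p (x : point) : x \notin p ->
  wind w i p x.2 (height w x.2 x.1) = wind w i p x.2 (height w x.2 x.1).+1.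
Proof.
case: x => l t /= xp; rewrite /wind; apply: eq_big_seq => y yp.
case: eqP => //= yt; rewrite yt [(height w t l <= _)%N]leq_eqVlt; case: eqP => //= e.
have yl : y.1 = l by apply: (@height_inj _ _ w t); apply: val_inj; rewrite /= e.
by case/negP: xp; rewrite -yl -yt -surjective_pairing.
Qed.

(** A traced path might bound only part of the given set. But its boundary is part of that of phi,
    so the difference of the two families of marks satisfies the maximum principle ([zcross_sub]);
    it vanishes on the first and on the last slice, hence everywhere. *)
Lemma adm_path phi : adm w i phi ->
  exists2 q, gp_path w i (x0 :: q) & path_phi w i q = phi.
Proof.
move=> ad; have [q gq act] := gp_path_exists inc rw ad; exists q => //.
have [_ [[<-] pq lq]] := gp_pathP gq.
set psi := path_phi w i q.
have ad' : adm w i psi by apply: path_adm.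
pose G := gap u (ext phi); pose G' := gap u (ext psi).
have WG t g : (t <= N)%N -> wind w i (x0 :: q) t g = G' t g.
  by move=> tN; apply: wind_gap.
pose V t g : int := (G t g)%:Z - (G' t g)%:Z.
have le1 l t h : (t <= N)%N -> height w t l = h :> nat ->
    (G' t h != G' t h.+1) ==> (G t h != G t h.+1).
  move=> tN hl; apply/implyP => ne; have xp : (l, t) \in x0 :: q.
    apply: contraT => /wind_support; rewrite !WG // hl => e; move: ne.
    by move: e; case: (G' _ _); case: (G' _ _).
  by have := allP act _ xp; rewrite /active /= hl.
have V0 t g : (t <= N)%N -> 0 <= V t g <= 0.
  move=> tN; apply: (max_principle (u := u) (N := N)
    (la := fun j => (line u j (u j) <= i)%N) (lb := fun j => (line u j (u j).+1 <= i)%N)) => //.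
  - by move=> j h jN hn; rewrite /V /G /G' /= (negPf hn).
  - move=> j jN; have [a [b [ha hb la lb]]] := crossing_lines w (Ordinal jN).
    rewrite /= in ha hb la lb.
    have ha' : height w j.+1 a = (u j).+1 :> nat by rewrite (heightS w (Ordinal jN)) ha swpL.
    have hb' : height w j.+1 b = u j :> nat by rewrite (heightS w (Ordinal jN)) hb swpR.
    have c : crossing_ok i u (ext phi) j by have /andP[/forallP c _] := ad; apply: (c (Ordinal jN)).
    have c' : crossing_ok i u (ext psi) j by have /andP[/forallP c' _] := ad'; apply: (c' (Ordinal jN)).
    have GS : G j.+1 (u j).+1 = ext phi j by rewrite /G /= eqxx.
    have GS' : G' j.+1 (u j).+1 = ext psi j by rewrite /G' /= eqxx.
    have far P k : k != (u j).+1 -> gap u P j.+1 k = gap u P j k by rewrite /= => /negPf ->.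
    have f0 P : gap u P j.+1 (u j) = gap u P j (u j) by rewrite far // neq_ltn ltnSn.
    have f2 P : gap u P j.+1 (u j).+2 = gap u P j (u j).+2.
      by rewrite far // neq_ltn ltnSn orbT.
    rewrite /V GS GS' /G /G'; rewrite /crossing_ok in c c'; apply: (zcross_sub c c').
    + exact: le1 (ltnW jN) ha.
    + exact: le1 (ltnW jN) hb.
    + by have := le1 _ _ _ jN ha'; rewrite GS GS' /G /G' !f2.
    + by have := le1 _ _ _ jN hb'; rewrite GS GS' /G /G' !f0.
  - move=> h; rewrite /V; have [hr|hr] := ltnP h r.+2.
      have /andP[_ /forallP c] := ad; have /andP[_ /forallP c'] := ad'.
      have /eqP e := c (Ordinal hr); have /eqP e' := c' (Ordinal hr).
      by rewrite /G /G' e e' subrr.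
    have E P : gap u P N h = false.
      case: (h) hr => // h' hr; apply: gap_none => s sN.
      by rewrite -[s]/(val (Ordinal sN)) /u letter_tnth; have := ltn_ord (tnth w (Ordinal sN)); lia.
    by rewrite /G /G' !E.
apply/ffunP => j; have := V0 j.+1 (u j).+1 (ltn_ord j).
rewrite /V /G /G' /= eqxx !ext_ord.
by case: (phi j); case: (psi j).
Qed.

Definition e_adm (phi : {ffun 'I_N -> bool}) : {ffun face r N -> int} :=
  - \sum_(j | phi j) e (inr j).

Lemma e_pathE q : gp_path w i (x0 :: q) -> e_path w i (x0 :: q) = e_adm (path_phi w i q).
Proof.
move=> gq; have [_ [[<-] pq lq]] := gp_pathP gq; rewrite /e_path /e_adm; congr (- _).
rewrite big_sumType /= big_pred0 ?add0r.
  by apply: eq_bigl => j; rewrite ffunE.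
move=> l; rewrite /enclosed winding_wind /=.
by rewrite (wind_start rw pq lq) eqxx.
Qed.

Lemma e_path_adm (x : {ffun face r N -> int} -> Prop) :
  (forall p, gp_path w i p -> x (e_path w i p)) <-> (forall phi, adm w i phi -> x (e_adm phi)).
Proof.
split=> H => [phi /adm_path[q gq <-]|p gp].
  by rewrite -e_pathE //; apply: H.
have [q [pE pq lq]] := gp_pathP gp; rewrite pE in gp *.
by rewrite e_pathE //; apply/H/path_adm.
Qed.

End EnclosedRegions.

Lemma rep_eq0 (K : numFieldType) (I : finType) (F : (I -> K) -> K) :
  rep 0 F -> forall x, cpos x -> F x = 0.
Proof.
move=> [P [Q [Q0 /esym/eqP zE FE]]] x px.
have p1 : cpos (fun a : I => 1 : K) by move=> a; apply: ltr01.
have tQ : tofrac Q != 0 :> {fraction (mpoly #|I| K)}.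
  by rewrite tofrac_eq0; apply: contraNneq (Q0 _ p1) => ->; rewrite /mev meval0.
move: zE; rewrite mulf_eq0 invr_eq0 (negPf tQ) orbF tofrac_eq0 => /eqP P0.
by rewrite FE // P0 /mev meval0 mul0r.
Qed.

(** * Tropicalization of sums of monomials *)

Section Monomials.
Variables (R : realType) (r N : nat).
Local Notation exponent := {ffun face r N -> int}.
Local Notation Xf := (@X R r N).
Implicit Types (u : exponent) (s : seq exponent).

Lemma X_neq0 F : Xf F != 0.
Proof.
by apply: rep_neq0 (rep_coord _ F) _ => x px; rewrite gt_eqF.
Qed.

Definition monomial u : ratfun R r N := \prod_F Xf F ^ u F.

Lemma monomialD u v : monomial (u + v) = monomial u * monomial v.
Proof.
rewrite /monomial -big_split; apply: eq_bigr => F _.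
by rewrite ffunE expfzDr ?X_neq0.
Qed.

Lemma monomial0 : monomial 0 = 1.
Proof. by rewrite /monomial big1 // => F _; rewrite ffunE expr0z. Qed.

Lemma monomialN u : monomial (- u) = (monomial u)^-1.
Proof.
rewrite /monomial -prodfV; apply: eq_bigr => F _.
by rewrite ffunE invr_expz.
Qed.

Lemma monomial_e F : monomial (e F) = Xf F.
Proof.
rewrite /monomial (bigD1 F) //= ffunE eqxx expr1z big1 ?mulr1 // => G GF.
by rewrite ffunE (negPf GF) expr0z.
Qed.

Lemma monomial_sum (T : Type) (l : seq T) (P : pred T) (F : T -> face r N) :
  monomial (\sum_(t <- l | P t) e (F t)) = \prod_(t <- l | P t) Xf (F t).
Proof.
rewrite (big_morph monomial monomialD monomial0).
by apply: eq_bigr => t _; apply: monomial_e.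
Qed.

Lemma rep_monomial u : rep (monomial u) (lmono u).
Proof.
have H F : rep (Xf F ^ u F) (fun x : face r N -> R[i] => x F ^ u F).
  by apply: rep_exprz (rep_coord _ F) => x px; rewrite gt_eqF.
exact: (rep_prod _ H).
Qed.

Lemma trop_ge0 (g : laurent R r N) x :
  (0 <= trop g x)%E <-> forall u, u \in finsupp g -> 0 <= dot x u.
Proof.
rewrite /trop; have -> : (0 <= \big[Order.min/+oo%E]_(u <- finsupp g) (dot x u)%:E)%E =
    all (fun u => 0 <= dot x u) (finsupp g).
  elim: (enum_fset (finsupp g)) => [|u s IH]; first by rewrite big_nil leey.
  by rewrite big_cons le_min IH lee_fin.
by split=> [/allP|H]; last exact/allP.
Qed.

(** By independence, any Laurent polynomial representing the sum has the multiplicity of u in s as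
    coefficient at u. Multiplicities are positive, so no exponent is lost. *)
Lemma trop_nonneg_monomials s :
  trop_nonneg (\sum_(u <- s) monomial u) =
  ([set x | forall u, u \in s -> 0 <= dot x u])%classic.
Proof.
apply/seteqP; split=> x /=.
  move=> [g gE /trop_ge0 H] u us; apply: H.
  pose l := [seq (g v, v) | v <- finsupp g] ++ [seq (-1 : R[i], v) | v <- s].
  have r1 : rep (laurent_fun g) (fun y => \sum_(v <- finsupp g) g v * lmono v y).
    by apply: rep_sum => v _; apply: repM (rep_cst _ _) (rep_monomial v).
  have r2 : rep (laurent_fun g) (fun y => \sum_(v <- s) lmono v y).
    by rewrite gE; apply: rep_sum => v _; apply: rep_monomial.
  have r3 := repD r1 (repM (rep_cst _ (-1)) r2).
  rewrite mpolyCN tofracN mpolyC1 tofrac1 mulN1r subrr in r3.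
  have l0 (y : face r N -> nat) : (forall a, (0 < y a)%N) -> lsum l (fun a => (y a)%:R) = 0.
    move=> y0; have py : cpos (fun a => (y a)%:R : R[i]) by move=> a; rewrite ltr0n.
    rewrite -[RHS](rep_eq0 r3 py) /lsum big_cat !big_map /=; congr (_ + _).
    by rewrite mulr_sumr.
  have := lsum_indep l0 u; rewrite big_cat !big_map /= => e.
  rewrite mem_finsupp; apply: contraTneq us => gu.
  move: e; rewrite big1 ?add0r => [|v /eqP -> //].
  rewrite big_const_seq iter_addr_0 => /eqP; rewrite mulrn_eq0 oppr_eq0 oner_eq0 orbF.
  by rewrite -leqn0 leqNgt -has_count has_pred1.
move=> H.
pose c u : R[i] := (count_mem u s)%:R.
pose g : laurent R r N := [fsfun u in [fset v in s]%fset => c u | 0].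
have gE u : g u = c u.
  rewrite fsfunE inE; case: ifP => // /negbT us.
  by rewrite /c (count_memPn us).
have gs u : (u \in finsupp g) = (u \in s).
  by rewrite mem_finsupp gE /c pnatr_eq0 -lt0n -has_count has_pred1.
exists g; last by apply/trop_ge0 => u; rewrite gs; apply: H.
rewrite /laurent_fun (perm_big (undup s)) /=; last first.
  by apply: uniq_perm; rewrite ?undup_uniq ?fset_uniq // => u; rewrite mem_undup gs.
rewrite -[RHS]big_undup_iterop_count /=.
apply: eq_bigr => u _; rewrite gE /c.
rewrite [tofrac _](_ : _ = (count_mem u s)%:R); last by rewrite !rmorph_nat.
by rewrite mulr_natl.
Qed.

End Monomials.

(** * The right face of a level as an admissible set *)

Section RightFaces.
Variables (r N : nat) (w : N.-tuple 'I_r).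
Hypotheses (inc : increasing (letter w) N) (rw : wordperm w = longest r).
Let u := letter w.

(** Without the letter l the lowest line could never rise above height l, but it has to end at
    height r. *)
Lemma level_occurs l : (0 < size (J w l))%N.
Proof.
rewrite lt0n; apply/negP => /eqP/size0nil Jl.
have no j : u j <> l \/ ~~ (j < N)%N.
  have [jN|] := ltnP j N; last by right.
  left; rewrite -[j]/(val (Ordinal jN)) /u letter_tnth => /val_inj e.
  have : Ordinal jN \in J w l by rewrite mem_filter e eqxx mem_enum.
  by rewrite Jl.
have H t : (t <= N)%N -> (height w t ord0 <= l)%N.
  elim: t => [|t IH] tN; first by rewrite height0.
  rewrite (heightS w (Ordinal tN)) /=; have := IH (ltnW tN); have := no t; rewrite tN /=.
  move: (height w t ord0 : nat) => h; rewrite /u /swp.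
  move: (letter w t) => m [] // n.
  by case: (h =P m) => ?; case: (h =P m.+1) => ?; lia.
have := H N (leqnn _); rewrite (height_end rw) /= subn0.
by have := ltn_ord l; lia.
Qed.

Lemma J_rcons l : exists s j, J w l = rcons s j /\ right_face w l = inr j.
Proof.
have := level_occurs l; rewrite /right_face; case/lastP: (J w l) => // s j _.
by exists s, j; rewrite map_rcons last_rcons.
Qed.

Lemma right_face_neq l : right_face w l != inl l.
Proof. by have [s [j [_ ->]]] := J_rcons l. Qed.

Section Indicator.
Variables (l : 'I_r) (q : 'I_N).
Hypothesis lq : right_face w l = inr q.
Let phi : {ffun 'I_N -> bool} := [ffun j => j == q].
Let i : nat := rev_ord l.

Let uq : u q = l.
Proof. by rewrite /u letter_tnth -[tnth w q]/(level w (inr q)) -lq level_right_face. Qed.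

Let no t : (q < t < N)%N -> u t != l.
Proof.
move=> /andP[qt tN]; apply/negP => /eqP; rewrite -[t]/(val (Ordinal tN)) /u letter_tnth.
move=> /val_inj e; have := @no_letter _ _ w (inr q) (Ordinal tN).
rewrite -lq fend_right_face level_right_face e eqxx lq /= ltnS => H.
by apply: notF; apply: H.
Qed.

Let extE t : ext phi t = (t == q).
Proof.
rewrite /ext; case: insubP => [j _ <-|]; first by rewrite ffunE.
by rewrite -leqNgt => Nt; apply/esym/gtn_eqF/(leq_trans (ltn_ord q)).
Qed.

Let gapE t h : (t <= N)%N -> gap u (ext phi) t h = (q < t)%N && (h == l.+1).
Proof.
elim: t => [//|t IH] tN; rewrite /= extE IH ?(ltnW tN) // ltnS.
have [e|n] := eqVneq t q.
  by rewrite e uq ltnn leqnn; case: eqP.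
have qn : (q == t :> nat) = false by rewrite eq_sym (negPf n).
rewrite [(q <= t)%N]leq_eqVlt qn /=; case: eqP => // ->.
case qt: (q < t)%N => //=; apply/esym; rewrite eqSS; apply/negbTE/no.
by rewrite qt.
Qed.

(** After the last occurrence of l no line passes between the heights l and l+1, so the side of a
    line is the one on which it ends, where the order of the labels is reversed. *)
Let side t h : (q < t)%N -> (t <= N)%N -> (h <= r)%N -> (line u t h <= i)%N = (l < h)%N.
Proof.
have [d dE] : exists d, d = (N - t)%N by exists (N - t)%N.
elim: d t h dE => [|d IH] t h dE qt tN hr.
  have -> : t = N by lia.
  have -> : line u N h = (r - h)%N.
    have := line_reversed (Ordinal (hr : (h < r.+1)%N)) rw.
    by rewrite size_tuple.
  by rewrite /i /=; have := ltn_ord l; lia.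
have tN' : (t < N)%N by lia.
have utl := @no t; rewrite qt tN' in utl; have {utl}/eqP ne := utl isT.
have ur : (u t < r)%N by rewrite -[t]/(val (Ordinal tN')) /u letter_tnth ltn_ord.
have -> : line u t h = line u t.+1 (swp (u t) h) by rewrite /= swpK.
rewrite IH ?leqW //; first by rewrite /swp; do !case: eqP => ?; lia.
- by lia.
by rewrite /swp; do !case: eqP => ?; lia.
Qed.

(** Before crossing q nothing is marked. At q the lower line is leftward and the upper one
    rightward; afterwards all lines above the marked gap are leftward and all lines below it are
    rightward, as required. *)
Lemma adm_right_face : adm w i phi.
Proof.
have ri : (r - i)%N = l.+1 by rewrite /i /= subKn.
apply/andP; split; apply/forallP; last first.
  by move=> h; rewrite -/u gapE // ltn_ord ri.
move=> j; rewrite /crossing_ok -/u !gapE ?(ltnW (ltn_ord j)) // extE.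
have jr : (u j < r)%N by rewrite /u letter_tnth ltn_ord.
have [jq|qj|jq] := ltngtP j q.
- by apply: cross_ok_false; apply: leq_trans; apply/ltnW/inc/ltn_ord.
- rewrite !side ?(ltnW (ltn_ord j)) //; last by rewrite ltnW.
  have /eqP ne := @no j (introT andP (conj qj (ltn_ord j))).
  rewrite eqSS; have -> : (u j == l) = false by apply/eqP.
  have [h|h] := ltnP l (u j).
    by rewrite ltnW //= !eqSS andbT; apply/eqP; lia.
  have -> : (l < (u j).+1)%N = false by lia.
  by rewrite /= andbT implybF; apply/eqP; lia.
rewrite jq uq; have e1 h : line u q h = line u q.+1 (swp (u q) h) by rewrite /= swpK.
rewrite !e1 uq swpL swpR !side ?ltnSn ?ltnn //; last exact: ltnW.
Qed.

End Indicator.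
End RightFaces.

(** * The potential as a sum of monomials, and comparison of the cones *)

Section Potential.
Variables (R : realType) (r N : nat) (w : N.-tuple 'I_r).
Hypotheses (inc : increasing (letter w) N) (rw : wordperm w = longest r).
Local Notation Xf := (@X R r N).
Implicit Types (l i : 'I_r).

Lemma left_sum_neq0 i t : left_sum w i Xf t != 0.
Proof.
have rP u : rep (left_prod w i Xf u) (fun x : face r N -> R[i] => left_prod w i x u).
  apply: rep_prod => v; apply: repV (rep_coord _ _) => x px; exact: lt0r_neq0.
have rS : rep (left_sum w i Xf t) (fun x : face r N -> R[i] => left_sum w i x t).
  by apply: rep_sum => u _; apply: rP.
have pos x u : cpos x -> 0 < left_prod w i (x : face r N -> R[i]) u.
  by move=> px; apply: prodr_gt0 => v _; rewrite invr_gt0.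
apply: rep_neq0 rS _ => x px; rewrite /left_sum big_ord_recl gt_eqF //.
by apply: ltr_pwDl; [exact: pos | apply: sumr_ge0 => u _; exact/ltW/pos].
Qed.

Lemma left_sum_monomials i : left_sum w i Xf (size (J w i)).-1 / Xf (inl i) =
  \sum_(k <- iota 0 (size (J w i))) monomial R (e_seg w i k).
Proof.
have n0 := level_occurs rw i; rewrite /left_sum (prednK n0) mulr_suml.
rewrite -[X in iota 0 X]subn0 -/(index_iota 0 _) big_mkord; apply: eq_bigr => k _.
rewrite /e_seg monomialD !monomialN monomial_e monomial_sum mulrC; congr (_ * _).
rewrite -prodfV /left_prod -[RHS](big_map inr xpredT (fun F => (Xf F)^-1)) map_take.
rewrite (big_nth (inl i)) big_mkord size_takel ?size_map ?(ltnW (ltn_ord k)) //.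
by apply: eq_bigr => v _; rewrite nth_take.
Qed.

Lemma weight_monomial phi : weight Xf phi = monomial R (e_adm r phi).
Proof.
rewrite /e_adm monomialN monomial_sum -prodfV /weight [RHS]big_mkcond.
by apply: eq_bigr.
Qed.

Lemma Theta_monomials i : Theta w i Xf =
  \sum_(u <- [seq e_adm r phi | phi <- enum [pred phi | adm w i phi]]) monomial R u.
Proof.
by rewrite big_map big_enum /=; apply: eq_bigr => phi _; apply: weight_monomial.
Qed.

Lemma frozen_left i : frozen w (inl i : face r N). Proof. by []. Qed.
Lemma frozen_right l : frozen w (right_face w l).
Proof. by rewrite /frozen /right_unbounded fend_right_face eqxx orbT. Qed.

Lemma right_face_inl l i : right_face w l != inl i.
Proof. by have [s [j [_ ->]]] := J_rcons rw l. Qed.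

Lemma sinks_exist f : frozen w f -> exists s : seed R r N, sink_seed w f s.
Proof.
case/orP => [|/right_unboundedP ->].
  by case: f => // i _; exists (left_seed w i R (size (J w i)).-1);
    apply/left_sink_seed/level_occurs.
by have [s [ss _]] := right_sink R inc rw (level w f); exists s.
Qed.

Variable sf : face r N -> seed R r N.
Hypothesis sfP : forall f, frozen w f -> sink_seed w f (sf f).

(** The chosen sink seed is replaced by the explicit one, with the right face of the same level as
    auxiliary frozen face. *)
Lemma theta_left i : theta sf (inl i) =
  \sum_(k <- iota 0 (size (J w i))) monomial R (e_seg w i k).
Proof.
have n0 := level_occurs rw i.
rewrite /theta (sink_seed_coord (frozen_left i) (frozen_right i) _ (sfP (frozen_left i))
  (left_sink_seed R n0)); last by rewrite eq_sym right_face_inl.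
rewrite left_sink_coord // ?left_sum_monomials //; first exact: left_sum_neq0.
exact: X_neq0.
Qed.

Lemma theta_right l : theta sf (right_face w l) = Theta w (rev_ord l) Xf.
Proof.
have [s [ss <-]] := right_sink R inc rw l.
by rewrite /theta (sink_seed_coord (frozen_right l) (frozen_left l) (right_face_inl l l)
  (sfP (frozen_right l)) ss).
Qed.

Definition left_exponents : seq {ffun face r N -> int} :=
  [seq e_seg w i k | i <- enum 'I_r, k <- iota 0 (size (J w i))].
Definition right_exponents : seq {ffun face r N -> int} :=
  [seq u | i <- enum 'I_r, u <- [seq e_adm r phi | phi <- enum [pred phi | adm w i phi]]].

Lemma sum_theta_n : \sum_(i < r) theta_n w sf i =
  \sum_(u <- right_exponents) monomial R u.
Proof.
rewrite big_allpairs_dep big_enum /=; apply: eq_bigr => i _.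
by rewrite /theta_n theta_right rev_ordK Theta_monomials.
Qed.

Lemma W_monomials : W w sf = \sum_(u <- left_exponents ++ right_exponents) monomial R u.
Proof.
(* Frozen faces are split by whether they are unbounded to the left. Every level contains a
   crossing, so no face is unbounded on both sides. *)
rewrite big_cat -sum_theta_n /W (bigID (fun f : face r N => fstart f == 0%N)) /=.
congr (_ + _).
  rewrite big_allpairs_dep big_enum /= big_sumType /= [X in _ + X]big_pred0 ?addr0.
    by apply: eq_bigr => i _; rewrite theta_left.
  by move=> j; rewrite andbF.
rewrite (reindex_inj rev_ord_inj) /=.
rewrite (reindex_onto (right_face w) (level w)) => [|f]; last first.
  by case/andP => /orP[->//|/right_unboundedP].
apply: eq_big => [l|l _]; last by rewrite /theta_n rev_ordK.
rewrite frozen_right level_right_face eqxx andbT /=.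
by have [s [j [_ ->]]] := J_rcons rw l.
Qed.

Lemma dotD (x : {ffun face r N -> R}) u v : dot x (u + v) = dot x u + dot x v.
Proof.
by rewrite /dot -big_split; apply: eq_bigr => F _; rewrite ffunE rmorphD mulrDr.
Qed.

Lemma mem_left u : u \in left_exponents <->
  exists i k, (k < size (J w i))%N /\ u = e_seg w i k.
Proof.
split=> [/allpairsPdep[i [k [_ kn ->]]]|[i [k [kn ->]]]].
  by exists i, k; split=> //; move: kn; rewrite mem_iota.
by apply/allpairsPdep; exists i, k; rewrite mem_enum mem_iota.
Qed.

Lemma mem_right u : u \in right_exponents <-> exists i phi, adm w i phi /\ u = e_adm r phi.
Proof.
split=> [/allpairsPdep[i [v [_ /mapP[phi aphi ->] ->]]]|[i [phi [aphi ->]]]].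
  by exists i, phi; split=> //; move: aphi; rewrite mem_enum.
apply/allpairsPdep; exists i, (e_adm r phi); rewrite mem_enum; split=> //.
by apply/mapP; exists phi; rewrite ?mem_enum.
Qed.

(* The longest segment is the sum of the second longest one and the exponent
   of the right face, which is enclosed by a GP-path. *)
Lemma e_seg_size i : exists k phi, [/\ (k < size (J w i))%N, adm w (rev_ord i) phi &
  e_seg w i (size (J w i)) = e_seg w i k + e_adm r phi].
Proof.
have [s [j [Ji ri]]] := J_rcons rw i.
exists (size s), [ffun j' => j' == j]; split.
- by rewrite Ji size_rcons.
- exact: adm_right_face.
rewrite /e_seg take_size Ji -cats1 take_size_cat // big_cat /= big_seq1 opprD addrA.
congr (_ - _); apply/esym; rewrite (eq_bigl (pred1 j)) ?big_pred1_eq // => j'.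
by rewrite ffunE.
Qed.

Lemma area_coneE x : (forall i p, gp_path w i p -> 0 <= dot x (e_path w i p)) <->
  (forall u, u \in right_exponents -> 0 <= dot (x : {ffun face r N -> R}) u).
Proof.
have E i := @e_path_adm r N w i inc rw (fun u => 0 <= dot x u).
split=> [H u /mem_right[i [phi [a ->]]]|H i].
  by apply: (proj1 (E i)) a; apply: H.
by apply/E => phi a; apply: H; apply/mem_right; exists i, phi.
Qed.

(** The exponents of W give all inequalities of the cone except those of the full segments k = n_i,
    and these follow by [e_seg_size]. *)
Lemma graded_area_cone_Xi : graded_area_cone R w = Xi w sf.
Proof.
rewrite /Xi W_monomials trop_nonneg_monomials; apply/seteqP; split=> x /=.
  move=> [/area_coneE H1 H2] u; rewrite mem_cat => /orP[/mem_left[i [k [kn ->]]]|].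
    by apply: H2; apply: ltnW.
  exact: H1.
move=> H; split.
  by apply/area_coneE => u ur; apply: H; rewrite mem_cat ur orbT.
move=> i k; rewrite leq_eqVlt => /orP[/eqP ->|kn].
  have [k' [phi [kn a ->]]] := e_seg_size i; rewrite dotD addr_ge0 // H // mem_cat.
    by apply/orP; left; apply/mem_left; exists i, k'.
  by apply/orP; right; apply/mem_right; exists (rev_ord i), phi.
by apply: H; rewrite mem_cat; apply/orP; left; apply/mem_left; exists i, k.
Qed.

Lemma area_cone_Xi_hat : area_cone R w = Xi_hat w sf.
Proof.
rewrite /Xi_hat sum_theta_n trop_nonneg_monomials /area_cone; congr (_ `&` _)%classic.
by apply/seteqP; split=> x /=; [move/area_coneE | move=> ?; apply/area_coneE].
Qed.

End Potential.

Theorem corollary2 (R : realType) (r N : nat) (w : N.-tuple 'I_r)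
    (hN : N = (r.+1 * r)./2) (hw : reduced_expression (longest r) w) :
  (forall f : face r N, frozen w f -> exists s : seed R r N, sink_seed w f s)
  /\
  (forall sf : face r N -> seed R r N,
     (forall f : face r N, frozen w f -> sink_seed w f (sf f)) ->
     [/\ graded_area_cone R w = Xi w sf,
         area_cone R w = Xi_hat w sf
       & forall lam : {ffun 'I_r -> R},
           graded_area_fiber w lam = Xi_fiber w sf lam]).
Proof.
have rw : wordperm w = longest r := hw.1.
have inc : increasing (letter w) N.
  by have := @reduced_increasing r w; rewrite size_tuple => /(_ hN rw).
split=> [f|sf sfP]; first exact: sinks_exist.
split=> [||lam]; [exact: graded_area_cone_Xi | exact: area_cone_Xi_hat |].
by rewrite /graded_area_fiber /Xi_fiber (graded_area_cone_Xi inc rw sfP).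
Qed.
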